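(* Let $k$ be a field (not necessarily algebraically closed). Let $Q$ be the (disconnected) quiver with four vertices $1,2,3,4$ and exactly eight arrows: two arrows $1\to 2$, two arrows $2\to 1$, two arrows $3\to 4$ and two arrows $4\to 3$. Let $r\subseteq kQ$ be the two-sided ideal generated by all paths of length $1$, and let $A=kQ/r^2$. Then the mutation quiver $Q(s\tau\text{-tilt } A)$ has exactly $4$ connected components.
   Context: Let $A$ be a finite-dimensional $k$-algebra. $\mathrm{mod}\,A$ denotes finite-dimensional left $A$-modules, identified with representations of the quiver of $A$ (satisfying the relations). $\tau$ is the Auslander-Reiten translation. A module $M$ is $\tau$-rigid if $\mathrm{Hom}_A(M,\tau M)=0$. A module is basic if no two of its nonzero indecomposable summands in a decomposition are isomorphic. $|X|$ is the number of pairwise non-isomorphic indecomposable direct summands of $X$. A $\tau$-rigid pair is a pair $(M,P)$ of basic modules with $M$ $\tau$-rigid, $P$ projective and $\mathrm{Hom}_A(P,M)=0$. It is support $\tau$-tilting if $|M|+|P|=|A|$ and almost complete support $\tau$-tilting if $|M|+|P|=|A|-1$. A pair $(N,R)$ is a summand of $(M,P)$ if $N$ is a summand of $M$ and $R$ is a summand of $P$. Every almost complete support $\tau$-tilting pair is a summand of exactly two distinct (up to isomorphism) support $\tau$-tilting pairs; these two are called mutations of each other. $\mathrm{add}\,M$ is the category of modules all of whose indecomposable summands are summands of $M$, and $\mathrm{Fac}\,M$ is the category of quotients of modules in $\mathrm{add}\,M$. If $T_1=(M_1,P_1)$ and $T_2=(M_2,P_2)$ are mutations of each other, then one of $\mathrm{Fac}\,M_1$,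 $\mathrm{Fac}\,M_2$ is strictly contained in the other; $T_2$ is a left mutation of $T_1$ if $\mathrm{Fac}\,M_2\subset \mathrm{Fac}\,M_1$. The mutation quiver $Q(s\tau\text{-tilt } A)$ has as vertices the isomorphism classes of support $\tau$-tilting pairs over $A$, and an arrow $T_1\to T_2$ exactly when $T_2$ is a left mutation of $T_1$. Connected components are those of the underlying undirected graph. *)

(* Defs.v *)
From HB Require Import structures.
From mathcomp Require Import all_boot all_order all_algebra all_field.
From mathcomp Require Import generic_quotient ring_quotient.
From mathcomp Require Import finmap boolp classical_sets functions cardinality.
From Stdlib Require Import Relation_Operators.

Set Implicit Arguments.
Unset Strict Implicit.
Unset Printing Implicit Defensive.

Import GRing.Theory.
Local Open Scope classical_set_scope.
Local Open Scope card_scope.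
Local Open Scope ring_scope.

Section Ideals.
Variable R : nzRingType.
Implicit Types (I J S : set R).

Definition two_sided_ideal I :=
  [/\ I 0, forall x y, I x -> I y -> I (x + y)
    & forall a x, I x -> I (a * x) /\ I (x * a)].

Definition ideal_gen S : set R :=
  [set x | forall I, two_sided_ideal I -> S `<=` I -> I x].

Definition ideal_mul I J : set R :=
  ideal_gen [set z | exists x y, [/\ I x, J y & z = x * y]].

Lemma ideal_gen_ideal S : two_sided_ideal (ideal_gen S).
Proof.
split.
- by move=> I [].
- move=> x y Sx Sy I II SI; have [_ ID _] := II.
  by apply: ID; [exact: Sx I II SI | exact: Sy I II SI].
- move=> a x Sx; split=> I II SI; have [_ _ /(_ a x (Sx I II SI))[? ?]] := II.
    exact.
  exact.
Qed.

Lemma sub_ideal_gen S : S `<=` ideal_gen S.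
Proof. by move=> x Sx I _; apply. Qed.

Record proper_two_sided_ideal := ProperIdeal {
  ideal_set : set R;
  ideal_setP : two_sided_ideal ideal_set;
  ideal_proper : ~ ideal_set 1 }.

Definition ideal_pred (I : proper_two_sided_ideal) : pred R :=
  fun x => `[< ideal_set I x >].

Fact ideal_pred_zmod (I : proper_two_sided_ideal) : zmod_closed (ideal_pred I).
Proof.
have [I0 ID IM] := ideal_setP I; split; first exact/asboolP.
move=> x y /asboolP Ix /asboolP Iy; apply/asboolP; apply: ID => //.
by rewrite -mulN1r; have [] := IM (-1) y Iy.
Qed.
HB.instance Definition _ (I : proper_two_sided_ideal) :=
  GRing.isZmodClosed.Build R (ideal_pred I) (ideal_pred_zmod I).
Definition ideal_zmod (I : proper_two_sided_ideal) : zmodClosed R :=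
  GRing.ZmodClosed.clone R (ideal_pred I) _.

End Ideals.

Section QuotientAlgebra.
Variables (k : fieldType) (R : algType k) (I : proper_two_sided_ideal R).
Local Open Scope quotient_scope.

Definition quot_alg := {ideal_quot (ideal_zmod I)}.
HB.instance Definition _ := GRing.Zmodule.on quot_alg.
HB.instance Definition _ := Quotient.on quot_alg.

Definition qpi (x : R) : quot_alg := \pi_quot_alg x.
Definition qrepr (x : quot_alg) : R := repr x.

Lemma qreprK x : qpi (qrepr x) = x. Proof. exact: reprK. Qed.

Lemma qpi_eq x y : qpi x = qpi y <-> ideal_set I (x - y).
Proof.
split=> [/eqP|Ixy]; first by rewrite -Quotient.idealrBE => /asboolP.
by apply/eqP; rewrite -Quotient.idealrBE; apply/asboolP.
Qed.

Lemma qreprP x : ideal_set I (qrepr (qpi x) - x).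
Proof. by apply/qpi_eq; rewrite qreprK. Qed.

Lemma qpiD x y : qpi (x + y) = qpi x + qpi y.
Proof. by rewrite /qpi raddfD. Qed.

Definition qone : quot_alg := qpi 1.
Definition qmul (x y : quot_alg) : quot_alg := qpi (qrepr x * qrepr y).
Definition qscale (c : k) (x : quot_alg) : quot_alg := qpi (c *: qrepr x).

Lemma qpiM x y : qmul (qpi x) (qpi y) = qpi (x * y).
Proof.
have [_ ID IM] := ideal_setP I; apply/qpi_eq.
set x' := qrepr _; set y' := qrepr _.
have -> : x' * y' - x * y = x' * (y' - y) + (x' - x) * y.
  by rewrite mulrBr mulrBl addrA subrK.
apply: ID; first by have [] := IM x' _ (qreprP y).
by have [] := IM y _ (qreprP x).
Qed.

Lemma qpiZ c x : qscale c (qpi x) = qpi (c *: x).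
Proof.
have [_ _ IM] := ideal_setP I; apply/qpi_eq; rewrite -scalerBr -mulr_algl.
by have [] := IM c%:A _ (qreprP x).
Qed.

Fact qmulA : associative qmul.
Proof.
move=> x y z; rewrite -[x]qreprK -[y]qreprK -[z]qreprK.
by rewrite !qpiM mulrA.
Qed.
Fact qmul1 : left_id qone qmul.
Proof. by move=> x; rewrite -[x]qreprK qpiM mul1r. Qed.
Fact qmulr1 : right_id qone qmul.
Proof. by move=> x; rewrite -[x]qreprK qpiM mulr1. Qed.
Fact qmulDl : left_distributive qmul +%R.
Proof.
move=> x y z; rewrite -[x]qreprK -[y]qreprK -[z]qreprK.
by rewrite -qpiD !qpiM mulrDl qpiD.
Qed.
Fact qmulDr : right_distributive qmul +%R.
Proof.
move=> x y z; rewrite -[x]qreprK -[y]qreprK -[z]qreprK.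
by rewrite -qpiD !qpiM mulrDr qpiD.
Qed.
Fact qone_neq0 : qone != 0.
Proof.
apply/eqP => h; apply: (@ideal_proper _ I); rewrite -[1]subr0; apply/qpi_eq.
by rewrite -/qone h /qpi raddf0.
Qed.
HB.instance Definition _ := GRing.Zmodule_isNzRing.Build quot_alg
  qmulA qmul1 qmulr1 qmulDl qmulDr qone_neq0.

Fact qscaleA a b x : qscale a (qscale b x) = qscale (a * b) x.
Proof. by rewrite -[x]qreprK !qpiZ scalerA. Qed.
Fact qscale1 : left_id 1 qscale.
Proof. by move=> x; rewrite -[x]qreprK qpiZ scale1r. Qed.
Fact qscaleDr : right_distributive qscale +%R.
Proof.
move=> a x y; rewrite -[x]qreprK -[y]qreprK.
by rewrite -qpiD !qpiZ scalerDr qpiD.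
Qed.
Fact qscaleDl x : {morph qscale^~ x : a b / a + b}.
Proof. by move=> a b; rewrite -[x]qreprK !qpiZ scalerDl qpiD. Qed.
HB.instance Definition _ := GRing.Zmodule_isLmodule.Build k quot_alg
  qscaleA qscale1 qscaleDr qscaleDl.

Fact qscaleAl (a : k) (x y : quot_alg) : a *: (x * y) = a *: x * y.
Proof.
rewrite -[x]qreprK -[y]qreprK.
change (qscale a (qmul (qpi (qrepr x)) (qpi (qrepr y))) =
        qmul (qscale a (qpi (qrepr x))) (qpi (qrepr y))).
by rewrite qpiM !qpiZ qpiM scalerAl.
Qed.
HB.instance Definition _ := GRing.Lmodule_isLalgebra.Build k quot_alg qscaleAl.

Fact qscaleAr (a : k) (x y : quot_alg) : a *: (x * y) = x * (a *: y).
Proof.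
rewrite -[x]qreprK -[y]qreprK.
change (qscale a (qmul (qpi (qrepr x)) (qpi (qrepr y))) =
        qmul (qpi (qrepr x)) (qscale a (qpi (qrepr y)))).
by rewrite qpiM !qpiZ qpiM scalerAr.
Qed.
HB.instance Definition _ := GRing.Lalgebra_isAlgebra.Build k quot_alg qscaleAr.

Fact qpi_zmod_morphism : zmod_morphism qpi.
Proof. by move=> x y; rewrite /qpi raddfB. Qed.
HB.instance Definition _ :=
  GRing.isZmodMorphism.Build R quot_alg qpi qpi_zmod_morphism.
Fact qpi_monoid_morphism : monoid_morphism qpi.
Proof. by split=> // x y; rewrite -qpiM. Qed.
HB.instance Definition _ :=
  GRing.isMonoidMorphism.Build R quot_alg qpi qpi_monoid_morphism.
Fact qpi_scalable : scalable qpi.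
Proof. by move=> a x; rewrite -qpiZ. Qed.
HB.instance Definition _ :=
  GRing.isScalable.Build k R quot_alg *:%R qpi qpi_scalable.

End QuotientAlgebra.

Record quiver := Quiver {
  vertex : finType;
  arrow : finType;
  source : arrow -> vertex;
  target : arrow -> vertex;
  quiver_nonempty : (0 < #|vertex|)%N }.

Section Paths.
Variable Q : quiver.

Fixpoint is_walk (x : vertex Q) (s : seq (arrow Q)) : bool :=
  if s is a :: s' then (source a == x) && is_walk (target a) s' else true.

(* [(x, [:: a1; ...; an])] is the path starting at [x] that goes through [a1]
   first and [an] last; [n = 0] gives the stationary path at [x]. *)
Record qpath := QPath {
  pdata : vertex Q * seq (arrow Q);
  pdataP : is_walk pdata.1 pdata.2 }.
HB.instance Definition _ := [isSub for pdata].
HB.instance Definition _ := [Choice of qpath by <:].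

Implicit Types p q : qpath.

Definition pstart p : vertex Q := (pdata p).1.
Definition pword p : seq (arrow Q) := (pdata p).2.
Definition pend p : vertex Q := last (pstart p) [seq target a | a <- pword p].
Definition plength p : nat := size (pword p).

Definition stationary (x : vertex Q) : qpath :=
  @QPath (x, [::]) isT.

(* Paths compose like functions, so that left modules are representations:
   [pcomp p q] is [q] followed by [p]. *)
Definition pcomp p q : option qpath :=
  if pstart p == pend q then insub (pstart q, pword q ++ pword p) else None.

Lemma is_walk_cat x s t : is_walk x (s ++ t) =
  is_walk x s && is_walk (last x [seq target a | a <- s]) t.
Proof. by elim: s x => //= a s IH x; rewrite IH andbA. Qed.

Variant pcomp_spec p q : option qpath -> Type :=
| PComp r of pstart p = pend q & pstart r = pstart q
           & pword r = pword q ++ pword p : pcomp_spec p q (Some r)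
| PCompNone of pstart p != pend q : pcomp_spec p q None.

Lemma pcompP p q : pcomp_spec p q (pcomp p q).
Proof.
rewrite /pcomp; case: eqP => [e|/eqP]; last exact: PCompNone.
case: insubP => [r _ er|]; first by apply: PComp; rewrite // /pstart /pword er.
rewrite is_walk_cat (pdataP q) /= -/(pend q) -e.
by rewrite (pdataP p).
Qed.

Lemma qpath_eq p q : pstart p = pstart q -> pword p = pword q -> p = q.
Proof.
case: p q => [[x s] wp] [[y t] wq] /= exy est; apply: val_inj => /=.
by congr pair.
Qed.

Lemma pend_cat p q r : pstart p = pend q -> pstart r = pstart q ->
  pword r = pword q ++ pword p -> pend r = pend p.
Proof.
by move=> e er ew; rewrite /pend er ew map_cat last_cat -/(pend q) -e.
Qed.

Lemma pcompA p q r : obind (pcomp p) (pcomp q r) =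
                     obind (pcomp^~ r) (pcomp p q).
Proof.
case: (pcompP q r) => [qr e1 s1 w1|n1] /=;
case: (pcompP p q) => [pq e2 s2 w2|n2] //=.
- have e3 := pend_cat e1 s1 w1.
  case: (pcompP p qr) => [u _ su wu|]; last by rewrite e3 e2 eqxx.
  case: (pcompP pq r) => [v _ sv wv|]; last by rewrite s2 e1 eqxx.
  congr Some; apply: qpath_eq; first by rewrite su sv s1.
  by rewrite wu wv w1 w2 catA.
- case: pcompP => // u e3; move: n2.
  by rewrite e3 (pend_cat e1 s1 w1) eqxx.
- by case: pcompP => // u e3; move: n1; rewrite -e3 s2 eqxx.
Qed.

Lemma pcomp_stationaryl x p :
  pcomp (stationary x) p = if x == pend p then Some p else None.
Proof.
rewrite -[x]/(pstart (stationary x)); case: pcompP => [r -> s w|/negbTE -> //].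
by rewrite eqxx; congr Some; apply: qpath_eq; rewrite // w cats0.
Qed.

Lemma pcomp_stationaryr x p :
  pcomp p (stationary x) = if x == pstart p then Some p else None.
Proof.
rewrite -[x in RHS]/(pend (stationary x)) eq_sym.
case: pcompP => [r e s w|/negbTE -> //].
by rewrite e eqxx; congr Some; apply: qpath_eq; rewrite ?w // s -[LHS]e.
Qed.


Lemma pwordP p : is_walk (pstart p) (pword p). Proof. exact: pdataP. Qed.

Fact is_walk_take i p : is_walk (pstart p) (take i (pword p)).
Proof.
by have := pwordP p; rewrite -{1}(cat_take_drop i (pword p)) is_walk_cat =>
  /andP[].
Qed.

Definition ptake i p : qpath := @QPath (pstart p, take i (pword p))
  (is_walk_take i p).

Fact is_walk_drop i p : is_walk (pend (ptake i p)) (drop i (pword p)).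
Proof.
by have := pwordP p; rewrite -{1}(cat_take_drop i (pword p)) is_walk_cat =>
  /andP[].
Qed.

Definition pdrop i p : qpath := @QPath (pend (ptake i p), drop i (pword p))
  (is_walk_drop i p).

Lemma plength_take i p : (i <= plength p)%N -> plength (ptake i p) = i.
Proof. exact: size_takel. Qed.

Lemma plength_drop i p : plength (pdrop i p) = (plength p - i)%N.
Proof. exact: size_drop. Qed.

Lemma pcomp_drop_take i p : pcomp (pdrop i p) (ptake i p) = Some p.
Proof.
case: pcompP => [r _ s w|]; last by rewrite eqxx.
by congr Some; apply: qpath_eq; rewrite // w cat_take_drop.
Qed.

Lemma pword_take i p : pword (ptake i p) = take i (pword p). Proof. by []. Qed.
Lemma pword_drop i p : pword (pdrop i p) = drop i (pword p). Proof. by []. Qed.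
Lemma pstart_take i p : pstart (ptake i p) = pstart p. Proof. by []. Qed.
Lemma pstart_drop i p : pstart (pdrop i p) = pend (ptake i p).
Proof. by []. Qed.

Lemma pcomp_takeK p q r : pcomp p q = Some r -> ptake (plength q) r = q.
Proof.
case: pcompP => // u e s w [<-]; apply: qpath_eq => //.
by rewrite pword_take w take_size_cat.
Qed.

Lemma pcomp_dropK p q r : pcomp p q = Some r -> pdrop (plength q) r = p.
Proof.
move=> epq; apply: qpath_eq.
  by rewrite pstart_drop (pcomp_takeK epq); case: pcompP epq.
by move: epq; case: pcompP => // u e s w [<-]; rewrite pword_drop w drop_size_cat.
Qed.

Lemma ptake0 p : ptake 0 p = stationary (pstart p).
Proof. by apply: qpath_eq => //; rewrite pword_take take0. Qed.
Lemma pdrop0 p : pdrop 0 p = p.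
Proof. by apply: qpath_eq; rewrite ?pstart_drop ?ptake0 ?pword_drop ?drop0. Qed.
Lemma ptake_all p : ptake (plength p) p = p.
Proof. by apply: qpath_eq => //; rewrite pword_take take_size. Qed.
Lemma pdrop_all p : pdrop (plength p) p = stationary (pend p).
Proof.
by apply: qpath_eq; rewrite ?pstart_drop ?ptake_all ?pword_drop ?drop_size.
Qed.

Lemma ptake_take i j p : (j <= i)%N -> ptake j (ptake i p) = ptake j p.
Proof.
by move=> ji; apply: qpath_eq => //; rewrite !pword_take take_takel.
Qed.
Lemma pdrop_drop i j p : pdrop i (pdrop j p) = pdrop (i + j) p.
Proof.
apply: qpath_eq; last by rewrite !pword_drop drop_drop.
rewrite !pstart_drop /pend !pstart_take !pword_take pword_drop.
rewrite pstart_drop /pend pstart_take pword_take.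
by rewrite -last_cat -map_cat addnC takeD.
Qed.
Lemma ptake_drop i j p : ptake i (pdrop j p) = pdrop j (ptake (i + j) p).
Proof.
apply: qpath_eq; last by rewrite pword_take !pword_drop pword_take take_drop.
by rewrite pstart_take !pstart_drop ptake_take ?leq_addl.
Qed.

End Paths.

Section PathAlgebra.
Variables (k : fieldType) (Q : quiver).
Local Notation path := (qpath Q).
Implicit Types p q r : path.

(* Formal linear combinations of paths. *)
Record path_alg := PathAlg {
  coef : path -> k;
  coefP : `[< finite_set [set p | coef p != 0] >] }.
HB.instance Definition _ := [isSub for coef].
HB.instance Definition _ := [Choice of path_alg by <:].
Implicit Types x y z : path_alg.

Lemma path_algP x y : (forall p, coef x p = coef y p) -> x = y.
Proof. by move=> e; apply: val_inj; apply/funext. Qed.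

Lemma coef_finite x : finite_set [set p | coef x p != 0].
Proof. exact/asboolP/coefP. Qed.

Fact pzero_subproof : `[< finite_set [set p : path | (0 : k) != 0] >].
Proof.
by apply/asboolP; rewrite (_ : mkset _ = set0) // -subset0 => p /=; rewrite eqxx.
Qed.
Definition pzero := @PathAlg (fun=> 0) pzero_subproof.

Fact padd_subproof x y : `[< finite_set [set p | coef x p + coef y p != 0] >].
Proof.
apply/asboolP.
apply: (@sub_finite_set _ _ ([set p | coef x p != 0] `|` [set p | coef y p != 0])).
  move=> p /=; have [->|nx] := eqVneq (coef x p) 0; last by left.
  by rewrite add0r; right.
by rewrite finite_setU; split; apply: coef_finite.
Qed.
Definition padd x y := PathAlg (padd_subproof x y).

Fact pscale_subproof c x : `[< finite_set [set p | c * coef x p != 0] >].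
Proof.
apply/asboolP; apply: sub_finite_set (coef_finite x) => p /=.
by apply: contra_neq => ->; rewrite mulr0.
Qed.
Definition pscale c x := PathAlg (pscale_subproof c x).

Fact paddA : associative padd.
Proof. by move=> x y z; apply: path_algP => p /=; rewrite addrA. Qed.
Fact paddC : commutative padd.
Proof. by move=> x y; apply: path_algP => p /=; rewrite addrC. Qed.
Fact padd0 : left_id pzero padd.
Proof. by move=> x; apply: path_algP => p /=; rewrite add0r. Qed.
Fact paddN : left_inverse pzero (pscale (-1)) padd.
Proof. by move=> x; apply: path_algP => p /=; rewrite mulN1r addNr. Qed.
HB.instance Definition _ :=
  GRing.isZmodule.Build path_alg paddA paddC padd0 paddN.

Fact pscaleA a b x : pscale a (pscale b x) = pscale (a * b) x.
Proof. by apply: path_algP => p /=; rewrite mulrA. Qed.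
Fact pscale1 : left_id 1 pscale.
Proof. by move=> x; apply: path_algP => p /=; rewrite mul1r. Qed.
Fact pscaleDr : right_distributive pscale +%R.
Proof. by move=> a x y; apply: path_algP => p /=; rewrite mulrDr. Qed.
Fact pscaleDl x : {morph pscale^~ x : a b / a + b}.
Proof. by move=> a b; apply: path_algP => p /=; rewrite mulrDl. Qed.
HB.instance Definition _ := GRing.Zmodule_isLmodule.Build k path_alg
  pscaleA pscale1 pscaleDr pscaleDl.

Lemma coef0 p : coef 0 p = 0. Proof. by []. Qed.
Lemma coefD x y p : coef (x + y) p = coef x p + coef y p. Proof. by []. Qed.
Lemma coefZ c x p : coef (c *: x) p = c * coef x p. Proof. by []. Qed.
Lemma coefB x y p : coef (x - y) p = coef x p - coef y p.
Proof. by rewrite coefD -scaleN1r coefZ mulN1r. Qed.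
Lemma coef_sum (J : Type) (s : seq J) (P : pred J) (F : J -> path_alg) p :
  coef (\sum_(j <- s | P j) F j) p = \sum_(j <- s | P j) coef (F j) p.
Proof.
by apply: (big_morph (coef^~ p)) => [x y|]; rewrite ?coefD ?coef0.
Qed.

Fact pvec_subproof p : `[< finite_set [set q : path | (q == p)%:R != 0 :> k] >].
Proof.
apply/asboolP; apply: (@sub_finite_set _ _ [set p]) => // q /=.
by case: (eqVneq q p) => //; rewrite eqxx.
Qed.
Definition pvec p := PathAlg (pvec_subproof p).

Lemma coef_pvec p q : coef (pvec p) q = (q == p)%:R. Proof. by []. Qed.

(* The coefficient of [r] in a product is a sum over the factorisations
   [r = (pdrop i r) o (ptake i r)]; see [pvecM]. *)
Definition mul_coef (f g : path -> k) r : k :=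
  \sum_(i < (plength r).+1) f (pdrop i r) * g (ptake i r).

Fact pmul_subproof x y :
  `[< finite_set [set r | mul_coef (coef x) (coef y) r != 0] >].
Proof.
apply/asboolP.
pose f (u : path * path) := odflt u.1 (pcomp u.1 u.2).
pose S := [set p | coef x p != 0] `*` [set q | coef y q != 0].
apply: (@sub_finite_set _ _ (f @` S)) => [r /= nr|]; last first.
  by apply: finite_image; apply: finite_setX; apply: coef_finite.
have [i ni] : exists i : 'I_(plength r).+1,
    coef x (pdrop i r) * coef y (ptake i r) != 0.
  apply/existsP; apply: contra_neqT nr => /existsPn h.
  by rewrite /mul_coef big1 // => i _; apply/eqP; move: (h i); rewrite negbK.
exists (pdrop i r, ptake i r); last by rewrite /f /= pcomp_drop_take.
split=> /=; apply: contra_neq ni => ->; by rewrite ?mul0r ?mulr0.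
Qed.
Definition pmul x y := PathAlg (pmul_subproof x y).

Definition pone : path_alg := \sum_(v : vertex Q) pvec (stationary v).

Lemma coef_pone p : coef pone p = (plength p == 0)%:R.
Proof.
rewrite /pone coef_sum (eq_bigr (fun v => (p == stationary v)%:R)) //.
case e : (pword p) => [|a s].
  rewrite (bigD1 (pstart p)) //= big1 ?addr0 => [|v nv].
    by rewrite /plength e; case: eqP => // [[]]; exact: qpath_eq.
  by case: eqP => // e'; rewrite e' eqxx in nv.
rewrite /plength e big1 //= => v _.
by case: eqP => // e'; rewrite e' in e.
Qed.

Fact pmulA : associative pmul.
Proof.
move=> x y z; apply: path_algP => r; rewrite /= /mul_coef /=.
set n := plength r.
pose F i j := coef x (pdrop i r) * coef y (pdrop j (ptake i r))
              * coef z (ptake j r).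
transitivity (\sum_(i < n.+1) \sum_(j < n.+1 | (j <= i)%N) F i j).
  apply: eq_bigr => i _; have lin : (i <= n)%N by rewrite -ltnS.
  rewrite /mul_coef plength_take // mulr_sumr.
  rewrite [RHS](_ : _ = \sum_(j < i.+1) F i j); last first.
    by rewrite (big_ord_widen n.+1 (F i)) ?ltnS.
  by apply: eq_bigr => j _; rewrite mulrA /F ptake_take // -ltnS.
rewrite (exchange_big_dep predT) //=; apply: eq_bigr => j _.
rewrite /mul_coef plength_drop mulr_suml -/n.
have ljn : (j <= n)%N by rewrite -ltnS.
rewrite -(big_mkord (fun i => j <= i)%N (F^~ j)).
rewrite -(big_nat_widenl _ _ _ predT) // -[in LHS](add0n j) big_addn subSn //.
rewrite big_mkord; apply: eq_bigr => l _.
by rewrite pdrop_drop ptake_drop.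
Qed.

Fact pmul1l : left_id pone pmul.
Proof.
move=> x; apply: path_algP => r; rewrite /= /mul_coef big_ord_recr /=.
rewrite coef_pone plength_drop subnn eqxx mul1r ptake_all big1 ?add0r //.
move=> i _; rewrite coef_pone plength_drop subn_eq0 leqNgt ltn_ord mul0r.
by [].
Qed.

Fact pmul1r : right_id pone pmul.
Proof.
move=> x; apply: path_algP => r; rewrite /= /mul_coef big_ord_recl /=.
rewrite coef_pone ptake0 eqxx mulr1 pdrop0 big1 ?addr0 // => i _.
by rewrite coef_pone plength_take ?mulr0 // /bump add1n ltn_ord.
Qed.

Fact pmulDl : left_distributive pmul +%R.
Proof.
move=> x y z; apply: path_algP => r; rewrite coefD /= /mul_coef -big_split /=.
by apply: eq_bigr => i _; rewrite mulrDl.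
Qed.

Fact pmulDr : right_distributive pmul +%R.
Proof.
move=> x y z; apply: path_algP => r; rewrite coefD /= /mul_coef -big_split /=.
by apply: eq_bigr => i _; rewrite mulrDr.
Qed.

Definition some_vertex : vertex Q :=
  enum_val (Ordinal (quiver_nonempty Q)).

Fact pone_neq0 : pone != 0.
Proof.
apply/eqP => /(congr1 (coef^~ (stationary some_vertex))) /eqP.
by rewrite coef_pone coef0 oner_eq0.
Qed.

HB.instance Definition _ := GRing.Zmodule_isNzRing.Build path_alg
  pmulA pmul1l pmul1r pmulDl pmulDr pone_neq0.

Lemma coef1 p : coef 1 p = (plength p == 0)%:R. Proof. exact: coef_pone. Qed.
Lemma coefM x y r :
  coef (x * y) r = \sum_(i < (plength r).+1) coef x (pdrop i r) * coef y (ptake i r).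
Proof. by []. Qed.

Fact pscaleAl (c : k) x y : c *: (x * y) = c *: x * y.
Proof.
apply: path_algP => r; rewrite coefZ !coefM mulr_sumr.
by apply: eq_bigr => i _; rewrite mulrA.
Qed.
HB.instance Definition _ :=
  GRing.Lmodule_isLalgebra.Build k path_alg pscaleAl.

Fact pscaleAr (c : k) x y : c *: (x * y) = x * (c *: y).
Proof.
apply: path_algP => r; rewrite coefZ !coefM mulr_sumr.
by apply: eq_bigr => i _; rewrite mulrCA.
Qed.
HB.instance Definition _ :=
  GRing.Lalgebra_isAlgebra.Build k path_alg pscaleAr.

Lemma pvecM p q : pvec p * pvec q = oapp pvec 0 (pcomp p q).
Proof.
apply: path_algP => r; rewrite coefM.
have eqC i : coef (pvec p) (pdrop i r) * coef (pvec q) (ptake i r) =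
    ((pdrop i r == p) && (ptake i r == q))%:R.
  by rewrite !coef_pvec -natrM mulnb.
rewrite (eq_bigr _ (fun (i : 'I__) _ => eqC i)).
have [e|ne] := eqVneq (pcomp p q) (Some r); last first.
  rewrite big1 => [|i _].
    case: pcompP ne => //= s _ _ _ ne.
    by case: eqP => // ers; rewrite ers eqxx in ne.
  case: eqP => //= ep; case: eqP => //= eq.
  by rewrite -ep -eq pcomp_drop_take eqxx in ne.
have lq : (plength q < (plength r).+1)%N.
  rewrite ltnS; case: pcompP e => // u _ _ w [<-].
  by rewrite /plength w size_cat leq_addr.
rewrite e /= eqxx (bigD1 (Ordinal lq)) //= (pcomp_dropK e).
rewrite (pcomp_takeK e) !eqxx big1 ?addr0 // => i ni.
case: (eqVneq (ptake i r) q) => [eq|]; last by rewrite andbF.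
case/eqP: ni; apply: val_inj => /=.
by rewrite -eq plength_take // -ltnS.
Qed.

Lemma path_algE x : exists S : {fset path},
  x = \sum_(p <- S) coef x p *: pvec p.
Proof.
have /finite_fsetP[S eS] := coef_finite x; exists S.
apply: path_algP => q; rewrite coef_sum.
have [qS|qS] := boolP (q \in S).
  rewrite (big_fsetD1 q) // coefZ coef_pvec eqxx mulr1 big1_fset => [|p].
    by rewrite [RHS]addr0.
  rewrite !inE coefZ coef_pvec eq_sym => /andP[/negbTE -> _] _.
  exact: mulr0.
have /eqP -> : coef x q == 0.
  apply: contraNT qS => xq; suff : [set` S] q by [].
  by rewrite -eS.
rewrite big_seq big1 // => p pS.
rewrite coefZ coef_pvec; case: eqP => [e|]; last by rewrite mulr0.
by rewrite e pS in qS.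
Qed.

Definition arrow_ideal : set path_alg :=
  ideal_gen [set x | exists2 p : path, plength p = 1%N & x = pvec p].

Definition arrow_ideal_sq : set path_alg := ideal_mul arrow_ideal arrow_ideal.

Definition long (n : nat) : set path_alg :=
  [set x | forall p, (plength p < n)%N -> coef x p = 0].

Lemma long_mul m n x y : long m x -> long n y -> long (m + n) (x * y).
Proof.
move=> lx ly r lr; rewrite coefM big1 // => i _.
have li : (i <= plength r)%N by rewrite -ltnS.
have [lim|lmi] := ltnP i n; first by rewrite ly ?mulr0 // plength_take.
by rewrite lx ?mul0r // plength_drop ltn_subLR // (leq_trans lr) // addnC leq_add2r.
Qed.

Lemma long_ideal n : two_sided_ideal (long n).
Proof.
split=> [p _|x y lx ly p lp|a x lx]; first exact: coef0.
  by rewrite coefD lx ?ly ?addr0.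
split; first exact: (@long_mul 0).
by rewrite -[n]addn0; apply: long_mul.
Qed.

Lemma arrow_ideal_long : arrow_ideal `<=` long 1.
Proof.
move=> x; apply; first exact: long_ideal.
move=> _ [p lp ->] q lq; rewrite coef_pvec; case: eqP => // e.
by move: lq; rewrite e lp.
Qed.

Lemma arrow_ideal_sqE : arrow_ideal_sq = long 2.
Proof.
have [_ _ rM] : two_sided_ideal arrow_ideal := ideal_gen_ideal _.
have [r0 rD r2M] : two_sided_ideal arrow_ideal_sq := ideal_gen_ideal _.
apply/seteqP; split=> x.
  apply; first exact: long_ideal.
  move=> _ [y [z [ry rz ->]]]; apply: (@long_mul 1 1);
  exact: arrow_ideal_long.
move=> lx; have [S ->] := path_algE x.
apply: (big_ind arrow_ideal_sq) => // p _.
have [->|xp] := eqVneq (coef x p) 0; first by rewrite scale0r.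
rewrite -mulr_algl; apply: (r2M _ _ _).1.
have {xp lx} : (1 < plength p)%N.
  by rewrite ltnNge; apply: contra xp => lp; apply/eqP/lx.
rewrite /plength; case e : (pword p) => [//|a [//|b s]] _.
have := pwordP p; rewrite e /= => /and3P[/eqP sa /eqP sb ws].
pose pa : path := @QPath Q (pstart p, [:: a])
  (introT andP (conj (introT eqP sa) isT)).
pose pb : path := @QPath Q (target a, [:: b])
  (introT andP (conj (introT eqP sb) isT)).
pose ps : path := @QPath Q (target b, s) ws.
have -> : pvec p = (pvec ps * pvec pb) * pvec pa.
  rewrite pvecM; case: pcompP => [r e1 s1 w1|]; last by rewrite eqxx.
  rewrite /= pvecM; case: pcompP => [q e2 s2 w2|]; last by rewrite s1 eqxx.
  rewrite /=; congr pvec; apply: qpath_eq; first by rewrite s2.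
  by rewrite w2 w1 e.
apply: sub_ideal_gen; exists (pvec ps * pvec pb), (pvec pa).
have arr q : plength q = 1%N -> arrow_ideal (pvec q).
  by move=> lq; apply: sub_ideal_gen; exists q.
by split=> //; [apply: (rM _ _ _).1; apply: arr | apply: arr].
Qed.

Fact arrow_ideal_sq_proper : ~ arrow_ideal_sq 1.
Proof.
rewrite arrow_ideal_sqE => /(_ (stationary some_vertex) isT) /eqP.
by rewrite coef1 oner_eq0.
Qed.

Definition rad_sq : proper_two_sided_ideal path_alg :=
  ProperIdeal (ideal_gen_ideal _) arrow_ideal_sq_proper.

Lemma rad_sqE : ideal_set rad_sq = long 2.
Proof. exact: arrow_ideal_sqE. Qed.

Definition rsz_alg := quot_alg rad_sq.
HB.instance Definition _ := GRing.Algebra.on rsz_alg.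

Local Notation short := {: vertex Q + arrow Q}.

Definition short_path (i : short) : path :=
  match i with
  | inl v => stationary v
  | inr a => @QPath Q (source a, [:: a])
               (introT andP (conj (eqxx _) isT))
  end.

Lemma short_path_inj : injective short_path.
Proof.
by move=> [v|a] [w|b] /(congr1 (@pdata Q)) //= => [[->]|[_ ->]].
Qed.

Lemma short_pathP p : (plength p < 2)%N -> exists i, p = short_path i.
Proof.
rewrite /plength; case e : (pword p) => [|a [|//]] _.
  by exists (inl (pstart p)); apply: qpath_eq.
have := pdataP p; rewrite -/(pword p) e /= => /andP[/eqP sa _].
by exists (inr a); apply: qpath_eq; rewrite // /pstart -sa.
Qed.

Definition rsz_coord (x : rsz_alg) : 'rV[k]_#|short| :=
  \row_i coef (qrepr x) (short_path (enum_val i)).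

Lemma rsz_coord_pi (x : path_alg) :
  rsz_coord (qpi rad_sq x) = \row_i coef x (short_path (enum_val i)).
Proof.
apply/rowP => i; rewrite !mxE.
have := qreprP rad_sq x; rewrite rad_sqE.
move=> /(_ (short_path (enum_val i))).
rewrite coefB => h; apply/eqP; rewrite -subr_eq0 h //.
by case: (enum_val i).
Qed.

Fact rsz_coord_linear : linear rsz_coord.
Proof.
move=> c x y; rewrite -[x](qreprK (I := rad_sq)) -[y](qreprK (I := rad_sq)).
rewrite -linearP !rsz_coord_pi; apply/rowP => i.
by rewrite !mxE coefD coefZ.
Qed.

Fact rsz_coord_bij : bijective rsz_coord.
Proof.
pose g (u : 'rV[k]_#|short|) : rsz_alg :=
  qpi rad_sq (\sum_i u 0 i *: pvec (short_path (enum_val i))).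
have sumE (u : 'rV[k]_#|short|) i :
    coef (\sum_j u 0 j *: pvec (short_path (enum_val j)))
      (short_path (enum_val i)) = u 0 i.
  rewrite coef_sum (bigD1 i) // coefZ coef_pvec eqxx mulr1 big1 => [|j nj].
    by rewrite [LHS]addr0.
  rewrite coefZ coef_pvec.
  case: eqP => [/short_path_inj /enum_val_inj e|]; last by rewrite mulr0.
  by rewrite e eqxx in nj.
exists g => [x|u]; last by rewrite rsz_coord_pi; apply/rowP => i; rewrite mxE.
rewrite -[RHS](qreprK (I := rad_sq)); apply/qpi_eq.
rewrite rad_sqE => p /short_pathP[i ->].
by rewrite -[i]enum_rankK coefB sumE mxE subrr.
Qed.

HB.instance Definition _ := Lmodule_hasFinDim.Build k rsz_alg
  (exist2 _ _ rsz_coord rsz_coord_linear rsz_coord_bij).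
HB.instance Definition _ := Algebra_isFalgebra.Build k rsz_alg.

End PathAlgebra.

Section Modules.
Variables (k : fieldType) (A : falgType k).

(* Finite-dimensional modules, up to the choice of a basis: a left module is a
   space of columns on which [a] acts by [v |-> mact M a *m v], a right module
   is a space of rows on which [a] acts by [v |-> v *m ract T a]. *)
Record lmodule := LModule {
  mdim : nat;
  mact : {lrmorphism A -> 'M[k]_mdim} }.

Record rmodule := RModule {
  rdim : nat;
  ract : {lrmorphism A -> 'M[k]_rdim} }.

Implicit Types (M N X Y P : lmodule) (T : rmodule).

(* The k-dual of a right module: the column [c] is the functional
   [v |-> v *m c] on rows, and [(a c) v = c (v a)]. *)
Definition dual T : lmodule := LModule (ract T).

Definition is_hom M N (f : 'M[k]_(mdim N, mdim M)) : Prop :=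
  forall a, f *m mact M a = mact N a *m f.

Definition onto_mx m n (f : 'M[k]_(n, m)) : Prop :=
  forall w : 'cV_n, exists v, w = f *m v.

Definition iso M N : Prop :=
  exists (f : 'M[k]_(mdim N, mdim M)) (g : 'M[k]_(mdim M, mdim N)),
    [/\ is_hom f, is_hom g, f *m g = 1%:M & g *m f = 1%:M].

Section ZeroModule.
Definition zero_act (a : A) : 'M[k]_0 := 0.
Fact zero_act_zmod : zmod_morphism zero_act.
Proof. by move=> a b; rewrite /zero_act subr0. Qed.
HB.instance Definition _ :=
  GRing.isZmodMorphism.Build A 'M[k]_0 zero_act zero_act_zmod.
Fact zero_act_monoid : monoid_morphism zero_act.
Proof. by split=> [|a b]; rewrite [LHS]flatmx0 [RHS]flatmx0. Qed.
HB.instance Definition _ :=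
  GRing.isMonoidMorphism.Build A 'M[k]_0 zero_act zero_act_monoid.
Fact zero_act_scalable : scalable zero_act.
Proof. by move=> c a; rewrite [LHS]flatmx0 [RHS]flatmx0. Qed.
HB.instance Definition _ :=
  GRing.isScalable.Build k A 'M[k]_0 *:%R zero_act zero_act_scalable.
End ZeroModule.

Definition zero_module : lmodule := @LModule 0 zero_act.

Section DirectSum.
Variables M N : lmodule.
Definition dsum_act (a : A) : 'M[k]_(mdim M + mdim N) :=
  block_mx (mact M a) 0 0 (mact N a).
Fact dsum_act_zmod : zmod_morphism dsum_act.
Proof.
by move=> a b; rewrite /dsum_act !raddfB opp_block_mx add_block_mx !oppr0 !addr0.
Qed.
HB.instance Definition _ :=
  GRing.isZmodMorphism.Build A 'M[k]_(mdim M + mdim N) dsum_act dsum_act_zmod.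
Fact dsum_act_monoid : monoid_morphism dsum_act.
Proof.
split=> [|a b]; rewrite /dsum_act ?rmorph1 -?scalar_mx_block // !rmorphM.
by rewrite [RHS]mulmx_block !mulmx0 !mul0mx !addr0 !add0r.
Qed.
HB.instance Definition _ :=
  GRing.isMonoidMorphism.Build A 'M[k]_(mdim M + mdim N)
    dsum_act dsum_act_monoid.
Fact dsum_act_scalable : scalable dsum_act.
Proof. by move=> c a; rewrite /dsum_act !linearZ scale_block_mx !scaler0. Qed.
HB.instance Definition _ :=
  GRing.isScalable.Build k A 'M[k]_(mdim M + mdim N) *:%R
    dsum_act dsum_act_scalable.
Definition dsum : lmodule := @LModule (mdim M + mdim N) dsum_act.
End DirectSum.

Section RegularModule.
Let b := vbasis {:A}.
Definition reg_act (a : A) : 'M[k]_(\dim {:A}) :=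
  \matrix_(i, j) coord b i (a * b`_j).
Fact reg_act_zmod : zmod_morphism reg_act.
Proof.
by move=> x y; apply/matrixP => i j; rewrite !mxE mulrBl linearB.
Qed.
HB.instance Definition _ :=
  GRing.isZmodMorphism.Build A 'M[k]_(\dim {:A}) reg_act reg_act_zmod.
Fact reg_act_monoid : monoid_morphism reg_act.
Proof.
split=> [|x y]; apply/matrixP => i j; rewrite !mxE.
  by rewrite mul1r coord_free ?(basis_free (vbasisP _)) // eq_sym.
rewrite -mulrA {1}(coord_vbasis (memvf (y * b`_j))) mulr_sumr linear_sum.
apply: eq_bigr => l _; rewrite !mxE -scalerAr linearZ /=.
by rewrite mulrC.
Qed.
HB.instance Definition _ :=
  GRing.isMonoidMorphism.Build A 'M[k]_(\dim {:A}) reg_act reg_act_monoid.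
Fact reg_act_scalable : scalable reg_act.
Proof.
by move=> c x; apply/matrixP => i j; rewrite !mxE -scalerAl linearZ.
Qed.
HB.instance Definition _ :=
  GRing.isScalable.Build k A 'M[k]_(\dim {:A}) *:%R reg_act reg_act_scalable.
End RegularModule.

Definition regular_module : lmodule := @LModule (\dim {:A}) reg_act.

Definition indecomposable X : Prop :=
  (0 < mdim X)%N /\
  forall Y Z, iso X (dsum Y Z) -> mdim Y = 0%N \/ mdim Z = 0%N.

Definition summand N M : Prop := exists N', iso M (dsum N N').

Definition basic M : Prop :=
  exists n (X : 'I_n -> lmodule),
  [/\ forall i, indecomposable (X i),
      iso M (\big[dsum/zero_module]_(i < n) X i)
    & forall i j, i != j -> ~ iso (X i) (X j)].

Definition iso_class X : set lmodule := [set Y | iso X Y].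

(* [num_summands M n] states that |M| = n. *)
Definition num_summands M (n : nat) : Prop :=
  iso_class @` [set X | indecomposable X /\ summand X M] #= `I_n.

Definition projective P : Prop :=
  forall M N (g : 'M_(mdim N, mdim M)) (h : 'M_(mdim N, mdim P)),
    is_hom g -> is_hom h -> onto_mx g ->
    exists2 h' : 'M_(mdim M, mdim P), is_hom h' & h = g *m h'.

(* [f : P -> N] is a projective cover of its image (when [P] is projective):
   a map [h] into [P] is onto as soon as [f h] and [f] have the same image. *)
Definition essential P N (f : 'M[k]_(mdim N, mdim P)) : Prop :=
  forall X (h : 'M_(mdim P, mdim X)), is_hom h ->
    (forall v : 'cV_(mdim P), exists u : 'cV_(mdim X), f *m v = f *m (h *m u)) ->
    onto_mx h.

(* P1 -f-> P0 -p-> M -> 0 *)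
Definition min_proj_presentation M P1 P0
    (f : 'M[k]_(mdim P0, mdim P1)) (p : 'M[k]_(mdim M, mdim P0)) : Prop :=
  [/\ projective P1 /\ projective P0,
      is_hom f /\ is_hom p,
      onto_mx p,
      forall v : 'cV_(mdim P0), p *m v = 0 <-> exists u, v = f *m u
    & essential f /\ essential p].

(* Hom_A(P, A), a right module under [(g a) v = g v * a]. *)
Definition hom_to_alg P : set 'Hom('cV[k]_(mdim P), A) :=
  [set g | forall a v, g (mact P a *m v) = a * g v].

(* [T] is the cokernel of [Hom_A(f, A) : Hom_A(P0, A) -> Hom_A(P1, A)], for a
   minimal projective presentation [f] of [M]; [c] is the cokernel map. *)
Definition is_transpose M T : Prop :=
  exists P1 P0 (f : 'M_(mdim P0, mdim P1)) (p : 'M_(mdim M, mdim P0)),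
  min_proj_presentation f p /\
  exists c : {linear 'Hom('cV[k]_(mdim P1), A) -> 'rV[k]_(rdim T)},
  [/\ forall g a, hom_to_alg g -> c (amulr a \o g)%VF = c g *m ract T a,
      forall w, exists2 g, hom_to_alg g & c g = w
    & forall g, hom_to_alg g ->
        (c g = 0 <-> exists2 h : 'Hom('cV[k]_(mdim P0), A),
                       hom_to_alg h & g = (h \o linfun (mulmx f))%VF)].

(* [N] is the Auslander-Reiten translate D Tr M. *)
Definition is_tau M N : Prop :=
  exists2 T, is_transpose M T & iso N (dual T).

Definition tau_rigid M : Prop :=
  exists2 N, is_tau M N &
    forall f : 'M_(mdim N, mdim M), is_hom f -> f = 0.

Definition mpair := (lmodule * lmodule)%type.
Implicit Types U V : mpair.

Definition tau_rigid_pair U : Prop :=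
  [/\ basic U.1 /\ basic U.2, tau_rigid U.1, projective U.2
    & forall f : 'M_(mdim U.1, mdim U.2), is_hom f -> f = 0].

Definition support_tau_tilting U : Prop :=
  tau_rigid_pair U /\
  exists m p, [/\ num_summands U.1 m, num_summands U.2 p
                & num_summands regular_module (m + p)].

Definition almost_complete U : Prop :=
  tau_rigid_pair U /\
  exists m p, [/\ num_summands U.1 m, num_summands U.2 p
                & num_summands regular_module (m + p).+1].

Definition pair_iso U V : Prop := iso U.1 V.1 /\ iso U.2 V.2.

Definition pair_summand U V : Prop := summand U.1 V.1 /\ summand U.2 V.2.

Definition mutation U V : Prop :=
  [/\ support_tau_tilting U, support_tau_tilting V, ~ pair_iso U V
    & exists W, [/\ almost_complete W, pair_summand W U & pair_summand W V]].

Definition add_cat M : set lmodule :=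
  [set N | forall X, indecomposable X -> summand X N -> summand X M].

Definition Fac M : set lmodule :=
  [set Y | exists2 N, add_cat M N &
             exists2 g : 'M_(mdim Y, mdim N), is_hom g & onto_mx g].

(* [V] is a left mutation of [U]. *)
Definition left_mutation U V : Prop := mutation U V /\ Fac V.1 `<` Fac U.1.

Definition pair_class U : set mpair := [set V | pair_iso U V].

Definition mut_vertices : set (set mpair) :=
  pair_class @` [set U | support_tau_tilting U].

Definition mut_arrow (C D : set mpair) : Prop :=
  exists U V, [/\ C = pair_class U, D = pair_class V & left_mutation U V].

Definition mut_component (C : set mpair) : set (set mpair) :=
  [set D | mut_vertices D /\ clos_refl_sym_trans _ mut_arrow C D].

Definition mut_components : set (set (set mpair)) :=
  mut_component @` mut_vertices.

End Modules.

Arguments mut_components {k} A.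

(* The vertices 1, 2, 3, 4 are the ordinals 0, 1, 2, 3; the two arrows starting
   at [i] are [(i, true)] and [(i, false)], and they end at [swap i]. *)
Definition swap (i : 'I_4) : 'I_4 :=
  match val i with
  | 0 => inord 1
  | 1 => inord 0
  | 2 => inord 3
  | _ => inord 2
  end.

Definition Q4 : quiver :=
  @Quiver 'I_4 ('I_4 * bool)%type fst (fun a => swap a.1)
    (etrans (congr1 (leq 1) (card_ord 4)) isT).

(* Main.v *)
Require Import Defs.
From HB Require Import structures.
From mathcomp Require Import all_boot all_order all_algebra all_field.
From mathcomp Require Import boolp classical_sets functions cardinality.
From mathcomp Require Import zify.
From Stdlib Require Import Relation_Operators.

Set Implicit Arguments.
Unset Strict Implicit.
Unset Printing Implicit Defensive.

Import GRing.Theory.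
Local Open Scope classical_set_scope.
Local Open Scope card_scope.
Local Open Scope ring_scope.

(** The quiver has two blocks, [{0, 1}] and [{2, 3}], and [swap] exchanges the
    vertices of a block.  As paths of length two vanish, an indecomposable module
    has its top at a single vertex [i] and its radical at [swap i], so it is a
    pair of matrices [Y], written [kron i Y], whose structure map [phi Y] from
    two copies of the top to the radical is onto ([indecomposable_kron]).

    A tau-rigid module has no extensions by its own quotients
    ([tau_rigid_retract_splits]).  Applied to [kron i Y], this says that [Y] has
    no self-extensions as a representation of the Kronecker quiver, and then
    [Y] is preprojective or preinjective: this is proved by reflecting [Y], that
    is by replacing it by the kernel of its structure map
    ([krigid_classification]).  Conversely minimal projective presentations are
    explicit for these modules, and tau-rigidity of a sum of them is read off
    from extension groups ([kron_presentation], [tau_rigid_dsums]).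

    The g-vectors of the indecomposable tau-rigid modules and of the shifted
    projectives are, in each block, the integral points of the two lines
    [a + b = 1] and [a + b = -1].  Two of them are compatible when they lie in
    different blocks, or when they are equal or adjacent on the same line
    ([compat], [tau_rigid_pair_rays], [clique_tau_rigid_pair]).  So a support
    tau-tilting pair consists, in each block, of two adjacent points of one line
    ([clique_quadP]).

    A mutation exchanges one point for the one on the other side of its
    neighbour, and thus moves the pair by one step along its line; all these
    steps are left mutations in one direction or the other, the module that is
    removed being characterised by the fact that its top is not reached from the
    new pair ([exchange_arrow], [quad_step]).  Since three of the four points
    meet both blocks, a mutation never changes the line chosen in a block
    ([labelled_mutation]).  The components are therefore given by the choice of
    one of two lines in each of the two blocks. *)

(** * Modules, direct sums and the Krull-Schmidt theorem *)

Notation mhom M N f := (@is_hom _ _ M N f).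

HB.instance Definition _ (k : fieldType) (A : falgType k) := gen_eqMixin (lmodule A).

Section Modules.
Variables (k : fieldType) (A : falgType k).
Implicit Types (M N X Y Z : lmodule A).

Section FromRepresentation.
Variables (n : nat) (f : A -> 'M[k]_n).
Hypotheses (fL : linear f) (f1 : f 1 = 1%:M).
Hypothesis fM : forall a b, f (a * b) = f a *m f b.

Fact rep_monoid : monoid_morphism f. Proof. by split. Qed.

Definition rep_morphism : {lrmorphism A -> 'M[k]_n} :=
  HB.pack f (GRing.isLinear.Build k A 'M[k]_n *:%R f fL)
    (GRing.isMonoidMorphism.Build A 'M[k]_n f rep_monoid).

Definition rep_module : lmodule A := LModule rep_morphism.

End FromRepresentation.

Lemma mactM M a b : mact M (a * b) = mact M a *m mact M b.
Proof. exact: rmorphM. Qed.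
Lemma mact1 M : mact M 1 = 1%:M. Proof. exact: rmorph1. Qed.
Lemma mactD M a b : mact M (a + b) = mact M a + mact M b.
Proof. exact: rmorphD. Qed.
Lemma mactZ M c a : mact M (c *: a) = c *: mact M a.
Proof. exact: linearZ. Qed.
Lemma mact_sum M (J : Type) (s : seq J) (P : pred J) (F : J -> A) :
  mact M (\sum_(j <- s | P j) F j) = \sum_(j <- s | P j) mact M (F j).
Proof. exact: linear_sum. Qed.

Lemma hom1 M : mhom M M 1%:M. Proof. by move=> a; rewrite mul1mx mulmx1. Qed.
Lemma hom0 M N : mhom M N 0. Proof. by move=> a; rewrite mul0mx mulmx0. Qed.
Lemma homM M N X f g : mhom M N f -> mhom N X g -> mhom M X (g *m f).
Proof. by move=> Hf Hg a; rewrite -mulmxA Hf !mulmxA Hg. Qed.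
Lemma homD M N f g : mhom M N f -> mhom M N g -> mhom M N (f + g).
Proof. by move=> Hf Hg a; rewrite mulmxDl mulmxDr Hf Hg. Qed.
Lemma homZ M N c f : mhom M N f -> mhom M N (c *: f).
Proof. by move=> Hf a; rewrite -scalemxAl -scalemxAr Hf. Qed.
Lemma homN M N f : mhom M N f -> mhom M N (- f).
Proof. by move=> Hf; rewrite -scaleN1r; exact: homZ. Qed.
Lemma homB M N f g : mhom M N f -> mhom M N g -> mhom M N (f - g).
Proof. by move=> Hf Hg; apply: homD => //; apply: homN. Qed.
Lemma hom_sum M N (J : Type) (s : seq J) (P : pred J) F :
  (forall j, P j -> mhom M N (F j)) -> mhom M N (\sum_(j <- s | P j) F j).
Proof.
by move=> HF; apply: (big_ind (fun f => mhom M N f)) => //;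
  [exact: hom0 | exact: homD].
Qed.

Lemma iso_refl M : iso M M.
Proof. by exists 1%:M, 1%:M; split; rewrite ?mulmx1 //; apply: hom1. Qed.
Lemma iso_sym M N : iso M N -> iso N M.
Proof. by move=> [f [g [? ? ? ?]]]; exists g, f. Qed.
Lemma iso_trans M N X : iso M N -> iso N X -> iso M X.
Proof.
move=> [f [g [Hf Hg fg gf]]] [f' [g' [Hf' Hg' fg' gf']]].
exists (f' *m f), (g *m g'); split; try by apply: homM; eassumption.
  by rewrite mulmxA -(mulmxA f') fg mulmx1.
by rewrite mulmxA -(mulmxA g) gf' mulmx1.
Qed.

(** Being a direct summand, in the form of a split inclusion; it avoids carrying
    a complement along. *)
Definition retract X M : Prop :=
  exists i p, [/\ mhom X M i, mhom M X p & p *m i = 1%:M].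

Lemma retract_refl M : retract M M.
Proof. by exists 1%:M, 1%:M; split; rewrite ?mulmx1 //; apply: hom1. Qed.
Lemma retract_trans X Y Z : retract X Y -> retract Y Z -> retract X Z.
Proof.
move=> [i [p [Hi Hp pi]]] [i' [p' [Hi' Hp' pi']]].
exists (i' *m i), (p *m p'); split; try by apply: homM; eassumption.
by rewrite mulmxA -(mulmxA p) pi' mulmx1.
Qed.
Lemma iso_retract X Y : iso X Y -> retract X Y.
Proof. by move=> [f [g [? ? ? ?]]]; exists f, g. Qed.
Lemma retract_iso_l X X' M : iso X X' -> retract X M -> retract X' M.
Proof. by move=> /iso_sym/iso_retract; apply: retract_trans. Qed.
Lemma retract_iso_r X M M' : iso M M' -> retract X M -> retract X M'.
Proof. by move=> /iso_retract h /retract_trans; apply. Qed.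

Lemma hom_row M N X f g : mhom M X f -> mhom N X g -> mhom (dsum M N) X (row_mx f g).
Proof.
move=> Hf Hg a; rewrite mul_mx_row -Hf -Hg.
by rewrite [LHS]mul_row_block !mulmx0 addr0 add0r.
Qed.
Lemma hom_col M N X f g : mhom X M f -> mhom X N g -> mhom X (dsum M N) (col_mx f g).
Proof.
move=> Hf Hg a; rewrite mul_col_mx Hf Hg.
by rewrite [RHS]mul_block_col !mul0mx addr0 add0r.
Qed.

Section DirectSums.
Variables M N : lmodule A.

Definition inl_mx : 'M[k]_(mdim (dsum M N), mdim M) := col_mx 1%:M 0.
Definition inr_mx : 'M[k]_(mdim (dsum M N), mdim N) := col_mx 0 1%:M.
Definition prl_mx : 'M[k]_(mdim M, mdim (dsum M N)) := row_mx 1%:M 0.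
Definition prr_mx : 'M[k]_(mdim N, mdim (dsum M N)) := row_mx 0 1%:M.

Lemma inl_hom : mhom M (dsum M N) inl_mx.
Proof. by apply: hom_col; [exact: hom1 | exact: hom0]. Qed.
Lemma inr_hom : mhom N (dsum M N) inr_mx.
Proof. by apply: hom_col; [exact: hom0 | exact: hom1]. Qed.
Lemma prl_hom : mhom (dsum M N) M prl_mx.
Proof. by apply: hom_row; [exact: hom1 | exact: hom0]. Qed.
Lemma prr_hom : mhom (dsum M N) N prr_mx.
Proof. by apply: hom_row; [exact: hom0 | exact: hom1]. Qed.
Lemma prl_inl : prl_mx *m inl_mx = 1%:M.
Proof. by rewrite mul_row_col mulmx1 mulmx0 addr0. Qed.
Lemma prr_inr : prr_mx *m inr_mx = 1%:M.
Proof. by rewrite mul_row_col mulmx1 mulmx0 add0r. Qed.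
Lemma prl_inr : prl_mx *m inr_mx = 0.
Proof. by rewrite mul_row_col mul1mx mul0mx addr0. Qed.
Lemma prr_inl : prr_mx *m inl_mx = 0.
Proof. by rewrite mul_row_col mul1mx mul0mx add0r. Qed.
Lemma in_pr : inl_mx *m prl_mx + inr_mx *m prr_mx = 1%:M.
Proof.
rewrite !mul_col_row !mulmx0 !mul0mx !mulmx1 add_block_mx !addr0 !add0r.
by rewrite -scalar_mx_block.
Qed.

Lemma retract_inl : retract M (dsum M N).
Proof.
by exists inl_mx, prl_mx; split; [exact: inl_hom|exact: prl_hom|exact: prl_inl].
Qed.
Lemma retract_inr : retract N (dsum M N).
Proof.
by exists inr_mx, prr_mx; split; [exact: inr_hom|exact: prr_hom|exact: prr_inr].
Qed.
End DirectSums.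
#[local] Opaque inl_mx inr_mx prl_mx prr_mx.

(** Lets decompositions be built and used through their inclusions and
    projections. *)
Lemma iso_dsumP M X Y :
  iso M (dsum X Y) <->
  exists iX iY pX pY, [/\ mhom X M iX, mhom Y M iY, mhom M X pX & mhom M Y pY] /\
    [/\ pX *m iX = 1%:M, pY *m iY = 1%:M, pX *m iY = 0, pY *m iX = 0
      & iX *m pX + iY *m pY = 1%:M].
Proof.
split=> [[f [g [Hf Hg fg gf]]]|].
  exists (g *m inl_mx X Y), (g *m inr_mx X Y), (prl_mx X Y *m f), (prr_mx X Y *m f).
  split; first by split; apply: homM; eauto using inl_hom, inr_hom, prl_hom, prr_hom.
  split; rewrite ?mulmxA -?(mulmxA _ f) ?fg ?mulmx1.
  - exact: prl_inl.
  - exact: prr_inr.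
  - exact: prl_inr.
  - exact: prr_inl.
  - by rewrite -mulmxDl -!(mulmxA g) -mulmxDr in_pr mulmx1.
move=> [iX [iY [pX [pY [[HiX HiY HpX HpY] [eX eY eXY eYX e1]]]]]].
exists (inl_mx X Y *m pX + inr_mx X Y *m pY), (iX *m prl_mx X Y + iY *m prr_mx X Y).
split.
- by apply: homD; apply: homM; eauto using inl_hom, inr_hom.
- by apply: homD; apply: homM; eauto using prl_hom, prr_hom.
- rewrite mulmxDl !mulmxDr !mulmxA -!(mulmxA _ pX) -!(mulmxA _ pY) eX eY eXY eYX.
  by rewrite !(mulmx0, mul0mx, mulmx1, mul1mx) addr0 add0r in_pr.
- rewrite mulmxDl !mulmxDr !mulmxA -!(mulmxA iX) -!(mulmxA iY).
  rewrite prl_inl prr_inr prl_inr prr_inl.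
  by rewrite !(mulmx0, mul0mx, mulmx1, mul1mx) addr0 add0r e1.
Qed.

Lemma dsum_iso M M' N N' : iso M M' -> iso N N' -> iso (dsum M N) (dsum M' N').
Proof.
move=> [f [g [Hf Hg fg gf]]] [f' [g' [Hf' Hg' fg' gf']]].
apply/iso_dsumP.
exists (inl_mx M N *m g), (inr_mx M N *m g'), (f *m prl_mx M N), (f' *m prr_mx M N).
split.
  by split; apply: homM; eauto using inl_hom, inr_hom, prl_hom, prr_hom.
split.
- by rewrite mulmxA -(mulmxA f) prl_inl mulmx1.
- by rewrite mulmxA -(mulmxA f') prr_inr mulmx1.
- by rewrite mulmxA -(mulmxA f) prl_inr mulmx0 mul0mx.
- by rewrite mulmxA -(mulmxA f') prr_inl mulmx0 mul0mx.
- by rewrite !mulmxA -(mulmxA _ g) -(mulmxA _ g') gf gf' !mulmx1 in_pr.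
Qed.

Lemma dsumC M N : iso (dsum M N) (dsum N M).
Proof.
apply/iso_dsumP.
exists (inr_mx M N), (inl_mx M N), (prr_mx M N), (prl_mx M N).
split; first by split; eauto using inl_hom, inr_hom, prl_hom, prr_hom.
by split; eauto using prl_inl, prr_inr, prl_inr, prr_inl; rewrite addrC in_pr.
Qed.

Lemma dsumA M N X : iso (dsum M (dsum N X)) (dsum (dsum M N) X).
Proof.
apply/iso_sym/iso_dsumP.
exists (inl_mx _ X *m inl_mx M N).
exists (row_mx (inl_mx _ X *m inr_mx M N) (inr_mx (dsum M N) X)).
exists (prl_mx M N *m prl_mx _ X).
exists (col_mx (prr_mx M N *m prl_mx _ X) (prr_mx (dsum M N) X)).
split; split.
- by apply: homM; eauto using inl_hom, inr_hom.
- by apply: hom_row; [apply: homM | ]; eauto using inl_hom, inr_hom.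
- by apply: homM; eauto using prl_hom.
- by apply: hom_col; [apply: homM | ]; eauto using prl_hom, prr_hom.
- rewrite mulmxA -(mulmxA (prl_mx M N)) prl_inl.
  by rewrite [_ *m 1%:M]mulmx1 prl_inl.
- rewrite mul_col_row !mulmxA -!(mulmxA (prr_mx M N)) prl_inl prl_inr.
  by rewrite prr_inl prr_inr mul1mx mulmx0 mul0mx prr_inr -scalar_mx_block.
- rewrite mul_mx_row -!mulmxA prl_inr (mulmxA (prl_mx (dsum M N) X)).
  by rewrite prl_inl mul1mx prl_inr mulmx0 row_mx0.
- rewrite mul_col_mx !mulmxA -(mulmxA (prr_mx _ _)) prl_inl [_ *m 1%:M]mulmx1 prr_inl.
  by rewrite prr_inl mul0mx col_mx0.
- rewrite mul_row_col addrA -!mulmxA -mulmxDr !mulmxA -mulmxDl in_pr mul1mx.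
  exact: in_pr.
Qed.

Lemma dsum0 M : iso (dsum M (zero_module A)) M.
Proof.
apply/iso_sym/iso_dsumP; exists 1%:M, 0, 1%:M, 0.
split; first by split; try exact: hom1; exact: hom0.
split; rewrite ?mulmx0 ?mul0mx ?mulmx1 ?addr0 //.
by apply/matrixP => -[].
Qed.

(** The image of an idempotent endomorphism, as a module in coordinates. *)
Section Cut.
Variables (M : lmodule A) (n : nat).
Variables (p : 'M[k]_(n, mdim M)) (i : 'M[k]_(mdim M, n)).
Hypotheses (pi : p *m i = 1%:M) (ip : mhom M M (i *m p)).

Fact cut_linear : linear (fun a => p *m mact M a *m i).
Proof.
move=> c a b; rewrite mactD mactZ mulmxDr mulmxDl.
by rewrite -scalemxAr -scalemxAl.
Qed.
Fact cut1 : p *m mact M 1 *m i = 1%:M. Proof. by rewrite mact1 mulmx1. Qed.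
Fact cutM a b :
  p *m mact M (a * b) *m i = (p *m mact M a *m i) *m (p *m mact M b *m i).
Proof.
have e : p *m mact M a *m i *m p = p *m mact M a.
  by rewrite -!mulmxA -ip !mulmxA pi mul1mx.
by rewrite mactM !mulmxA e.
Qed.

Definition cut_module : lmodule A := rep_module cut_linear cut1 cutM.

Lemma cut_in : mhom cut_module M i.
Proof. by move=> a; rewrite /= !mulmxA ip -!mulmxA pi mulmx1. Qed.
Lemma cut_pr : mhom M cut_module p.
Proof. by move=> a; rewrite /= -!mulmxA -ip !mulmxA pi mul1mx. Qed.
End Cut.

Lemma full_rank_idempotent n r (e : 'M[k]_n) (c : 'M_(n, r)) d g h :
  c *m d = e -> e *m e = e -> d *m g = 1%:M -> h *m c = 1%:M -> d *m c = 1%:M.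
Proof.
move=> <- ee dg hc; have {}ee : c *m d *m c *m d = c *m d by rewrite -mulmxA.
transitivity (h *m (c *m d *m c *m d) *m g).
  by rewrite !mulmxA hc mul1mx -!mulmxA dg mulmx1.
by rewrite ee !mulmxA hc mul1mx dg.
Qed.

Lemma idempotent_factor n (e : 'M[k]_n) : e *m e = e ->
  exists r (c : 'M_(n, r)) d, [/\ r = \rank e, c *m d = e & d *m c = 1%:M].
Proof.
move=> ee; exists (\rank e), (col_base e), (row_base e).
split; [by [] | exact: mulmx_base | ].
have /row_freeP[g rg] := row_base_free e.
have /row_fullP[h hc] := col_base_full e.
exact: (full_rank_idempotent (mulmx_base e) ee rg hc).
Qed.

Lemma idempotent_splits M e : mhom M M e -> e *m e = e ->
  exists X, exists2 i, mhom X M i & exists2 p, mhom M X p &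
    [/\ p *m i = 1%:M, i *m p = e & mdim X = \rank e].
Proof.
move=> He /idempotent_factor[r [i [p [rE ip pi]]]].
have Hip : mhom M M (i *m p) by rewrite ip.
exists (cut_module pi Hip), i; first exact: cut_in.
by exists p; first exact: cut_pr.
Qed.

Lemma retract_complement X M i p : mhom X M i -> mhom M X p -> p *m i = 1%:M ->
  exists2 Y, iso M (dsum X Y) & mdim Y = \rank (1%:M - i *m p).
Proof.
move=> Hi Hp pi; pose e := 1%:M - i *m p.
have pe : p *m e = 0 by rewrite mulmxBr mulmx1 mulmxA pi mul1mx subrr.
have ei : e *m i = 0 by rewrite mulmxBl mul1mx -mulmxA pi mulmx1 subrr.
have He : mhom M M e by apply: homB; [exact: hom1 | exact: homM].
have ee : e *m e = e by rewrite mulmxBl mul1mx -mulmxA pe mulmx0 subr0.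
have [Y [j Hj [q Hq [qj jq dY]]]] := idempotent_splits He ee.
exists Y => //; apply/iso_dsumP; exists i, j, p, q; split=> //; split=> //.
- by rewrite -[j]mulmx1 -qj !mulmxA -(mulmxA p) jq pe mul0mx.
- by rewrite -[q]mul1mx -qj -!mulmxA (mulmxA j) jq ei mulmx0.
- by rewrite jq /e addrC subrK.
Qed.

Lemma summandP X M : summand X M <-> retract X M.
Proof.
split=> [[Y /iso_dsumP[i [_ [p [_ [[Hi _ Hp _] [pi _ _ _ _]]]]]]]|].
  by exists i, p.
by move=> [i [p [Hi Hp pi]]]; have [Y] := retract_complement Hi Hp pi; exists Y.
Qed.

Lemma iso_mdim X Y : iso X Y -> mdim X = mdim Y.
Proof.
move=> [f [g [_ _ fg gf]]]; apply/eqP; rewrite eqn_leq.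
have := mulmx1_min gf; have := mulmx1_min fg.
by move=> -> ->.
Qed.

Lemma iso_flat X Y : mdim X = 0%N -> mdim Y = 0%N -> iso X Y.
Proof.
move=> x0 y0; exists 0, 0; split; try exact: hom0.
  by apply/matrixP => i; have := ltn_ord i; rewrite {2}y0.
by apply/matrixP => i; have := ltn_ord i; rewrite {2}x0.
Qed.

Lemma indec_idem X e : indecomposable X -> mhom X X e -> e *m e = e ->
  e = 0 \/ e = 1%:M.
Proof.
move=> [_ Xi] He ee.
have [Y [i Hi [p Hp [pi ip dY]]]] := idempotent_splits He ee.
have [Z /Xi[YZ|] dZ] := retract_complement Hi Hp pi.
  by left; apply/eqP; rewrite -mxrank_eq0 -dY YZ.
rewrite dZ ip => /esym/eqP; rewrite mxrank_eq0 subr_eq0 => /eqP <-; by right.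
Qed.

Lemma idem_indec X : (0 < mdim X)%N ->
  (forall e, mhom X X e -> e *m e = e -> e = 0 \/ e = 1%:M) -> indecomposable X.
Proof.
move=> X0 Xi; split=> // Y Z.
move/iso_dsumP=> [i [j [p [q [[Hi Hj Hp Hq] [pi qj pj qi e1]]]]]].
have [||e|e] := Xi (i *m p).
- exact: homM.
- by rewrite mulmxA -(mulmxA i) pi mulmx1.
- left; have : p *m i *m (p *m i) = 0 by rewrite mulmxA -(mulmxA p) e mulmx0 mul0mx.
  rewrite pi mulmx1 => /(congr1 (fun x => \rank x)).
  by rewrite mxrank1 mxrank0.
- right; have jq : j *m q = 0 by move: e1; rewrite e => /(canRL (addKr _)); rewrite addNr.
  have : q *m j *m (q *m j) = 0 by rewrite mulmxA -(mulmxA q) jq mulmx0 mul0mx.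
  rewrite qj mulmx1 => /(congr1 (fun x => \rank x)).
  by rewrite mxrank1 mxrank0.
Qed.

Lemma indec_iso X Y : iso X Y -> indecomposable X -> indecomposable Y.
Proof.
move=> XY [X0 Xi]; split=> [|Z T YZT]; first by rewrite -(iso_mdim XY).
exact/Xi/(iso_trans XY).
Qed.

Lemma hom_inv X Y f : mhom X Y f -> forall g, f *m g = 1%:M -> g *m f = 1%:M ->
  mhom Y X g.
Proof.
move=> Hf g fg gf a; rewrite -[LHS]mulmx1 -fg.
by rewrite !mulmxA -(mulmxA g) -Hf !mulmxA gf mul1mx.
Qed.

(** Fitting's lemma.  If [char_poly f] divides ['X^m * q] with [q] prime to
    ['X], a Bezout relation between the two factors gives an idempotent
    polynomial in [f], which must be [0] or [1]. *)
Lemma fitting X f : indecomposable X -> mhom X X f ->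
  f \in unitmx \/ (1%:M - f) \in unitmx.
Proof.
case: X f => [[|n] act] f Xi Hf; first by case: Xi.
set X := LModule act in Xi Hf *.
have [m [q q0 chi]] := multiplicity_XsubC (char_poly f) 0.
rewrite monic_neq0 ?char_poly_monic //= in q0.
rewrite subr0 in chi.
have cop : coprimep ('X^(m.+1)) q.
  rewrite coprimep_expl // coprimep_sym.
  have -> : 'X = 'X - (0 : k)%:P by rewrite subr0.
  by rewrite coprimep_XsubC.
have /Bezout_eq1_coprimepP[[u v] /= uv] := cop.
have Xq0 : horner_mx f ('X^(m.+1) * q) = 0.
  rewrite exprS -mulrA [X in 'X * X]mulrC -chi rmorphM /=.
  by rewrite (Cayley_Hamilton f) mulr0.
have polyH w : mhom X X (horner_mx f w).
  move=> a; have: comm_mx (mact X a) f by rewrite /comm_mx -Hf.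
  by move/comm_mx_horner => /(_ w) ->.
set e := horner_mx f (u * 'X^(m.+1)).
have e1 : 1%:M - e = horner_mx f (v * q).
  by rewrite -[1%:M](rmorph1 (horner_mx f)) -uv rmorphD /= addrC addKr.
have ee : e *m e = e.
  apply/eqP; rewrite -subr_eq0 -[X in _ - X]mulmx1 -mulmxBr -opprB e1 mulmxN.
  rewrite oppr_eq0 /e -[_ *m _]rmorphM /= mulrACA rmorphM /= Xq0 mulr0.
  by rewrite eqxx.
have [e0|e0] := indec_idem Xi (polyH _) ee.
- right; have fm0 : f ^+ m.+1 = 0.
    have: horner_mx f 'X^(m.+1) *m horner_mx f (v * q) = 0.
      by rewrite -[_ *m _]rmorphM /= mulrCA rmorphM /= Xq0 mulr0.
    by rewrite -e1 (_ : e = 0) // subr0 mulmx1 rmorphXn /= horner_mx_X.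
  have := subrX1 f m.+1; rewrite fm0 sub0r -(opprB 1 f) mulNr => /oppr_inj/esym.
  by case/mulmx1_unit.
- left; move: e0; rewrite /e rmorphM exprSr rmorphM /= horner_mx_X mulrA.
  by move=> /mulmx1_unit[].
Qed.

(** Division by the unit [f + g] reduces to [fitting]. *)
Lemma fitting_add X f g : indecomposable X -> mhom X X f -> mhom X X g ->
  f + g \in unitmx -> f \in unitmx \/ g \in unitmx.
Proof.
move=> Xi Hf Hg u; pose h := invmx (f + g).
have Hh : mhom X X h.
  by apply: (hom_inv (homD Hf Hg)); rewrite ?mulmxV ?mulVmx.
have : h *m f + h *m g = 1%:M by rewrite -mulmxDr mulVmx.
move=> /(canRL (addKr _)); rewrite addrC => hg.
have uh : h \in unitmx by rewrite unitmx_inv.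
have [] := fitting Xi (homM Hf Hh).
  by rewrite unitmx_mul uh; left.
by rewrite -hg unitmx_mul uh; right.
Qed.

Lemma retract_unit X Y i p : mhom X Y i -> mhom Y X p -> p *m i \in unitmx ->
  retract X Y.
Proof.
move=> Hi Hp u; exists (i *m invmx (p *m i)), p; split=> //; last first.
  by rewrite mulmxA mulmxV.
apply: (homM _ Hi); apply: (hom_inv (homM Hi Hp)); by rewrite ?mulmxV ?mulVmx.
Qed.

(** The exchange property behind the Krull-Schmidt theorem: the identity of [X] is
    the sum of the endomorphisms through [Y] and through [Z], and one of them is
    invertible. *)
Lemma retract_dsum X Y Z : indecomposable X -> retract X (dsum Y Z) ->
  retract X Y \/ retract X Z.
Proof.
move=> Xi [i [p [Hi Hp pi]]].
have Hl := homM Hi (@prl_hom Y Z); have Hr := homM Hi (@prr_hom Y Z).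
have Hl' := homM (@inl_hom Y Z) Hp; have Hr' := homM (@inr_hom Y Z) Hp.
have [||] := fitting_add Xi (homM Hl Hl') (homM Hr Hr').
- rewrite !mulmxA -mulmxDl -!(mulmxA p) -mulmxDr in_pr mulmx1 pi.
  exact: unitmx1.
- by move/(retract_unit Hl Hl'); left.
- by move/(retract_unit Hr Hr'); right.
Qed.

Lemma retract0 X : (0 < mdim X)%N -> ~ retract X (zero_module A).
Proof.
move=> X0 [i [p [_ _ pi]]]; have := mulmx1_min pi.
by rewrite leqn0 => /eqP X00; rewrite X00 in X0.
Qed.

Lemma retract_indec X Y : (0 < mdim X)%N -> indecomposable Y -> retract X Y ->
  iso X Y.
Proof.
move=> X0 Yi [i [p [Hi Hp pi]]].
have [|e|e] := indec_idem Yi (homM Hp Hi).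
- by rewrite mulmxA -(mulmxA i) pi mulmx1.
- have : p *m i *m (p *m i) = 0 by rewrite mulmxA -(mulmxA p) e mulmx0 mul0mx.
  rewrite pi mulmx1 => /(congr1 (fun x => \rank x)).
  by rewrite mxrank1 mxrank0 => X00; rewrite X00 in X0.
- by exists i, p.
Qed.

Definition dsums (s : seq (lmodule A)) : lmodule A := foldr (@dsum _ _) (zero_module A) s.

Lemma big_dsums n (X : 'I_n -> lmodule A) :
  \big[@dsum _ A/zero_module A]_(i < n) X i = dsums [seq X i | i <- index_enum 'I_n].
Proof. by rewrite unlock; elim: (index_enum _) => //= i s ->. Qed.

Lemma dsums_cat s1 s2 : iso (dsums (s1 ++ s2)) (dsum (dsums s1) (dsums s2)).
Proof.
elim: s1 => [|X s IH] /=.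
  exact: iso_trans (iso_sym (dsum0 _)) (dsumC _ _).
apply: iso_trans (dsum_iso (iso_refl X) IH) _; exact: dsumA.
Qed.

Lemma retract_dsums X s : X \in s -> retract X (dsums s).
Proof.
elim: s => //= Y s IH; rewrite inE => /predU1P[->|/IH XM]; first exact: retract_inl.
exact: retract_trans XM (@retract_inr _ _).
Qed.

Lemma retract_dsums_indec X s : indecomposable X ->
  (forall Y, Y \in s -> indecomposable Y) -> retract X (dsums s) ->
  exists2 Y, Y \in s & iso X Y.
Proof.
move=> Xi; have [X0 _] := Xi.
elim: s => [|Y s IH] si /=; first by move/(retract0 X0).
move=> /(retract_dsum Xi)[XY|/IH[]].
- exists Y; rewrite ?inE ?eqxx //; apply: retract_indec => //.
  by apply: si; rewrite inE eqxx.
- by move=> Z sZ; apply: si; rewrite inE sZ orbT.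
- by move=> Z sZ XZ; exists Z; rewrite // inE sZ orbT.
Qed.

Lemma decomposition M :
  exists2 s, forall X, X \in s -> indecomposable X & iso M (dsums s).
Proof.
have [n] := ubnP (mdim M); elim: n M => // n IH M; rewrite ltnS => Mn.
have [M0|M0] := posnP (mdim M).
  by exists [::] => //; apply: iso_flat.
have [Mi|] := pselect (indecomposable M).
  exists [:: M]; last exact: iso_sym (dsum0 M).
  by move=> X; rewrite inE => /eqP ->.
move=> /not_andP[//|] /existsNP[Y] /existsNP[Z] /not_implyP[MYZ].
move=> /not_orP[/eqP Y0 /eqP Z0].
have := iso_mdim MYZ; rewrite /= => dM.
rewrite -!lt0n in Y0 Z0.
have [|s si Ys] := IH Y.
  by rewrite (leq_trans _ Mn) // dM -[X in (X < _)%N]addn0 ltn_add2l.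
have [|t ti Zt] := IH Z.
  by rewrite (leq_trans _ Mn) // dM -[X in (X < _)%N]add0n ltn_add2r.
exists (s ++ t) => [X|].
  by rewrite mem_cat => /orP[/si|/ti].
apply: iso_trans MYZ (iso_trans (dsum_iso Ys Zt) _).
exact: iso_sym (dsums_cat _ _).
Qed.
End Modules.

(** * Projective modules and dual bases *)

Section ColumnMaps.
Variable k : fieldType.

Lemma eq_mulmxcV m n (f g : 'M[k]_(m, n)) : (forall v : 'cV_n, f *m v = g *m v) -> f = g.
Proof. by move=> fg; apply/trmx_inj/row_matrixP => i; rewrite -!tr_col !colE fg. Qed.

Lemma mulmx_cVP m n p (f : 'M[k]_(m, n)) (g : 'M[k]_(m, p)) :
  (forall v : 'cV_n, exists u, f *m v = g *m u) -> exists h, f = g *m h.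
Proof.
move=> fg; have /choice[u Hu] j := fg (delta_mx j 0).
exists (\matrix_(i, j) u j i 0); apply/trmx_inj/row_matrixP => j.
rewrite -!tr_col !colE Hu -mulmxA -colE; congr (_ *m _)^T.
by apply/colP => i; rewrite !mxE.
Qed.

Lemma ontoP m n (f : 'M[k]_(n, m)) : onto_mx f <-> exists g, f *m g = 1%:M.
Proof.
split=> [fo|[g fg] w]; last by exists (g *m w); rewrite mulmxA fg mul1mx.
have [|g fg] := @mulmx_cVP _ _ _ (1%:M : 'M_n) f.
  by move=> v; rewrite mul1mx; have [u ->] := fo v; exists u.
by exists g.
Qed.

Definition cmx m n (F : 'cV[k]_m -> 'cV[k]_n) : 'M[k]_(n, m) :=
  \matrix_(i, j) F (delta_mx j 0) i 0.

Lemma cmxE m n (F : 'cV[k]_m -> 'cV[k]_n) : linear F -> forall v, cmx F *m v = F v.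
Proof.
move=> FL v; pose G : {linear 'cV[k]_m -> 'cV[k]_n} :=
  HB.pack F (GRing.isLinear.Build k _ _ *:%R F FL).
rewrite -[F v]/(G v) [in RHS](_ : v = \sum_j v j 0 *: delta_mx j 0); last first.
  rewrite [LHS]matrix_sum_delta; apply: eq_bigr => i _.
  by rewrite big_ord1.
apply/colP => i; rewrite linear_sum summxE !mxE; apply: eq_bigr => j _.
by rewrite linearZ !mxE mulrC.
Qed.
End ColumnMaps.

Section Subspaces.
Variables (k : fieldType) (vT : vectType k).

Lemma linfun_exists (wT : vectType k) (F : vT -> wT) : linear F ->
  exists f : 'Hom(vT, wT), forall v, f v = F v.
Proof.
move=> FL; pose G : {linear vT -> wT} := HB.pack F (GRing.isLinear.Build k _ _ *:%R F FL).
by exists (linfun G) => v; rewrite lfunE.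
Qed.

(** Take a subspace of maximal dimension among those contained in [S]. *)
Lemma vspace_of_set (S : set vT) : S 0 ->
  (forall c u v, S u -> S v -> S (c *: u + v)) ->
  exists U : {vspace vT}, forall v, v \in U <-> S v.
Proof.
move=> S0 SL.
pose sub (U : {vspace vT}) := forall v, v \in U -> S v.
have sub0 : sub 0%VS by move=> v; rewrite memv0 => /eqP ->.
have [n] := ubnP (\dim {:vT} - \dim (0%VS : {vspace vT}))%N.
elim: n (0%VS : {vspace vT}) sub0 => // n IH U Us; rewrite ltnS => Un.
have [SU|] := pselect (forall v, S v -> v \in U).
  by exists U => v; split; [exact: Us | exact: SU].
move=> /existsNP[v /not_implyP[Sv /negP vU]].
apply: (IH (U + <[v]>)%VS).
  move=> _ /memv_addP[u uU [_ /vlineP[c ->] ->]].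
  by rewrite addrC; apply: SL => //; apply: Us.
apply: leq_trans Un; apply: ltn_sub2l.
  rewrite ltnNge; apply/negP => le; move: vU.
  have /eqP -> : U == fullv by rewrite eqEdim subvf.
  by rewrite memvf.
rewrite ltn_neqAle dimvS ?addvSl // andbT.
rewrite (dimv_leqif_sup (addvSl U <[v]>)).2; apply: contra vU.
by move/subvP; apply; apply: (subvP (addvSr U _)); apply: memv_line.
Qed.

(** A coordinate of the projection along [U]. *)
Lemma separating_functional (U : {vspace vT}) u : u \notin U ->
  exists Phi : vT -> k, [/\ forall c v w, Phi (c *: v + w) = c * Phi v + Phi w,
    forall v, v \in U -> Phi v = 0 & Phi u != 0].
Proof.
move=> uU; pose p v := v - projv U v.
have pU : p u != 0.
  by apply: contra uU; rewrite subr_eq0 => /eqP ->; apply: memv_proj.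
have [i pi] : exists i, coord (vbasis {:vT}) i (p u) != 0.
  apply/existsP; apply: contra_neqT pU => /existsPn h.
  rewrite (coord_vbasis (memvf (p u))) big1 // => i _.
  by have := h i; rewrite negbK => /eqP ->; rewrite scale0r.
exists (fun v => coord (vbasis {:vT}) i (p v)); split=> // [c v w|v vU].
  have -> : p (c *: v + w) = c *: p v + p w.
    by rewrite /p linearP scalerBr opprD addrACA.
  by rewrite linearP.
by rewrite /p projv_id // subrr linear0.
Qed.
End Subspaces.

Section Projectives.
Variables (k : fieldType) (A : falgType k).
Implicit Types (M N P X Y E : lmodule A) (T : rmodule A).

Lemma hom_ext_onto M N X (p : 'M[k]_(mdim N, mdim M)) (f g : 'M[k]_(mdim X, mdim N)) :
  onto_mx p -> f *m p = g *m p -> f = g.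
Proof. by move=> /ontoP[q pq] fg; rewrite -[f]mulmx1 -pq mulmxA fg -mulmxA pq mulmx1. Qed.

Definition tens_fun P M (g : 'Hom('cV[k]_(mdim P), A)) (m : 'cV[k]_(mdim M)) v :=
  mact M (g v) *m m.

Fact tens_linear P M g m : linear (@tens_fun P M g m).
Proof. by move=> c u v; rewrite /tens_fun linearP mactD mactZ mulmxDl scalemxAl. Qed.

(** The homomorphism [v |-> g(v) m] from [P] to [M], for [g] in the dual
    [Hom(P, A)]. *)
Definition tens P M g m := cmx (@tens_fun P M g m).

Lemma tensE P M g m v : @tens P M g m *m v = mact M (g v) *m m.
Proof. exact: cmxE (tens_linear _ _) v. Qed.

Lemma tens_hom P M g m : hom_to_alg g -> mhom P M (tens g m).
Proof.
move=> Hg a; apply: eq_mulmxcV => v.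
by rewrite -!mulmxA !tensE Hg mactM -mulmxA.
Qed.

Lemma mul_tens P M N g m (f : 'M_(mdim N, mdim M)) : mhom M N f ->
  f *m @tens P M g m = tens g (f *m m).
Proof.
by move=> Hf; apply: eq_mulmxcV => v; rewrite -mulmxA !tensE mulmxA Hf mulmxA.
Qed.

Lemma tens_mul P Q M g m (f : 'M_(mdim P, mdim Q)) :
  @tens P M g m *m f = tens (g \o linfun (mulmx f))%VF m.
Proof.
by apply: eq_mulmxcV => v; rewrite -mulmxA !tensE comp_lfunE lfunE.
Qed.

Lemma tens_amulr P M g m a :
  tens (amulr a \o g)%VF m = @tens P M g (mact M a *m m).
Proof.
by apply: eq_mulmxcV => v; rewrite !tensE comp_lfunE lfunE /= mactM mulmxA.
Qed.

Lemma tensDr P M g m m' : @tens P M g (m + m') = tens g m + tens g m'.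
Proof. by apply: eq_mulmxcV => v; rewrite mulmxDl !tensE mulmxDr. Qed.
Lemma tensZr P M g c m : @tens P M g (c *: m) = c *: tens g m.
Proof. by apply: eq_mulmxcV => v; rewrite -scalemxAl !tensE -scalemxAr. Qed.
Lemma tensDl P M g g' m : @tens P M (g + g') m = tens g m + tens g' m.
Proof. by apply: eq_mulmxcV => v; rewrite mulmxDl !tensE lfunE /= mactD mulmxDl. Qed.
Lemma tensZl P M g c m : @tens P M (c *: g) m = c *: tens g m.
Proof.
by apply: eq_mulmxcV => v; rewrite -scalemxAl !tensE lfunE /= mactZ scalemxAl.
Qed.

Lemma hom_to_alg0 P : hom_to_alg (0 : 'Hom('cV[k]_(mdim P), A)).
Proof. by move=> a v; rewrite !lfunE /= mulr0. Qed.
Lemma hom_to_algP P c (g h : 'Hom('cV[k]_(mdim P), A)) :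
  hom_to_alg g -> hom_to_alg h -> hom_to_alg (c *: g + h).
Proof.
move=> Hg Hh a v; rewrite !lfunE /= !lfunE /= Hg Hh.
by rewrite mulrDr scalerAr.
Qed.
Lemma hom_to_alg_amulr P a (g : 'Hom('cV[k]_(mdim P), A)) :
  hom_to_alg g -> hom_to_alg (amulr a \o g)%VF.
Proof. by move=> Hg b v; rewrite !comp_lfunE !lfunE /= Hg mulrA. Qed.
Lemma hom_to_alg_comp P Q (g : 'Hom('cV[k]_(mdim P), A)) f :
  mhom Q P f -> hom_to_alg g -> hom_to_alg (g \o linfun (mulmx f))%VF.
Proof. by move=> Hf Hg b v; rewrite !comp_lfunE !lfunE /= mulmxA Hf -mulmxA Hg. Qed.

(** A finite dual basis identifies [Hom(P, M)] with [Hom(P, A) (x) M], which is what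
    the computation of maps into the translate uses. *)
Definition dual_basis P : Prop := exists (J : finType)
    (g : J -> 'Hom('cV[k]_(mdim P), A)) (y : J -> 'cV[k]_(mdim P)),
  (forall j, hom_to_alg (g j)) /\ \sum_j tens (g j) (y j) = 1%:M.

Lemma dual_basis_projective P : dual_basis P -> projective P.
Proof.
move=> [J [g [y [Hg gy]]]] M N f h Hf Hh fo.
have /choice[m Hm] j := fo (h *m y j).
exists (\sum_j tens (g j) (m j)); first by apply: hom_sum => j _; exact: tens_hom.
rewrite mulmx_sumr -[h]mulmx1 -gy mulmx_sumr; apply: eq_bigr => j _.
by rewrite !mul_tens // Hm.
Qed.

Lemma dual_basis_retract P Q : retract P Q -> dual_basis Q -> dual_basis P.
Proof.
move=> [i [p [Hi Hp pi]]] [J [g [y [Hg gy]]]].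
exists J, (fun j => (g j \o linfun (mulmx i))%VF), (fun j => p *m y j).
split=> [j|]; first exact: hom_to_alg_comp.
rewrite -pi -[X in _ = X *m _]mulmx1 -gy mulmx_sumr mulmx_suml; apply: eq_bigr => j _.
by rewrite -tens_mul mul_tens.
Qed.

Lemma dual_basis0 : dual_basis (zero_module A).
Proof.
exists void, (fun=> 0), (fun=> 0); split=> [[]|].
by apply/matrixP => -[].
Qed.

Lemma dual_basis_dsum P Q : dual_basis P -> dual_basis Q -> dual_basis (dsum P Q).
Proof.
move=> [J [g [y [Hg gy]]]] [J' [g' [y' [Hg' gy']]]].
exists (J + J')%type, (fun j => match j with
    | inl j => (g j \o linfun (mulmx (prl_mx P Q)))%VF
    | inr j => (g' j \o linfun (mulmx (prr_mx P Q)))%VF end),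
  (fun j => match j with inl j => inl_mx P Q *m y j | inr j => inr_mx P Q *m y' j end).
split=> [[j|j]|].
- by apply: hom_to_alg_comp => //; exact: prl_hom.
- by apply: hom_to_alg_comp => //; exact: prr_hom.
rewrite big_sumType /= -in_pr; congr (_ + _).
  rewrite -[X in _ = X *m _]mulmx1 -gy mulmx_sumr mulmx_suml; apply: eq_bigr => j _.
  by rewrite -tens_mul mul_tens //; exact: inl_hom.
rewrite -[X in _ = X *m _]mulmx1 -gy' mulmx_sumr mulmx_suml; apply: eq_bigr => j _.
by rewrite -tens_mul mul_tens //; exact: inr_hom.
Qed.

Section Regular.
Let b := vbasis {:A}.

Definition reg_coord (a : A) : 'cV[k]_(\dim {:A}) := \col_i coord b i a.

Lemma reg_elem : exists g : 'Hom('cV[k]_(mdim (regular_module A)), A),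
  [/\ hom_to_alg g, forall v, reg_coord (g v) = v & forall a, g (reg_coord a) = a].
Proof.
have [g gE] : exists g : 'Hom('cV[k]_(mdim (regular_module A)), A),
    forall v, g v = \sum_(i < \dim {:A}) v i 0 *: b`_i.
  apply: linfun_exists => c u v; rewrite scaler_sumr -big_split /=.
  by apply: eq_bigr => i _; rewrite !mxE scalerDl scalerA.
have gK v : reg_coord (g v) = v.
  apply/colP => i; rewrite mxE gE linear_sum (bigD1 i) //=.
  rewrite linearZ /= coord_free ?(basis_free (vbasisP _)) // eqxx mulr1.
  rewrite big1 ?addr0 // => j ji.
  rewrite linearZ /= coord_free ?(basis_free (vbasisP _)) //.
  by rewrite -(inj_eq val_inj) eq_sym in ji *; rewrite (negbTE ji) mulr0.
have Kg a : g (reg_coord a) = a.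
  rewrite gE [RHS](coord_vbasis (memvf a)).
  by apply: eq_bigr => i _; rewrite mxE.
exists g; split=> // a v.
rewrite -[RHS]Kg; congr (g _); apply/colP => i; rewrite !mxE.
rewrite gE mulr_sumr linear_sum; apply: eq_bigr => j _.
by rewrite -scalerAr linearZ /= !mxE mulrC.
Qed.

Lemma dual_basis_regular : dual_basis (regular_module A).
Proof.
have [g [Hg gK Kg]] := reg_elem.
exists unit, (fun=> g), (fun=> reg_coord 1); split=> //.
rewrite big_const card_unit /= addr0; apply: eq_mulmxcV => v.
rewrite [LHS](@tensE (regular_module A) (regular_module A)) mul1mx -[LHS]gK Hg Kg mulr1.
exact: gK.
Qed.
End Regular.

Lemma regular_map M (m : 'cV[k]_(mdim M)) :
  exists2 f, mhom (regular_module A) M f & f *m reg_coord 1 = m.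
Proof.
have [g [Hg gK Kg]] := reg_elem.
by exists (tens g m); [exact: tens_hom | rewrite tensE Kg mact1 mul1mx].
Qed.

(** A projective module is a retract of the sum of copies of the regular module
    that maps onto it by sending the units to a basis. *)
Lemma projective_dual_basis P : projective P -> dual_basis P.
Proof.
move=> PP.
have free (s : seq 'cV[k]_(mdim P)) : exists F f, [/\ dual_basis F, mhom F P f &
    forall v, v \in s -> exists u, v = f *m u].
  elim: s => [|v s [F [f [DF Hf fs]]]].
    by exists (zero_module A), 0; split=> //; [exact: dual_basis0 | exact: hom0].
  have [g Hg gv] := regular_map v.
  exists (dsum (regular_module A) F), (row_mx g f); split.
  - exact: dual_basis_dsum dual_basis_regular DF.
  - exact: hom_row.
  - move=> w; rewrite inE => /predU1P[->|/fs[u ->]].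
      by exists (col_mx (reg_coord 1) 0); rewrite mul_row_col gv mulmx0 addr0.
    by exists (col_mx 0 u); rewrite mul_row_col mulmx0 add0r.
have [F [f [DF Hf fs]]] := free [seq delta_mx j 0 | j <- enum 'I_(mdim P)].
have fo : onto_mx f.
  move=> w; have fu : forall j : 'I_(mdim P), exists u : 'cV_(mdim F), delta_mx j 0 = f *m u.
    by move=> j; apply: fs; apply/mapP; exists j; rewrite ?mem_enum.
  have [u Hu] := choice fu; exists (\sum_j w j 0 *: u j); rewrite mulmx_sumr [LHS]matrix_sum_delta.
  by apply: eq_bigr => j _; rewrite big_ord1 -scalemxAr Hu.
have [i Hi fi] := PP _ _ f 1%:M Hf (@hom1 _ _ P) fo.
by apply: dual_basis_retract DF; exists i, f.
Qed.

Lemma projectiveP P : projective P <-> dual_basis P.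
Proof. by split; [exact: projective_dual_basis | exact: dual_basis_projective]. Qed.

Lemma projective_retract P Q : retract P Q -> projective Q -> projective P.
Proof. by rewrite !projectiveP; exact: dual_basis_retract. Qed.
Lemma projective_dsum P Q : projective P -> projective Q -> projective (dsum P Q).
Proof. by rewrite !projectiveP; exact: dual_basis_dsum. Qed.
Lemma projective0 : projective (zero_module A).
Proof. exact/projectiveP/dual_basis0. Qed.
Lemma projective_regular : projective (regular_module A).
Proof. exact/projectiveP/dual_basis_regular. Qed.
End Projectives.

(** * Maps into the Auslander-Reiten translate *)

Section Tau.
Variables (k : fieldType) (A : falgType k).
Implicit Types (M N P X Y E : lmodule A) (T : rmodule A).

Lemma rmul_mx m n (f : 'M[k]_(m, n)) (g : 'M[k]_(m, n)) :
  (forall (w : 'rV_m) (v : 'cV_n), w *m f *m v = w *m g *m v) -> f = g.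
Proof.
move=> fg; apply: eq_mulmxcV => v; apply/row_matrixP => i.
by rewrite !rowE !mulmxA.
Qed.

Section Cokernel.
Variables (M P1 P0 : lmodule A) (f : 'M[k]_(mdim P0, mdim P1)) (T : rmodule A).
Hypotheses (PP1 : projective P1) (PP0 : projective P0) (Hf : mhom P1 P0 f).
Variable c : {linear 'Hom('cV[k]_(mdim P1), A) -> 'rV[k]_(rdim T)}.
Hypothesis cM : forall g a, hom_to_alg g -> c (amulr a \o g)%VF = c g *m ract T a.
Hypothesis c_onto : forall w, exists2 g, hom_to_alg g & c g = w.
Hypothesis c_ker : forall g, hom_to_alg g ->
  (c g = 0 <-> exists2 h : 'Hom('cV[k]_(mdim P0), A),
                 hom_to_alg h & g = (h \o linfun (mulmx f))%VF).

Definition factors_through (u : 'M[k]_(mdim M, mdim P1)) :=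
  exists2 v, mhom P0 M v & u = v *m f.

(** With [T] the cokernel of [Hom(f, A)], the maps from [M] to the dual of [T]
    are the linear forms on [Hom(P1, M) = Hom(P1, A) (x) M] that vanish on what
    factors through [f].  If everything factors, such a form vanishes; it is
    evaluated below through a dual basis of [P1]. *)
Lemma factors_hom_zero : (forall u, mhom P1 M u -> factors_through u) ->
  forall g, mhom M (dual T) g -> g = 0.
Proof.
move=> fact g Hg.
have [J [e [y [He ey]]]] := projective_dual_basis PP1.
have [J' [d [z [Hd dz]]]] := projective_dual_basis PP0.
pose Phi (u : 'M[k]_(mdim M, mdim P1)) := \sum_j c (e j) *m g *m (u *m y j).
have PhiE h m : hom_to_alg h -> Phi (tens h m) = c h *m g *m m.
  move=> Hh.
  have hE : h = \sum_j (amulr (h (y j)) \o e j)%VF.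
    apply/lfunP => v; rewrite sum_lfunE -[v in LHS]mul1mx -ey mulmx_suml linear_sum.
    apply: eq_bigr => j _.
    by rewrite tensE [LHS]Hh comp_lfunE lfunE.
  rewrite [in RHS]hE linear_sum !mulmx_suml; apply: eq_bigr => j _.
  rewrite tensE cM // -!mulmxA; congr (_ *m _).
  by rewrite [LHS]mulmxA Hg -mulmxA.
apply: (@rmul_mx _ _ _ 0) => w m; rewrite mulmx0 mul0mx.
have [h Hh <-] := c_onto w; rewrite -PhiE //.
have [v Hv ->] := fact _ (tens_hom m Hh).
have -> : v *m f = \sum_j tens (d j \o linfun (mulmx f))%VF (v *m z j).
  rewrite -[v in LHS]mulmx1 -dz mulmx_sumr mulmx_suml; apply: eq_bigr => j _.
  by rewrite mul_tens // tens_mul.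
rewrite /Phi.
transitivity (\sum_j Phi (tens (d j \o linfun (mulmx f))%VF (v *m z j))).
  rewrite exchange_big; apply: eq_bigr => j _.
  by rewrite mulmx_suml mulmx_sumr.
rewrite big1 // => j _; rewrite PhiE; last exact: hom_to_alg_comp.
have [_ ->] := c_ker (hom_to_alg_comp Hf (Hd j)); first by rewrite !mul0mx.
by exists (d j).
Qed.

(** Conversely, a map that does not factor is separated from those that do by a
    linear form [Phi], which defines a nonzero map from [M] to the dual of [T]. *)
Lemma hom_zero_factors : (forall g, mhom M (dual T) g -> g = 0) ->
  forall u, mhom P1 M u -> factors_through u.
Proof.
move=> zero u Hu; apply: contrapT => nu.
have [U UP] : exists U : {vspace 'M[k]_(mdim M, mdim P1)},
    forall u, u \in U <-> factors_through u.
  apply: vspace_of_set; first by exists 0; rewrite ?mul0mx //; exact: hom0.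
  move=> a _ _ [v Hv ->] [w Hw ->]; exists (a *: v + w).
    by apply: homD => //; exact: homZ.
  by rewrite mulmxDl scalemxAl.
have /separating_functional[Phi [PhiL PhiU Phiu]] : u \notin U.
  by apply/negP => /UP.
have Phi0 : Phi 0 = 0 by apply: PhiU; exact: mem0v.
have PhiD v w : Phi (v + w) = Phi v + Phi w.
  by have := PhiL 1 v w; rewrite scale1r mul1r.
have PhiZ a v : Phi (a *: v) = a * Phi v.
  by have := PhiL a v 0; rewrite Phi0 !addr0.
have Phi_sum (I : finType) (F : I -> 'M[k]_(mdim M, mdim P1)) :
    Phi (\sum_i F i) = \sum_i Phi (F i) by apply: big_morph.
have /choice[h hP] (i : 'I_(rdim T)) :
    exists h, hom_to_alg h /\ c h = delta_mx 0 i.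
  by have [h] := c_onto (delta_mx 0 i); exists h.
pose g : 'M[k]_(rdim T, mdim M) :=
  \matrix_(i, j) Phi (tens (h i) (delta_mx j 0)).
have PhiT e m : hom_to_alg e -> c e = 0 -> Phi (tens e m) = 0.
  move=> He ce; have [/(_ ce)[d Hd ->] _] := c_ker He.
  by apply/PhiU/UP; exists (tens d m); rewrite ?tens_mul //; apply: tens_hom.
have gE e m : hom_to_alg e -> c e *m g *m m = (Phi (tens e m))%:M.
  move=> He; pose e' := \sum_i c e 0 i *: h i.
  have He' : hom_to_alg e'.
    apply: (big_ind (fun x => hom_to_alg x)) => [|x y Hx Hy|i _].
    - exact: hom_to_alg0.
    - by rewrite -[x]scale1r; apply: hom_to_algP.
    - rewrite -[_ *: _]addr0; apply: hom_to_algP; last exact: hom_to_alg0.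
      by have [] := hP i.
  have -> : tens e m = tens (e - e') m + tens e' m by rewrite -tensDl subrK.
  rewrite PhiD PhiT ?add0r; first last.
  - rewrite linearB linear_sum [X in _ - X](_ : _ = c e) ?subrr //.
    rewrite [RHS]matrix_sum_delta big_ord1; apply: eq_bigr => i _.
    by rewrite linearZ /=; have [_ ->] := hP i.
  - by rewrite addrC -scaleN1r; apply: hom_to_algP.
  have -> : tens e' m = \sum_i \sum_j (c e 0 i * m j 0) *: tens (h i) (delta_mx j 0).
    rewrite /e' (big_morph (fun g => tens g m) (id1 := 0) (op1 := +%R)); first last.
    - by apply: eq_mulmxcV => v; rewrite tensE lfunE /= raddf0 !mul0mx.
    - by move=> x y; rewrite tensDl.
    apply: eq_bigr => i _; rewrite tensZl [m in LHS]matrix_sum_delta.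
    rewrite (eq_bigr (fun j => m j 0 *: delta_mx j 0)); last by move=> j _; rewrite big_ord1.
    rewrite (big_morph (fun m => tens (h i) m) (id1 := 0) (op1 := +%R)); first last.
    - by apply: eq_mulmxcV => v; rewrite tensE mulmx0 mul0mx.
    - by move=> x y; rewrite tensDr.
    by rewrite scaler_sumr; apply: eq_bigr => j _; rewrite tensZr scalerA.
  apply/matrixP => a b; rewrite !ord1 !mxE eqxx mulr1n Phi_sum.
  under eq_bigr do rewrite mxE mulr_suml.
  rewrite exchange_big; apply: eq_bigr => i _; rewrite Phi_sum; apply: eq_bigr => j _.
  by rewrite PhiZ mxE mulrAC.
(* [g] is linear over the algebra because the pairing with [Phi] is balanced *)
have g0 : g = 0.
  apply: zero => a; apply: rmul_mx => w m.
  have [e He <-] := c_onto w.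
  rewrite !mulmxA -(mulmxA _ (mact M a)) gE // -[mact (dual T) a]/(ract T a) -cM //.
  by rewrite gE ?tens_amulr //; exact: hom_to_alg_amulr.
have [J [e [y [He ey]]]] := projective_dual_basis PP1.
move: Phiu; rewrite -[u]mulmx1 -ey mulmx_sumr Phi_sum big1 ?eqxx // => j _.
rewrite mul_tens //; have := gE (e j) (u *m y j) (He j).
rewrite g0 mulmx0 mul0mx => /matrixP/(_ 0 0).
by rewrite !mxE eqxx mulr1n.
Qed.
End Cokernel.
End Tau.

(** * Presentations and extensions of tau-rigid modules *)

Section Transpose.
Variables (k : fieldType) (A : falgType k).
Implicit Types (M N P X Y E : lmodule A) (T : rmodule A).

(** A complement [D] of [I] in [H] serves as a model of the quotient. *)
Lemma quotient_coordinates (vT : vectType k) (I H : {vspace vT}) : (I <= H)%VS ->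
  exists n (c : {linear vT -> 'rV[k]_n}) (l : {linear 'rV[k]_n -> vT}),
  [/\ forall w, l w \in H, cancel l c & forall g, g \in H -> (c g = 0 <-> g \in I)].
Proof.
move=> IH; pose D := (H :\: I)%VS.
have DI : (D :&: I)%VS = 0%VS by rewrite capv_diff.
have HDI : (D + I)%VS = H by rewrite addv_diff; apply/addv_idPl.
have DH : (D <= H)%VS by rewrite -HDI addvSl.
pose b := vbasis D.
pose c g : 'rV[k]_(\dim D) := \row_i coord b i (daddv_pi D I g).
pose l (w : 'rV[k]_(\dim D)) : vT := \sum_i w 0 i *: b`_i.
have cL : linear c by move=> a g h; apply/rowP => i; rewrite !mxE !linearP.
have lL : linear l.
  move=> a u v; rewrite scaler_sumr -big_split; apply: eq_bigr => i _.
  by rewrite !mxE scalerDl scalerA.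
have lD w : l w \in D.
  by apply: memv_suml => i _; apply: memvZ; apply: vbasis_mem; apply: mem_nth; rewrite size_tuple.
have lK w : c (l w) = w.
  apply/rowP => i; rewrite !mxE daddv_pi_id //.
  rewrite linear_sum (bigD1 i) //= linearZ /= coord_free ?(basis_free (vbasisP _)) //.
  rewrite eqxx mulr1 big1 ?addr0 // => j ji.
  rewrite linearZ /= coord_free ?(basis_free (vbasisP _)) //.
  by rewrite -(inj_eq val_inj) eq_sym in ji *; rewrite (negbTE ji) mulr0.
have lE g : l (c g) = daddv_pi D I g.
  rewrite [RHS](coord_vbasis (memv_pi D I g)).
  by apply: eq_bigr => i _; rewrite mxE.
exists (\dim D).
exists (HB.pack_for {linear vT -> 'rV[k]_(\dim D)} c
  (GRing.isLinear.Build k vT 'rV[k]_(\dim D) *:%R c cL)).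
exists (HB.pack_for {linear 'rV[k]_(\dim D) -> vT} l
  (GRing.isLinear.Build k 'rV[k]_(\dim D) vT *:%R l lL)).
split=> //= [w|g gH]; first exact: (subvP DH).
have gE : daddv_pi D I g + daddv_pi I D g = g by rewrite daddv_pi_add // HDI.
split=> [cg|gI].
  by rewrite -gE -lE cg (_ : l 0 = 0) ?add0r ?memv_pi // /l big1 // => i _;
    rewrite mxE scale0r.
have /eqP := gE; rewrite (@daddv_pi_id _ _ I D) ?[(I :&: D)%VS]capvC //.
rewrite -subr_eq0 addrK => /eqP e.
by apply/rowP => i; rewrite !mxE e linear0.
Qed.

(** The cokernel of [Hom(f, A)], realised on a complement of the image. *)
Lemma cokernel_exists P1 P0 (f : 'M[k]_(mdim P0, mdim P1)) : mhom P1 P0 f ->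
  exists T (c : {linear 'Hom('cV[k]_(mdim P1), A) -> 'rV[k]_(rdim T)}),
  [/\ forall g a, hom_to_alg g -> c (amulr a \o g)%VF = c g *m ract T a,
      forall w, exists2 g, hom_to_alg g & c g = w
    & forall g, hom_to_alg g ->
        (c g = 0 <-> exists2 h : 'Hom('cV[k]_(mdim P0), A),
                       hom_to_alg h & g = (h \o linfun (mulmx f))%VF)].
Proof.
move=> Hf; pose VT := 'Hom('cV[k]_(mdim P1), A).
have [H HP] : exists H : {vspace VT}, forall g, g \in H <-> hom_to_alg g.
  by apply: vspace_of_set; [exact: hom_to_alg0 | move=> ? ? ?; exact: hom_to_algP].
pose im (g : VT) := exists2 h : 'Hom('cV[k]_(mdim P0), A),
  hom_to_alg h & g = (h \o linfun (mulmx f))%VF.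
have [I IP] : exists I : {vspace VT}, forall g, g \in I <-> im g.
  apply: vspace_of_set.
    exists 0; first exact: hom_to_alg0.
    by apply/lfunP => v; rewrite comp_lfunE !lfunE.
  move=> a _ _ [g Hg ->] [h Hh ->]; exists (a *: g + h); first exact: hom_to_algP.
  by apply/lfunP => v; rewrite !(add_lfunE, scale_lfunE, comp_lfunE).
have IH : (I <= H)%VS.
  by apply/subvP => _ /IP[h Hh ->]; apply/HP; exact: hom_to_alg_comp.
have [n [c [l [lH lK cker]]]] := quotient_coordinates IH.
pose F a (g : VT) : VT := (amulr a \o g)%VF.
have FI a g : g \in I -> F a g \in I.
  move=> /IP[h Hh ->]; apply/IP; exists (amulr a \o h)%VF.
    exact: hom_to_alg_amulr.
  by rewrite /F comp_lfunA.
have FH a g : g \in H -> F a g \in H.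
  by move=> /HP Hg; apply/HP/hom_to_alg_amulr.
have FL a : linear (F a).
  by move=> b g h; apply/lfunP => v; rewrite !(add_lfunE, scale_lfunE, comp_lfunE) linearP.
have cF a g : g \in H -> c (F a g) = c (F a (l (c g))).
  move=> gH; have : g - l (c g) \in I.
    by apply/cker; rewrite ?rpredB // linearB lK subrr.
  move=> /(FI a)/[dup] /(subvP IH) h1 /(cker _ h1).
  have -> : F a (g - l (c g)) = F a g - F a (l (c g)).
    by rewrite addrC -scaleN1r FL scaleN1r addrC.
  by rewrite linearB => /eqP; rewrite subr_eq0 => /eqP.
have GL a : linear (fun w : 'rV[k]_n => c (F a (l w))).
  by move=> b u v; rewrite linearP FL linearP.
pose G a := HB.pack_for {linear 'rV[k]_n -> 'rV[k]_n} (fun w : 'rV[k]_n => c (F a (l w)))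
  (GRing.isLinear.Build k _ _ *:%R _ (GL a)).
pose r a := lin1_mx (G a).
have rE a w : w *m r a = c (F a (l w)) by rewrite mul_rV_lin1.
have cM a g : g \in H -> c (F a g) = c g *m r a by move=> gH; rewrite rE cF.
have rext (r1 r2 : 'M[k]_n) : (forall w : 'rV_n, w *m r1 = w *m r2) -> r1 = r2.
  by move=> h; apply/row_matrixP => i; rewrite !rowE.
have rL : linear r.
  move=> b u v; apply: rext => w; rewrite mulmxDr -scalemxAr !rE.
  rewrite (_ : F _ _ = b *: F u (l w) + F v (l w)) ?linearP //.
  apply/lfunP => x; rewrite !(add_lfunE, scale_lfunE, comp_lfunE) !lfunE /=.
  by rewrite mulrDr scalerAr.
have r1 : r 1 = 1%:M.
  apply: rext => w; rewrite rE mulmx1 -[RHS]lK; congr (c _).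
  by apply/lfunP => x; rewrite !(comp_lfunE, lfunE) /= mulr1.
have rM a b : r (a * b) = r a *m r b.
  apply: rext => w; rewrite mulmxA !rE -cF ?FH //.
  congr (c _); apply/lfunP => x; rewrite !(add_lfunE, scale_lfunE, comp_lfunE) !lfunE /=.
  by rewrite mulrA.
exists (RModule (rep_morphism rL r1 rM)), c; split=> [g a /HP gH|w|g /HP gH].
- exact: cM.
- by exists (l w); [apply/HP | rewrite lK].
- by rewrite cker.
Qed.

(** Tau-rigidity is surjectivity of [Hom(f, M)]; the two directions are about
    some minimal presentation, so that each can use the one at hand. *)
Lemma tau_rigid_of_presentation M P1 P0 f p : @min_proj_presentation _ _ M P1 P0 f p ->
  (forall u, mhom P1 M u -> exists2 v, mhom P0 M v & u = v *m f) -> tau_rigid M.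
Proof.
move=> pres fact; have [[PP1 PP0] [Hf Hp] _ _ _] := pres.
have [T [c [cM co ck]]] := cokernel_exists Hf.
exists (dual T); last first.
  exact: (factors_hom_zero PP1 PP0 Hf cM co ck fact).
exists T; last exact: iso_refl.
by exists P1, P0, f, p; split=> //; exists c.
Qed.

Lemma tau_rigid_presentation M : tau_rigid M ->
  exists P1 P0 f p, @min_proj_presentation _ _ M P1 P0 f p /\
  forall u, mhom P1 M u -> exists2 v, mhom P0 M v & u = v *m f.
Proof.
move=> [N [T [P1 [P0 [f [p [pres [c [cM co ck]]]]]]] [i [j [Hi Hj ij ji]]]] zero].
exists P1, P0, f, p; split=> //; have [[PP1 PP0] [Hf Hp] _ _ _] := pres.
apply: (hom_zero_factors PP1 cM co ck) => g Hg.
by rewrite -[g]mul1mx -ij -mulmxA (zero _ (homM Hg Hj)) mulmx0.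
Qed.

(** Short exact sequences [0 -> Y -> E -> X -> 0]. *)
Definition extension Y E X (i : 'M[k]_(mdim E, mdim Y)) (e : 'M[k]_(mdim X, mdim E)) :=
  [/\ mhom Y E i /\ mhom E X e, exists j, j *m i = 1%:M, onto_mx e, e *m i = 0
    & forall v : 'cV_(mdim E), e *m v = 0 -> exists u, v = i *m u].

Definition splits E X (e : 'M[k]_(mdim X, mdim E)) :=
  exists2 s, mhom X E s & e *m s = 1%:M.

(** The easy half of the Auslander-Smalo criterion.  Given a projective
    presentation [P1 -f-> P0 -p-> M], lift [p] to [q : P0 -> E].  The induced map
    [P1 -> Y] lifts along [M -> Y] and so factors through [f], which allows [q]
    to be corrected into a map that vanishes on the image of [f]. *)
Lemma tau_rigid_splits M Y E i e h : tau_rigid M -> @extension Y E M i e ->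
  mhom M Y h -> onto_mx h -> splits e.
Proof.
move=> /tau_rigid_presentation[P1 [P0 [f [p [[[PP1 PP0] [Hf Hp] po ker _] fact]]]]].
move=> [[Hi He] [j ji] eo ei kere] Hh ho.
have pf : p *m f = 0.
  by apply: eq_mulmxcV => v; rewrite mul0mx -mulmxA; apply/ker; exists v.
have [q Hq pq] := PP0 _ _ _ _ He Hp eo.
have [u qf] : exists u, q *m f = i *m u.
  apply: mulmx_cVP => v; rewrite -mulmxA; apply: kere.
  by rewrite 2!mulmxA -pq pf mul0mx.
have Hu : mhom P1 Y u.
  move=> a; rewrite -[LHS]mul1mx -ji -[RHS]mul1mx -ji -!mulmxA; congr (j *m _).
  rewrite mulmxA -qf -mulmxA Hf mulmxA Hq -mulmxA qf.
  by rewrite mulmxA -Hi mulmxA.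
have [u' Hu' uE] := PP1 _ _ _ _ Hh Hu ho.
have [v Hv u'E] := fact _ Hu'.
pose q' := q - i *m (h *m v).
have Hq' : mhom P0 E q' by apply: homB => //; apply: homM => //; apply: homM.
have q'f : q' *m f = 0 by rewrite mulmxBl qf uE u'E !mulmxA subrr.
have eq' : e *m q' = p by rewrite mulmxBr (mulmxA e) ei mul0mx subr0 -pq.
have /ontoP[r pr] := po.
have q'rp : q' *m r *m p = q'.
  apply: eq_mulmxcV => w; rewrite -!mulmxA; apply/eqP; rewrite -subr_eq0 -mulmxBr.
  have /ker[x ->] : p *m (r *m (p *m w) - w) = 0.
    by rewrite mulmxBr (mulmxA p r) pr mul1mx subrr.
  by rewrite mulmxA q'f mul0mx.
exists (q' *m r); last by rewrite mulmxA eq' pr.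
move=> a; apply: (hom_ext_onto po); rewrite -[RHS]mulmxA q'rp -mulmxA.
by rewrite -Hp mulmxA q'rp Hq'.
Qed.

(** Adding a complement of [X] to the middle term turns an extension of [X] into an
    extension of [M] by the same [Y]. *)
Lemma tau_rigid_retract_splits M X Y E i e h : tau_rigid M -> retract X M ->
  @extension Y E X i e -> mhom M Y h -> onto_mx h -> splits e.
Proof.
move=> Mt /summandP[Z] /iso_dsumP [iX [iZ [pX [pZ [[HiX HiZ HpX HpZ]]]]]].
move=> [eX eZ eXZ eZX e1] [[Hi He] [j ji] eo ei ker] Hh ho.
have [] := @tau_rigid_splits M Y (dsum E Z) (col_mx i 0) (row_mx (iX *m e) iZ) h Mt _ Hh ho.
  split.
  - split; first by apply: hom_col => //; exact: hom0.
    by apply: hom_row => //; exact: homM.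
  - by exists (row_mx j 0); rewrite mul_row_col ji mulmx0 addr0.
  - have /ontoP[r er] := eo.
    apply/ontoP; exists (col_mx (r *m pX) pZ).
    by rewrite mul_row_col mulmxA -(mulmxA iX) er mulmx1.
  - by rewrite mul_row_col mulmx0 addr0 -mulmxA ei mulmx0.
  - move=> v; rewrite -[v]vsubmxK mul_row_col => ev.
    have e0 : e *m usubmx v = 0.
      have := congr1 (mulmx pX) ev; rewrite mulmx0 mulmxDr !mulmxA eX eXZ mul1mx mul0mx.
      by rewrite addr0.
    have z0 : dsubmx v = 0.
      have := congr1 (mulmx pZ) ev; rewrite mulmx0 mulmxDr !mulmxA eZ eZX mul1mx !mul0mx.
      by rewrite add0r.
    by have [u uE] := ker _ e0; exists u; rewrite mul_col_mx mul0mx uE z0.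
move=> s Hs es; exists (prl_mx E Z *m (s *m iX)).
  by apply: homM (@prl_hom _ _ _ _); exact: homM.
rewrite -[s]vsubmxK mul_row_col in es.
have := congr1 (fun x => pX *m x *m iX) es.
rewrite mulmx1 eX mulmxDr mulmxDl !mulmxA eX eXZ mul1mx !mul0mx addr0.
move=> <-; congr (_ *m iX); rewrite -mulmxA; congr (e *m _).
by rewrite -[s in LHS]vsubmxK [LHS]mul_row_col mul1mx mul0mx addr0.
Qed.
End Transpose.

(** * Minimal presentations over a square-zero radical *)

Section NicePresentations.
Variables (k : fieldType) (A : falgType k) (J : set A).
Hypothesis JJ : forall a b, J a -> J b -> a * b = 0.
Implicit Types (M N P X Y E : lmodule A).

(** The submodule [J P]; as [J] has square zero, a map whose kernel lies in it is
    essential. *)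
Definition in_rad P (v : 'cV[k]_(mdim P)) : Prop :=
  exists (I : finType) (a : I -> A) (z : I -> 'cV_(mdim P)),
  (forall i, J (a i)) /\ v = \sum_i mact P (a i) *m z i.

Lemma in_rad_hom P Q f v : mhom P Q f -> in_rad v -> in_rad (P := Q) (f *m v).
Proof.
move=> Hf [I [a [z [Ja ->]]]]; exists I, a, (fun i => f *m z i); split=> //.
by rewrite mulmx_sumr; apply: eq_bigr => i _; rewrite mulmxA Hf mulmxA.
Qed.

Lemma in_radD P u v : in_rad (P := P) u -> in_rad (P := P) v -> in_rad (P := P) (u + v).
Proof.
move=> [I [a [y [Ja ->]]]] [I' [b [z [Jb ->]]]].
exists (I + I')%type, (fun i => match i with inl i => a i | inr i => b i end).
exists (fun i => match i with inl i => y i | inr i => z i end).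
by split=> [[]//|]; rewrite big_sumType.
Qed.

(** Nakayama's lemma for the square-zero ideal spanned by [J]. *)
Lemma in_rad_essential P N (f : 'M[k]_(mdim N, mdim P)) :
  (forall v, f *m v = 0 -> in_rad v) -> essential f.
Proof.
move=> kerf X h Hh im.
have lift v : exists u, in_rad (v - h *m u).
  by have [u fu] := im v; exists u; apply: kerf; rewrite mulmxBr fu subrr.
move=> v; have [u [I [a [z [Ja vE]]]]] := lift v.
have /choice[y yP] := fun i => lift (z i).
exists (u + \sum_i mact X (a i) *m y i); rewrite mulmxDr mulmx_sumr.
rewrite -[LHS](subrK (h *m u)) vE addrC; congr (_ + _); apply: eq_bigr => i _.
apply/eqP; rewrite (mulmxA h) Hh -mulmxA -subr_eq0 -mulmxBr.
have [I' [b [z' [Jb ->]]]] := yP i; rewrite mulmx_sumr big1 // => j _.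
by rewrite mulmxA -mactM JJ // raddf0 mul0mx.
Qed.

(** Minimality is replaced by the condition that both kernels lie in the radical,
    which is stable under direct sums. *)
Record nice_presentation M P1 P0 (f : 'M[k]_(mdim P0, mdim P1))
    (p : 'M[k]_(mdim M, mdim P0)) : Prop := NicePresentation {
  nice_proj1 : projective P1;
  nice_proj0 : projective P0;
  nice_hom1 : mhom P1 P0 f;
  nice_hom0 : mhom P0 M p;
  nice_onto : onto_mx p;
  nice_complex : p *m f = 0;
  nice_exact : forall v : 'cV_(mdim P0), p *m v = 0 -> exists u, v = f *m u;
  nice_rad1 : forall v : 'cV_(mdim P1), f *m v = 0 -> in_rad v;
  nice_rad0 : forall v : 'cV_(mdim P0), p *m v = 0 -> in_rad v }.

Lemma nice_min M P1 P0 f p : @nice_presentation M P1 P0 f p -> min_proj_presentation f p.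
Proof.
move=> [PP1 PP0 Hf Hp po pf ex r1 r0]; split=> // [v|].
  split=> [/ex //|[u ->]]; by rewrite mulmxA pf mul0mx.
by split; apply: in_rad_essential.
Qed.

Lemma nice_zero : @nice_presentation (zero_module A) (zero_module A) (zero_module A) 0 0.
Proof.
have r0 v : in_rad (P := zero_module A) v.
  by exists void, (fun=> 0), (fun=> 0); split=> [[]|]; rewrite [v]flatmx0 [RHS]flatmx0.
split=> //; try exact: projective0; try exact: hom0; try by rewrite mul0mx.
- by move=> w; exists 0; rewrite [w]flatmx0 [RHS]flatmx0.
- by move=> v _; exists 0; rewrite [v]flatmx0 [RHS]flatmx0.
Qed.

Lemma nice_dsum M P1 P0 f p M' P1' P0' f' p' :
  @nice_presentation M P1 P0 f p -> @nice_presentation M' P1' P0' f' p' ->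
  @nice_presentation (dsum M M') (dsum P1 P1') (dsum P0 P0')
    (block_mx f 0 0 f') (block_mx p 0 0 p').
Proof.
move=> [PP1 PP0 Hf Hp po pf ex r1 r0] [PP1' PP0' Hf' Hp' po' pf' ex' r1' r0'].
have block_hom X X' Y Y' g g' : mhom X Y g -> mhom X' Y' g' ->
    mhom (dsum X X') (dsum Y Y') (block_mx g 0 0 g').
  move=> Hg Hg'; apply: hom_col; apply: hom_row => //; exact: hom0.
have rad_block X X' (Y Y' : nat) (g : 'M[k]_(Y, mdim X)) (g' : 'M[k]_(Y', mdim X')) :
    (forall v, g *m v = 0 -> in_rad (P := X) v) ->
    (forall v, g' *m v = 0 -> in_rad (P := X') v) ->
    forall v, block_mx g 0 0 g' *m v = 0 -> in_rad (P := dsum X X') v.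
  move=> rg rg' v; rewrite -[v]vsubmxK mul_block_col !mul0mx addr0 add0r.
  move=> /eqP; rewrite col_mx_eq0 => /andP[/eqP/rg gu /eqP/rg' gd].
  have -> : col_mx (usubmx v) (dsubmx v) =
      inl_mx X X' *m usubmx v + inr_mx X X' *m dsubmx v.
    by rewrite !mul_col_mx !mul1mx !mul0mx add_col_mx addr0 add0r.
  by apply: in_radD; [apply: in_rad_hom gu; exact: inl_hom | apply: in_rad_hom gd; exact: inr_hom].
split; try (by apply: projective_dsum); try (by apply: block_hom);
  try (by apply: rad_block).
- move: po po' => /ontoP[q pq] /ontoP[q' pq']; apply/ontoP; exists (block_mx q 0 0 q').
  by rewrite mulmx_block !mulmx0 !mul0mx !addr0 !add0r pq pq' -scalar_mx_block.
- by rewrite mulmx_block !mulmx0 !mul0mx !addr0 !add0r pf pf' /block_mx !row_mx0 col_mx0.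
- move=> v; rewrite -[v]vsubmxK mul_block_col !mul0mx addr0 add0r.
  move=> /eqP; rewrite col_mx_eq0 => /andP[/eqP/ex[x ->] /eqP/ex'[x' ->]].
  exists (col_mx x x'); by rewrite mul_block_col !mul0mx addr0 add0r.
Qed.

Definition factors P1 P0 (f : 'M[k]_(mdim P0, mdim P1)) N :=
  forall u, mhom P1 N u -> exists2 v, mhom P0 N v & u = v *m f.

Lemma factors_dsums P1 P0 f s : (forall Y, Y \in s -> @factors P1 P0 f Y) ->
  factors f (dsums s).
Proof.
elim: s => [|Y s IH] fs u Hu /=.
  by exists 0; [exact: hom0 | rewrite [u]flatmx0 [RHS]flatmx0].
have Hl : mhom P1 Y (usubmx u).
  have := homM Hu (@prl_hom _ _ Y (dsums s)).
  by rewrite -[u in X in X -> _]vsubmxK mul_row_col mul1mx mul0mx addr0.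
have Hr : mhom P1 (dsums s) (dsubmx u).
  have := homM Hu (@prr_hom _ _ Y (dsums s)).
  by rewrite -[u in X in X -> _]vsubmxK mul_row_col mul1mx mul0mx add0r.
have [v Hv uv] := fs Y (mem_head _ _) _ Hl.
have [|w Hw uw] := IH _ _ Hr.
  by move=> Z sZ; apply: fs; rewrite inE sZ orbT.
exists (col_mx v w); first exact: hom_col.
by rewrite -[u]vsubmxK mul_col_mx -uv -uw.
Qed.

(** The direct sum of the presentations is minimal, and a map from it to a direct
    sum factors when each of its components does; so compatibility may be tested
    on pairs of summands. *)
Lemma tau_rigid_dsums (s : seq (lmodule A)) :
  (forall X, X \in s -> exists P1 P0 f p, @nice_presentation X P1 P0 f p /\
     forall Y, Y \in s -> factors f Y) -> tau_rigid (dsums s).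
Proof.
move=> nice_s.
have pres_t t : {subset t <= s} -> exists P1 P0 f p,
    @nice_presentation (dsums t) P1 P0 f p /\ forall Y, Y \in s -> factors f Y.
  elim: t => [|X t IH] ts.
    exists (zero_module A), (zero_module A), 0, 0; split; first exact: nice_zero.
    by move=> Y _ u Hu; exists 0; [exact: hom0 | rewrite mul0mx; apply/matrixP => ? []].
  have [|P1 [P0 [f [p [pres fact]]]]] := nice_s X; first by apply: ts; rewrite inE eqxx.
  have [|P1' [P0' [f' [p' [pres' fact']]]]] := IH.
    by move=> Y tY; apply: ts; rewrite inE tY orbT.
  exists (dsum P1 P1'), (dsum P0 P0'), (block_mx f 0 0 f'), (block_mx p 0 0 p').
  split=> [|Y sY u Hu]; first exact: nice_dsum.
  have Hl : mhom P1 Y (lsubmx u).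
    have := homM (@inl_hom _ _ P1 P1') Hu.
    by rewrite -[u in X in X -> _]hsubmxK mul_row_col mulmx1 mulmx0 addr0.
  have Hr : mhom P1' Y (rsubmx u).
    have := homM (@inr_hom _ _ P1 P1') Hu.
    by rewrite -[u in X in X -> _]hsubmxK mul_row_col mulmx1 mulmx0 add0r.
  have [v Hv uv] := fact Y sY _ Hl.
  have [w Hw uw] := fact' Y sY _ Hr.
  exists (row_mx v w); first exact: hom_row.
  by rewrite mul_row_block !mulmx0 addr0 add0r -uv -uw hsubmxK.
have [//|P1 [P0 [f [p [pres fact]]]]] := pres_t s.
apply: (tau_rigid_of_presentation (nice_min pres)).
exact: factors_dsums.
Qed.
End NicePresentations.

(** * Counting indecomposable summands *)
Section Counting.
Variables (k : fieldType) (A : falgType k) (I : eqType) (F : I -> lmodule A).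
Implicit Types (M N X Y : lmodule A) (s : seq I).
Hypothesis Fi : forall i, indecomposable (F i).
Hypothesis F_inj : forall i j, iso (F i) (F j) -> i = j.

Definition fsum s := dsums [seq F i | i <- s].

Lemma summand_fsum X s : indecomposable X -> summand X (fsum s) ->
  exists2 i, i \in s & iso X (F i).
Proof.
move=> Xi /summandP /retract_dsums_indec[//|_ /mapP[i _ ->] //|_ /mapP[i si ->] XF].
by exists i.
Qed.

Lemma mem_summand_fsum i s : (i \in s) <-> summand (F i) (fsum s).
Proof.
split=> [si|/summand_fsum[//|j sj /F_inj -> //]].
by apply/summandP/retract_dsums/map_f.
Qed.

Lemma fsum_perm s t : perm_eq s t -> iso (fsum s) (fsum t).
Proof.
elim: s t => [|i s IH] t st.
  by rewrite perm_sym in st; have /perm_nilP -> := st; exact: iso_refl.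
have ti : i \in t by rewrite -(perm_mem st) inE eqxx.
have := st; rewrite (permPr (perm_to_rem ti)) perm_cons => /IH h.
apply: (iso_trans (dsum_iso (iso_refl (F i)) h)).
elim: t ti {h st} => //= j t IHt; rewrite inE eq_sym; case: eqP => [-> _|_ /= /IHt h].
  exact: iso_refl.
apply: iso_trans (dsumA _ _ _) _.
apply: (iso_trans (dsum_iso (dsumC _ _) (iso_refl _))).
apply: (iso_trans (iso_sym (dsumA _ _ _))).
exact: dsum_iso (iso_refl _) h.
Qed.

Lemma iso_class_eq X Y : iso X Y -> iso_class X = iso_class Y.
Proof.
move=> XY; apply/seteqP; split=> Z; first exact/iso_trans/iso_sym.
exact: iso_trans.
Qed.

Lemma num_summands_iso M N n : iso M N -> num_summands M n -> num_summands N n.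
Proof.
move=> MN; rewrite /num_summands; congr (_ @` _ #= _).
by apply/seteqP; split=> X [Xi /summandP h]; split=> //; apply/summandP;
  apply: retract_iso_r h => //; exact: iso_sym.
Qed.

Lemma num_summands_unique M m n : num_summands M m -> num_summands M n -> m = n.
Proof. by move=> /card_esym h /(card_eq_trans h)/card_eq_II. Qed.

(** The classes of the summands are enumerated by the positions in [s]; [F_inj]
    makes this enumeration injective. *)
Lemma num_summands_fsum s : uniq s -> num_summands (fsum s) (size s).
Proof.
move=> us; rewrite /num_summands.
have -> : [set iso_class X | X in [set X | indecomposable X /\ summand X (fsum s)]] =
    [set iso_class (nth (zero_module A) [seq F i | i <- s] j) | j in `I_(size s)].
  apply/seteqP; split=> [_ [X [Xi /summand_fsum[//|i si /iso_class_eq e]] <-]|_ [j /= js <-]].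
    exists (index i s); rewrite /= ?index_mem // e.
    by rewrite (nth_map i) ?index_mem // nth_index.
  exists (nth (zero_module A) [seq F i | i <- s] j) => //.
  have /mapP[i si ->] : nth (zero_module A) [seq F i | i <- s] j \in [seq F i | i <- s].
    by rewrite mem_nth // size_map.
  by split=> //; apply/mem_summand_fsum.
apply: inj_card_eq => i j /set_mem /= si /set_mem /= sj.
case: s us si sj => [//|x s] us si sj.
rewrite !(nth_map x) // => e; apply/eqP; rewrite -(nth_uniq x si sj us).
apply/eqP/F_inj; suff : iso_class (F (nth x (x :: s) j)) (F (nth x (x :: s) j)).
  by rewrite -e.
exact: iso_refl.
Qed.

Lemma basic_fsum s : uniq s -> basic (fsum s).
Proof.
move=> us; exists (size s), (fun i => F (tnth (in_tuple s) i)).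
split=> // [|i j ij /F_inj]; last first.
  by move/(elimT (@tuple_uniqP _ _ (in_tuple s)) us) => e; case/eqP: ij.
rewrite big_dsums (map_comp F) (_ : index_enum _ = enum 'I_(size s)).
  by rewrite map_tnth_enum; exact: iso_refl.
by rewrite enumT /index_enum; case: index_enum_key.
Qed.

Lemma dsums_iso (T : eqType) (G H : T -> lmodule A) t : (forall i, i \in t -> iso (G i) (H i)) ->
  iso (dsums [seq G i | i <- t]) (dsums [seq H i | i <- t]).
Proof.
elim: t => [|i t IH] GH /=; first exact: iso_refl.
by apply: dsum_iso; [apply: GH; rewrite inE eqxx
  | apply: IH => j tj; apply: GH; rewrite inE tj orbT].
Qed.

(** Turns isomorphism classes of basic modules into finite subsets of the index
    type of [F]. *)
Lemma basic_iso_fsum M : basic M ->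
  (forall X, indecomposable X -> summand X M -> exists i, iso X (F i)) ->
  exists2 s, uniq s & iso M (fsum s).
Proof.
move=> [n [X [Xi MX X_inj]]] cl.
have sX i : summand (X i) M.
  apply/summandP; apply: retract_iso_r (iso_sym MX) _; rewrite big_dsums.
  by apply: retract_dsums; apply: map_f; rewrite mem_index_enum.
have /choice[r Hr] := fun i => cl (X i) (Xi i) (sX i).
exists [seq r i | i <- index_enum 'I_n].
  rewrite map_inj_uniq ?index_enum_uniq // => i j rij.
  apply/eqP; apply: contrapT => /negP ij; apply: (X_inj _ _ ij).
  by apply: iso_trans (Hr i) _; rewrite rij; exact: iso_sym.
apply: iso_trans MX _; rewrite big_dsums /fsum -map_comp.
by apply: dsums_iso => i _; exact: Hr.
Qed.
End Counting.

(** * Radical square zero algebras *)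

Section RadicalSquareZero.
Variables (k : fieldType) (Q : quiver).
Local Notation A := (rsz_alg k Q).
Local Notation short := (vertex Q + arrow Q)%type.

(** The coordinates in the basis of stationary paths and arrows. *)
Definition cf (x : A) (i : short) : k := coef (qrepr x) (short_path i).

Lemma cf_pi x i : cf (qpi (rad_sq k Q) x) i = coef x (short_path i).
Proof.
have /rowP/(_ (enum_rank i)) := rsz_coord_pi x.
by rewrite !mxE enum_rankK.
Qed.

Lemma cf_linear i : forall c x y, cf (c *: x + y) i = c * cf x i + cf y i.
Proof.
move=> c x y; have /rowP/(_ (enum_rank i)) := rsz_coord_linear c x y.
by rewrite !mxE enum_rankK.
Qed.

Lemma cf_inj x y : cf x =1 cf y -> x = y.
Proof.
move=> xy; have [g gK _] := @rsz_coord_bij k Q; apply: (can_inj gK).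
by apply/rowP => i; rewrite !mxE; exact: xy.
Qed.

Lemma cfD i x y : cf (x + y) i = cf x i + cf y i.
Proof. by have := cf_linear i 1 x y; rewrite scale1r mul1r. Qed.
Lemma cf0 i : cf 0 i = 0.
Proof. by apply: (addrI (cf 0 i)); rewrite -cfD !addr0. Qed.
Lemma cfZ i c x : cf (c *: x) i = c * cf x i.
Proof. by have := cf_linear i c x 0; rewrite cf0 !addr0. Qed.
Lemma cf_sum i (I : finType) (F : I -> A) : cf (\sum_j F j) i = \sum_j cf (F j) i.
Proof. by apply: (big_morph (cf^~ i)) => [x y|]; rewrite ?cfD ?cf0. Qed.

Lemma cf1 v : cf 1 (inl v) = 1.
Proof. by rewrite [1 : A]/(qpi _ 1) cf_pi Defs.coef1. Qed.
Lemma cf1_arrow a : cf 1 (inr a) = 0.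
Proof. by rewrite [1 : A]/(qpi _ 1) cf_pi Defs.coef1. Qed.

Lemma cfM_vertex x y v : cf (x * y) (inl v) = cf x (inl v) * cf y (inl v).
Proof.
rewrite -[x * y]/(qpi (rad_sq k Q) (qrepr x * qrepr y)) cf_pi Defs.coefM big_ord1.
by rewrite /= pdrop0 ptake0.
Qed.

Lemma cfM_arrow x y a : cf (x * y) (inr a) =
  cf x (inr a) * cf y (inl (source a)) + cf x (inl (target a)) * cf y (inr a).
Proof.
rewrite -[x * y]/(qpi (rad_sq k Q) (qrepr x * qrepr y)) cf_pi Defs.coefM.
rewrite big_ord_recl big_ord1 pdrop0 ptake0 /=; congr (_ + _ * _).
  by rewrite -[bump 0 0]/(plength (short_path (inr a))) pdrop_all.
by rewrite -[bump 0 0]/(plength (short_path (inr a))) ptake_all.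
Qed.

Definition vert (v : vertex Q) : A := qpi _ (pvec k (stationary v)).
Definition arr (a : arrow Q) : A := qpi _ (pvec k (short_path (inr a))).

Lemma cf_vert v i : cf (vert v) i = (i == inl v)%:R.
Proof.
rewrite /vert cf_pi coef_pvec -[stationary v]/(short_path (inl v)).
by rewrite (inj_eq (@short_path_inj Q)).
Qed.
Lemma cf_arr a i : cf (arr a) i = (i == inr a)%:R.
Proof. by rewrite /arr cf_pi coef_pvec (inj_eq (@short_path_inj Q)). Qed.

Lemma rsz_expand x :
  x = \sum_v cf x (inl v) *: vert v + \sum_a cf x (inr a) *: arr a.
Proof.
apply: cf_inj => -[v|a]; rewrite cfD !cf_sum.
  rewrite (bigD1 v) //= cfZ cf_vert eqxx mulr1 !big1 ?addr0 // => [a _|w wv].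
    by rewrite cfZ cf_arr mulr0.
  by rewrite cfZ cf_vert -[inl _ == _]/(v == w) eq_sym (negbTE wv) mulr0.
rewrite big1 => [|v _]; last by rewrite cfZ cf_vert mulr0.
rewrite add0r (bigD1 a) //= cfZ cf_arr eqxx mulr1 big1 ?addr0 // => b ba.
by rewrite cfZ cf_arr -[inr _ == _]/(a == b) eq_sym (negbTE ba) mulr0.
Qed.

Lemma vert_vert v w : vert v * vert w = if v == w then vert v else 0.
Proof.
apply: cf_inj => -[u|a].
  rewrite cfM_vertex !cf_vert -natrM mulnb.
  case: (v =P w) => [<-|vw]; first by rewrite cf_vert andbb.
  by rewrite cf0; case: eqP => // -[->]; case: eqP => // -[].
rewrite cfM_arrow !cf_vert mul0r mulr0 addr0.
by case: ifP => _; rewrite ?cf_vert ?cf0.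
Qed.

Lemma vert_arr v a : vert v * arr a = if v == target a then arr a else 0.
Proof.
apply: cf_inj => -[u|b].
  by rewrite cfM_vertex cf_arr mulr0; case: ifP => _; rewrite ?cf_arr ?cf0.
rewrite cfM_arrow !cf_vert !cf_arr mul0r add0r.
have [[<-]|ba] := eqVneq (inr b : short) (inr a).
  rewrite mulr1 -[inl _ == _]/(target b == v) eq_sym.
  by case: ifP; rewrite ?cf_arr ?eqxx ?cf0.
by rewrite mulr0; case: ifP; rewrite ?cf_arr ?(negbTE ba) ?cf0.
Qed.

Lemma arr_vert a v : arr a * vert v = if v == source a then arr a else 0.
Proof.
apply: cf_inj => -[u|b].
  by rewrite cfM_vertex cf_arr mul0r; case: ifP => _; rewrite ?cf_arr ?cf0.
rewrite cfM_arrow !cf_vert !cf_arr mulr0 addr0.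
have [[<-]|ba] := eqVneq (inr b : short) (inr a).
  rewrite mul1r -[inl _ == _]/(source b == v) eq_sym.
  by case: ifP; rewrite ?cf_arr ?eqxx ?cf0.
by rewrite mul0r; case: ifP; rewrite ?cf_arr ?(negbTE ba) ?cf0.
Qed.

Lemma arr_arr a b : arr a * arr b = 0.
Proof.
by apply: cf_inj => -[u|c]; rewrite cf0 ?cfM_vertex ?cfM_arrow !cf_arr ?mul0r // mulr0 addr0.
Qed.

Lemma sum_vert : \sum_v vert v = 1.
Proof.
rewrite [RHS]rsz_expand [X in _ + X]big1 ?addr0 => [|a _].
  by apply: eq_bigr => v _; rewrite cf1 scale1r.
by rewrite cf1_arrow scale0r.
Qed.

Definition rsz_rad : set A := [set x | forall v, cf x (inl v) = 0].

Lemma rsz_rad_sq x y : rsz_rad x -> rsz_rad y -> x * y = 0.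
Proof.
move=> rx ry; apply: cf_inj => -[v|a]; rewrite cf0 ?cfM_vertex ?cfM_arrow.
  by rewrite rx mul0r.
by rewrite rx ry mulr0 mul0r addr0.
Qed.

Implicit Types M N : lmodule A.

Lemma mact_expand M x : mact M x =
  \sum_v cf x (inl v) *: mact M (vert v) + \sum_a cf x (inr a) *: mact M (arr a).
Proof.
rewrite {1}[x]rsz_expand mactD !mact_sum; congr (_ + _);
  by apply: eq_bigr => i _; rewrite mactZ.
Qed.

Lemma hom_generators M N f :
  (forall v, f *m mact M (vert v) = mact N (vert v) *m f) ->
  (forall a, f *m mact M (arr a) = mact N (arr a) *m f) -> mhom M N f.
Proof.
move=> fv fa x; rewrite !(mact_expand _ x) mulmxDl mulmxDr !mulmx_suml !mulmx_sumr.
by congr (_ + _); apply: eq_bigr => i _; rewrite -scalemxAl -scalemxAr ?fv ?fa.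
Qed.
End RadicalSquareZero.

(** * Modules as pairs of matrices *)

Section Swap.
Lemma swapK : involutive swap.
Proof. by case=> [[|[|[|[|//]]]] ?]; apply: val_inj; rewrite /swap /= !inordK. Qed.
Lemma swap_neq i : swap i != i.
Proof. by case: i => [[|[|[|[|//]]]] ?]; rewrite -val_eqE /swap /= inordK. Qed.
End Swap.

Section KroneckerModules.
Variable k : fieldType.

Lemma mulmx_flat p m q (c : 'M[k]_(p, m)) (d : 'M_(m, q)) : m = 0%N -> c *m d = 0.
Proof. by move=> m0; move: c d; rewrite m0 => c d; rewrite [c]thinmx0 mul0mx. Qed.

Local Notation A := (rsz_alg k Q4).
Implicit Types (M N X : lmodule A) (i j : 'I_4).

Definition cv (x : A) i : k := cf x (inl i).
Definition ca (x : A) i (b : bool) : k := cf x (inr (i, b)).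

Definition ev i : A := vert k (Q := Q4) i.
Definition ar i b : A := arr k (Q := Q4) (i, b).

(** Surjectivity of [phi Y] says that the second component is the radical of
    [kron i Y]. *)
Definition phi r t (Y : bool -> 'M[k]_(r, t)) : 'M_(r, t + t) :=
  row_mx (Y true) (Y false).

Section Def.
Variables (i : 'I_4) (t r : nat) (Y : bool -> 'M[k]_(r, t)).

(** The space of dimension [t] sits at [i], that of dimension [r] at [swap i]; the
    two arrows at [i] act as [Y true] and [Y false]. *)
Definition kron_act (x : A) : 'M[k]_(t + r) :=
  block_mx (cv x i)%:M 0 (\sum_b ca x i b *: Y b) (cv x (swap i))%:M.

Fact kron_linear : linear kron_act.
Proof.
move=> c x y; rewrite scale_block_mx add_block_mx !scaler0 addr0 !scale_scalar_mx.
rewrite -!raddfD /kron_act /cv !cf_linear; congr block_mx.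
rewrite scaler_sumr -big_split; apply: eq_bigr => b _.
by rewrite /ca cf_linear scalerDl scalerA.
Qed.
Fact kron1 : kron_act 1 = 1%:M.
Proof.
rewrite /kron_act /cv !cf1 big1 => [|b _]; last by rewrite /ca cf1_arrow scale0r.
by rewrite -scalar_mx_block.
Qed.
Fact kronM x y : kron_act (x * y) = kron_act x *m kron_act y.
Proof.
rewrite mulmx_block !mulmx0 !mul0mx !addr0 add0r -!scalar_mxM /kron_act /cv !cfM_vertex.
congr block_mx; rewrite mulmx_suml mulmx_sumr -big_split; apply: eq_bigr => b _.
rewrite /ca cfM_arrow scalerDl mul_mx_scalar mul_scalar_mx !scalerA /=.
by rewrite [cf y _ * _]mulrC.
Qed.

Definition kron : lmodule A := rep_module kron_linear kron1 kronM.
End Def.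

Lemma kron_ev i j t r (Y : bool -> 'M[k]_(r, t)) : mact (kron i Y) (ev j) =
  block_mx (if i == j then 1%:M else 0) 0 0 (if swap i == j then 1%:M else 0).
Proof.
rewrite /= /kron_act /cv !cf_vert big1 => [|b _]; last by rewrite /ca cf_vert scale0r.
have E n (c : bool) : (c%:R : k)%:M = if c then 1%:M else 0 :> 'M_n by case: c; rewrite ?raddf0.
by rewrite !E.
Qed.

Lemma kron_ar i j b t r (Y : bool -> 'M[k]_(r, t)) : mact (kron i Y) (ar j b) =
  block_mx 0 0 (if i == j then Y b else 0) 0.
Proof.
rewrite /= /kron_act /cv !cf_arr /= !raddf0; congr block_mx.
rewrite (bigD1 b) //= [X in _ + X]big1 => [|c cb].
  rewrite addr0 /ca cf_arr -[inr _ == _]/((i == j) && (b == b)) eqxx andbT.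
  by case: ifP; rewrite ?scale1r ?scale0r.
by rewrite /ca cf_arr -[inr _ == _]/((i == j) && (c == b)) (negbTE cb) andbF scale0r.
Qed.

(** Homomorphisms out of [kron i Y], the two blocks of columns being the images
    of the top and of the radical. *)
Lemma hom_kron_from i t r (Y : bool -> 'M[k]_(r, t)) N (f : 'M_(mdim N, t)) g :
  mhom (kron i Y) N (row_mx f g) <->
  [/\ mact N (ev i) *m f = f, mact N (ev (swap i)) *m g = g,
      forall b, mact N (ar i b) *m f = g *m Y b & forall b, mact N (ar (swap i) b) *m g = 0].
Proof.
split=> [H|[fi gi fY g0]].
  have Hi j := H (ev j); have Ha j b := H (ar j b).
  split.
  - have := Hi i; rewrite kron_ev mul_row_block mul_mx_row eqxx !mulmx0 addr0 mulmx1.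
    by case/eq_row_mx.
  - have := Hi (swap i); rewrite kron_ev mul_row_block mul_mx_row eqxx !mulmx0 add0r mulmx1.
    by case/eq_row_mx.
  - move=> b; have := Ha i b; rewrite kron_ar mul_row_block mul_mx_row eqxx !mulmx0 add0r.
    by case/eq_row_mx.
  - move=> b; have := Ha (swap i) b.
    rewrite kron_ar mul_row_block mul_mx_row !mulmx0 addr0.
    by case/eq_row_mx.
have E j x : mact N (ev j) *m mact N x = mact N (ev j * x) by rewrite mactM.
have R j b x : mact N (ar j b) *m mact N x = mact N (ar j b * x) by rewrite mactM.
have zero (V W : 'M[k]_(mdim N)) (p : nat) (u : 'M_(mdim N, p)) : V *m u = u -> W *m V = 0 -> W *m u = 0.
  by move=> <- WV; rewrite mulmxA WV mul0mx.
apply: hom_generators => [j|[j b]].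
  rewrite -[vert _ _]/(ev j) kron_ev mul_row_block mul_mx_row !mulmx0 addr0 add0r.
  congr row_mx.
    have [<-|ij] := eqVneq i j; first by rewrite mulmx1 fi.
    rewrite mulmx0; apply/esym/(zero _ _ _ _ fi).
    by rewrite E vert_vert eq_sym (negbTE ij) raddf0.
  have [<-|ij] := eqVneq (swap i) j; first by rewrite mulmx1 gi.
  rewrite mulmx0; apply/esym/(zero _ _ _ _ gi).
  by rewrite E vert_vert eq_sym (negbTE ij) raddf0.
rewrite -[arr _ _]/(ar j b) kron_ar mul_row_block mul_mx_row !mulmx0 add0r addr0.
congr row_mx.
  have [<-|ij] := eqVneq i j; first by rewrite fY.
  rewrite mulmx0; apply/esym/(zero _ _ _ _ fi).
  by rewrite R arr_vert /= (negbTE ij) raddf0.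
have [<-|ij] := eqVneq (swap i) j; first by rewrite g0.
apply/esym/(zero _ _ _ _ gi).
by rewrite R arr_vert /= (negbTE ij) raddf0.
Qed.

Lemma hom_kron_to i t r (Y : bool -> 'M[k]_(r, t)) M f g :
  (forall x, f *m mact M x = cv x i *: f) ->
  (forall x, g *m mact M x = cv x (swap i) *: g + \sum_b ca x i b *: (Y b *m f)) ->
  mhom M (kron i Y) (col_mx f g).
Proof.
move=> Hf Hg x; rewrite mul_col_mx Hf Hg [RHS]mul_block_col mul0mx addr0 !mul_scalar_mx.
by rewrite addrC mulmx_suml; congr (col_mx _ (_ + _)); apply: eq_bigr => b _; rewrite scalemxAl.
Qed.

Lemma hom_kron_kron i t r (Y : bool -> 'M[k]_(r, t)) t' r' (Y' : bool -> 'M[k]_(r', t')) F :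
  mhom (kron i Y) (kron i Y') F <->
  exists l h, F = block_mx l 0 0 h /\ forall b, Y' b *m l = h *m Y b.
Proof.
have si := negbTE (swap_neq i); have si' : (i == swap i) = false by rewrite eq_sym.
split=> [|[l [h [-> H]]]].
  rewrite -[F in mhom _ _ F](@hsubmxK _ (t' + r') t r) => /hom_kron_from[].
  rewrite -[lsubmx F](@vsubmxK _ t' r' t) -[rsubmx F](@vsubmxK _ t' r' r) !kron_ev.
  rewrite !eqxx si' si !mul_block_col !mul0mx !addr0 !mul1mx !add0r.
  move=> /eq_col_mx[_ f0] /eq_col_mx[g0 _] fY _.
  exists (usubmx (lsubmx F)), (dsubmx (rsubmx F)); split.
    rewrite -[LHS](@hsubmxK _ (t' + r') t r) -[lsubmx F in LHS](@vsubmxK _ t' r' t).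
    by rewrite -[rsubmx F in LHS](@vsubmxK _ t' r' r) -f0 -g0 block_mxEh.
  move=> b; have := fY b; rewrite kron_ar eqxx mul_block_col !mul0mx !addr0 -g0.
  by rewrite mul_col_mx mul0mx => /eq_col_mx[].
rewrite block_mxEh; apply/hom_kron_from; rewrite !kron_ev !eqxx si' si.
rewrite !mul_block_col !mul0mx !addr0 !mul1mx add0r; split=> // b.
  by rewrite kron_ar eqxx mul_block_col mul_col_mx !mul0mx !addr0 H.
by rewrite kron_ar si' mul_block_col !mul0mx !addr0 col_mx0.
Qed.

(** Between modules with tops at different vertices nothing maps onto the top:
    the radical is spanned by images of arrows. *)
Lemma hom_kron_no_top i t r (Y : bool -> 'M[k]_(r, t)) j t' r' (Y' : bool -> 'M[k]_(r', t')) F :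
  i != j -> onto_mx (phi Y) -> mhom (kron i Y) (kron j Y') F ->
  @usubmx _ t' r' (t + r) F = 0.
Proof.
move=> ij /ontoP[q Yq].
rewrite -[F in mhom _ _ F](@hsubmxK _ (t' + r') t r) => /hom_kron_from[].
rewrite -[lsubmx F](@vsubmxK _ t' r' t) -[rsubmx F](@vsubmxK _ t' r' r) !kron_ev.
rewrite [j == i]eq_sym (negbTE ij) !mul_block_col !mul0mx !addr0 add0r.
move=> /eq_col_mx[f0 _] _ fY _.
have g0 b : usubmx (rsubmx F) *m Y b = 0.
  have := fY b; rewrite kron_ar mul_block_col !mul0mx addr0 mul_col_mx.
  by case/eq_col_mx.
have g00 : usubmx (rsubmx F) = 0.
  by rewrite -[LHS]mulmx1 -Yq mulmxA mul_mx_row !g0 row_mx0 mul0mx.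
rewrite -[F](@hsubmxK _ (t' + r') t r) -[lsubmx F](@vsubmxK _ t' r' t).
rewrite -[rsubmx F](@vsubmxK _ t' r' r) -f0 g00.
by rewrite -block_mxEh block_mxEv col_mxKu row_mx0.
Qed.

Lemma kron_retract_iso i t r (Y : bool -> 'M[k]_(r, t)) t' r' (Y' : bool -> 'M[k]_(r', t')) l h l' h' :
  (forall b, Y' b *m l = h *m Y b) -> (forall b, Y b *m l' = h' *m Y' b) ->
  l *m l' = 1%:M -> l' *m l = 1%:M -> h *m h' = 1%:M -> h' *m h = 1%:M ->
  iso (kron i Y) (kron i Y').
Proof.
move=> Hl Hl' ll' l'l hh' h'h; exists (block_mx l 0 0 h), (block_mx l' 0 0 h').
split; try by apply/hom_kron_kron; exists l, h; split.
- by apply/hom_kron_kron; exists l', h'; split.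
- by rewrite [LHS]mulmx_block !mulmx0 !mul0mx !addr0 add0r ll' hh' -scalar_mx_block.
- by rewrite [LHS]mulmx_block !mulmx0 !mul0mx !addr0 add0r l'l h'h -scalar_mx_block.
Qed.

(** Every module is a direct sum of modules [kron i Y].  Choose a projection [D]
    that kills the radical and commutes with the stationary paths.  As the
    arrows at [v] end at [swap v], and [swap] is an involution, the
    endomorphism [E v D + E (swap v) (1 - D)] is the projection onto the
    submodule generated by the part of the top at [v]. *)
Lemma indecomposable_kron X : indecomposable X ->
  exists i t r (Y : bool -> 'M[k]_(r, t)), [/\ (0 < t)%N, onto_mx (phi Y) & iso X (kron i Y)].
Proof.
move=> Xi; have [X0 _] := Xi.
pose E j := mact X (ev j); pose R (a : arrow Q4) := mact X (arr k a).
have EE v w : E v *m E w = if v == w then E v else 0.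
  by rewrite -mactM vert_vert; case: ifP => _ //; rewrite raddf0.
have ER v a : E v *m R a = if v == target a then R a else 0.
  by rewrite -mactM vert_arr; case: ifP => _ //; rewrite raddf0.
have RE a v : R a *m E v = if v == source a then R a else 0.
  by rewrite -mactM arr_vert; case: ifP => _ //; rewrite raddf0.
have RR a b : R a *m R b = 0 by rewrite -mactM arr_arr raddf0.
have sumE : \sum_v E v = 1%:M by rewrite -mact1 -sum_vert mact_sum.
(* [1 - D0] is a linear projection onto the radical *)
have [D0 [D0R [Z0 D0E]]] : exists D0, (forall a, D0 *m R a = 0) /\
    exists Z0, 1%:M - D0 = \sum_a R a *m Z0 a.
  pose U := (\sum_a (R a)^T)%MS; pose P := pinvmx U *m U.
  exists (1%:M - P^T); split=> [a|].
    apply: trmx_inj; rewrite mulmxBl mul1mx raddfB /= trmx_mul trmxK trmx0 mulmxA.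
    by rewrite mulmxKpV ?subrr // (sumsmx_sup a).
  have /sub_sumsmxP[z zP] : (P <= U)%MS by exact: submxMl.
  exists (fun a => (z a)^T); rewrite opprB addrC subrK zP raddf_sum.
  by apply: eq_bigr => a _; rewrite /= trmx_mul trmxK.
(* averaging over the stationary paths makes the projection homogeneous *)
pose D := \sum_v E v *m D0 *m E v.
have DE v : D *m E v = E v *m D0 *m E v.
  rewrite mulmx_suml (bigD1 v) //= -mulmxA EE eqxx [X in _ + X]big1 ?addr0 // => w wv.
  by rewrite -mulmxA EE (negbTE wv) mulmx0.
have ED v : E v *m D = E v *m D0 *m E v.
  rewrite mulmx_sumr (bigD1 v) //= !mulmxA EE eqxx [X in _ + X]big1 ?addr0 // => w wv.
  by rewrite !mulmxA EE eq_sym (negbTE wv) !mul0mx.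
have EDC v : E v *m D = D *m E v by rewrite ED DE.
have DR a : D *m R a = 0.
  by rewrite mulmx_suml big1 // => v _; rewrite -mulmxA ER; case: ifP => _;
     rewrite ?mulmx0 // -mulmxA D0R mulmx0.
have [Z DZ] : exists Z, 1%:M - D = \sum_a R a *m Z a.
  exists (fun a => Z0 a *m E (target a)).
  transitivity (\sum_v E v *m (1%:M - D0) *m E v).
    rewrite -[X in X - D]sumE /D -sumrB; apply: eq_bigr => v _.
    by rewrite mulmxBr mulmxBl mulmx1 EE eqxx.
  rewrite D0E; under eq_bigr do rewrite mulmx_sumr mulmx_suml.
  rewrite exchange_big; apply: eq_bigr => a _.
  rewrite (bigD1 (target a)) //= mulmxA ER eqxx -mulmxA big1 ?addr0 // => v va.
  by rewrite mulmxA ER (negbTE va) !mul0mx.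
have RD a : R a *m (1%:M - D) = 0.
  by rewrite DZ mulmx_sumr big1 // => b _; rewrite mulmxA RR mul0mx.
have RD' a : R a *m D = R a.
  by have /eqP := RD a; rewrite mulmxBr mulmx1 subr_eq0 => /eqP.
have DD : D *m (1%:M - D) = 0.
  by rewrite DZ mulmx_sumr big1 // => b _; rewrite mulmxA DR mul0mx.
have DD' : D *m D = D.
  by move/eqP: DD; rewrite mulmxBr mulmx1 subr_eq0 => /eqP.
have CC : (1%:M - D) *m (1%:M - D) = 1%:M - D.
  by rewrite mulmxBl mul1mx DD subr0.
have ECC v : E v *m (1%:M - D) = (1%:M - D) *m E v.
  by rewrite mulmxBl mulmxBr mul1mx mulmx1 EDC.
(* the idempotents [eps v] commute with the action and sum to one *)
pose eps v := E v *m D + E (swap v) *m (1%:M - D).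
have epsR v a : R a *m eps v = if v == source a then R a else 0.
  rewrite mulmxDr (mulmxA _ (E (swap v))) RE [X in _ + X](_ : _ = 0); last first.
    by case: ifP; rewrite ?RD ?mul0mx.
  by rewrite addr0 mulmxA RE; case: ifP; rewrite ?RD' ?mul0mx.
have Repst v a : eps v *m R a = if v == source a then R a else 0.
  rewrite mulmxDl -mulmxA DR mulmx0 add0r -mulmxA mulmxBl DR subr0 mul1mx ER /=.
  by rewrite (inj_eq (inv_inj swapK)).
have Heps v : mhom X X (eps v).
  apply: hom_generators => [w|a]; last by rewrite [RHS]epsR [LHS]Repst.
  have EC u : E u *m E w = E w *m E u by rewrite !EE eq_sym; case: eqP => // ->.
  rewrite -[mact X _]/(E w) [LHS]mulmxDl [RHS]mulmxDr -!mulmxA -EDC -ECC.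
  by rewrite !mulmxA !EC.
have CD : (1%:M - D) *m D = 0 by rewrite mulmxBl mul1mx DD' subrr.
have eps2 v : eps v *m eps v = eps v.
  have e1 u w p q : p *m E w = E w *m p -> (E u *m p) *m (E w *m q) = (E u *m E w) *m (p *m q).
    by move=> pE; rewrite mulmxA -(mulmxA (E u)) pE !mulmxA.
  have dist (p q : 'M[k]_(mdim X)) : (p + q) *m (p + q) = p *m p + p *m q + (q *m p + q *m q).
    by rewrite mulmxDl !mulmxDr.
  rewrite [LHS]dist !e1 // DD DD' CC CD !mulmx0 addr0 add0r.
  by rewrite !EE !eqxx.
have [i epsi] : exists i, eps i = 1%:M.
  apply: contrapT => no.
  have eps0 v : eps v = 0.
    by have [//|e1] := indec_idem Xi (Heps v) (eps2 v); case: no; exists v.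
  have : \sum_v eps v = 1%:M.
    have sumE' : \sum_v E (swap v) = 1%:M by rewrite -sumE [RHS](reindex_inj (inv_inj swapK)).
    by rewrite big_split -!mulmx_suml /= sumE sumE' !mul1mx addrC subrK.
  rewrite big1 // => /esym/(congr1 (@mxrank _ _ _)).
  by rewrite mxrank1 mxrank0 => X00; rewrite X00 in X0.
have si := negbTE (swap_neq i); have si' : (i == swap i) = false by rewrite eq_sym.
(* now [Dt] and [Dr] are the complementary projections to top and radical *)
pose Dt := E i *m D; pose Dr := E (swap i) *m (1%:M - D).
have Dt2 : Dt *m Dt = Dt.
  by rewrite /Dt mulmxA -(mulmxA _ D) -EDC !mulmxA EE eqxx -mulmxA DD'.
have Dr2 : Dr *m Dr = Dr.
  by rewrite /Dr mulmxA -(mulmxA _ (_ - D)) -ECC !mulmxA EE eqxx -mulmxA CC.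
have Dtr : Dt + Dr = 1%:M by [].
have DrE : Dr = 1%:M - Dt by rewrite -Dtr [RHS]addrC addKr.
have DtDr : Dt *m Dr = 0 by rewrite DrE mulmxBr mulmx1 Dt2 subrr.
have DrDt : Dr *m Dt = 0 by rewrite DrE mulmxBl mul1mx Dt2 subrr.
have [m [ct [dt [_ cdt dct]]]] := idempotent_factor Dt2.
have [n [cr [dr [_ cdr dcr]]]] := idempotent_factor Dr2.
have Dtc : Dt *m ct = ct by rewrite -cdt -mulmxA dct mulmx1.
have Drc : Dr *m cr = cr by rewrite -cdr -mulmxA dcr mulmx1.
have dtD : dt *m Dt = dt by rewrite -cdt mulmxA dct mul1mx.
have drD : dr *m Dr = dr by rewrite -cdr mulmxA dcr mul1mx.
have DrR b : Dr *m R (i, b) = R (i, b).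
  by rewrite /Dr -mulmxA mulmxBl DR subr0 mul1mx ER /= eqxx.
have RDt b : R (i, b) *m Dt = R (i, b).
  by rewrite /Dt mulmxA RE /= eqxx RD'.
pose Y b := dr *m R (i, b) *m ct.
exists i, m, n, Y.
have Yo : onto_mx (phi Y).
  apply/ontoP; exists (col_mx (dt *m Z (i, true) *m cr) (dt *m Z (i, false) *m cr)).
  have YE b z : Y b *m (dt *m z *m cr) = dr *m (R (i, b) *m z) *m cr.
    by rewrite /Y !mulmxA -(mulmxA _ ct) cdt -(mulmxA dr) RDt.
  rewrite mul_row_col !YE -mulmxDl -mulmxDr.
  have -> : R (i, true) *m Z (i, true) + R (i, false) *m Z (i, false) = Dr.
    transitivity (\sum_b R (i, b) *m Z (i, b)); first by rewrite big_bool.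
    rewrite /Dr DZ mulmx_sumr (eq_bigr (fun a => if a.1 == i then R a *m Z a else 0)) => [|a _]; last first.
      by rewrite mulmxA ER /= (inj_eq (inv_inj swapK)) eq_sym; case: ifP => _; rewrite ?mul0mx.
    rewrite [RHS](eq_bigr (fun p : 'I_4 * bool => if p.1 == i then R (p.1, p.2) *m Z (p.1, p.2) else 0)).
      rewrite -(pair_bigA _ (fun j b => if j == i then R (j, b) *m Z (j, b) else 0)) /=.
      rewrite (bigD1 i) //= [X in _ + X]big1 ?addr0 => [|j /negbTE -> //].
        by apply: eq_bigr => b _; rewrite eqxx.
      by rewrite big1.
    by case.
  by rewrite drD dcr.
split=> //.
  rewrite lt0n; apply/negP => /eqP t0; have /ontoP[q] := Yo.
  move=> /mulmx1_min; rewrite t0 addn0 leqn0 => /eqP r0.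
  have : \rank (1%:M : 'M[k]_(mdim X)) = 0%N.
    rewrite -Dtr -cdt -cdr; apply/eqP; rewrite mxrank_eq0.
    by rewrite !mulmx_flat ?addr0.
  by rewrite mxrank1 => X00; rewrite X00 in X0.
have fg : row_mx ct cr *m col_mx dt dr = 1%:M by rewrite mul_row_col cdt cdr Dtr.
have gf : col_mx dt dr *m row_mx ct cr = 1%:M.
  rewrite mul_col_row dct dcr -dtD -[cr in X in block_mx _ X]Drc -drD -[ct in X in block_mx _ _ X]Dtc.
  rewrite -(mulmxA dt) -(mulmxA dr) (mulmxA Dt) (mulmxA Dr) DtDr DrDt !mul0mx !mulmx0.
  by rewrite -scalar_mx_block.
have Hf : mhom (kron i Y) X (row_mx ct cr).
  apply/hom_kron_from; split=> [||b|b].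
  - by rewrite -[mact X _]/(E i) -Dtc /Dt !mulmxA EE eqxx.
  - by rewrite -[mact X _]/(E (swap i)) -Drc /Dr !mulmxA EE eqxx.
  - by rewrite /Y !mulmxA cdr DrR.
  - by rewrite -[mact X _]/(R (swap i, b)) -Drc /Dr !mulmxA RE /= eqxx RD mul0mx.
by apply: iso_sym; exists (row_mx ct cr), (col_mx dt dr); split=> //; exact: hom_inv Hf _ fg gf.
Qed.
End KroneckerModules.

(** * Kronecker pairs and the Euler form *)

Section KroneckerPairs.
Variable k : fieldType.
Implicit Types (t r n m : nat).
Local Notation pair r t := (bool -> 'M[k]_(r, t)).

(** Representations of the Kronecker quiver.  In [kext0], [G] is a cocycle and the
    pair [(h, l)] bounds it. *)
Definition khom r t (Y : pair r t) r' t' (Y' : pair r' t') l h : Prop :=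
  forall b, Y' b *m l = h *m Y b.

Definition kext0 r t (Y : pair r t) r' t' (Y' : pair r' t') : Prop :=
  forall G : pair r' t, exists h l, forall b, G b = h *m Y b - Y' b *m l.

Definition kindec r t (Y : pair r t) : Prop := forall l h, khom Y Y l h ->
  l *m l = l -> h *m h = h -> l = 0 /\ h = 0 \/ l = 1%:M /\ h = 1%:M.

Definition kiso r t (Y : pair r t) r' t' (Y' : pair r' t') : Prop :=
  exists l h l' h', [/\ khom Y Y' l h, khom Y' Y l' h', l *m l' = 1%:M /\ l' *m l = 1%:M
    & h *m h' = 1%:M /\ h' *m h = 1%:M].

Definition ktr r t (Y : pair r t) : pair t r := fun b => (Y b)^T.

Lemma khom_tr r t (Y : pair r t) r' t' (Y' : pair r' t') l h :
  khom Y Y' l h -> khom (ktr Y') (ktr Y) h^T l^T.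
Proof. by move=> H b; rewrite /ktr -!trmx_mul H. Qed.

Lemma kext0_tr r t (Y : pair r t) r' t' (Y' : pair r' t') :
  kext0 Y Y' -> kext0 (ktr Y') (ktr Y).
Proof.
move=> Y0 G; have [h [l hl]] := Y0 (ktr G); exists (- l^T), (- h^T) => b.
by rewrite -[G b]trmxK -/(ktr G b) hl raddfB /= !trmx_mul mulNmx mulmxN opprK addrC.
Qed.

Lemma kindec_tr r t (Y : pair r t) : kindec Y -> kindec (ktr Y).
Proof.
move=> Yi l h /khom_tr H ll hh; have [|||[h0 l0]|[h1 l1]] := Yi h^T l^T.
- by move=> b; have := H b; rewrite /ktr trmxK.
- by rewrite -trmx_mul hh.
- by rewrite -trmx_mul ll.
- by left; rewrite -[l]trmxK l0 -[h]trmxK h0 !trmx0.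
- by right; rewrite -[l]trmxK l1 -[h]trmxK h1 !trmx1.
Qed.

Lemma kiso_tr r t (Y : pair r t) r' t' (Y' : pair r' t') : kiso Y Y' -> kiso (ktr Y) (ktr Y').
Proof.
move=> [l [h [l' [h' [H H' [ll l'l] [hh h'h]]]]]].
exists h'^T, l'^T, h^T, l^T; split; try exact: khom_tr.
  by rewrite -!trmx_mul hh h'h !trmx1.
by rewrite -!trmx_mul ll l'l !trmx1.
Qed.

Lemma kiso_dim r t (Y : pair r t) r' t' (Y' : pair r' t') : kiso Y Y' -> r = r' /\ t = t'.
Proof.
move=> [l [h [l' [h' [_ _ [ll l'l] [hh h'h]]]]]].
by split; apply/eqP; rewrite eqn_leq ?(mulmx1_min hh) ?(mulmx1_min h'h) ?(mulmx1_min ll) ?(mulmx1_min l'l).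
Qed.

Lemma kiso_onto r t (Y : pair r t) r' t' (Y' : pair r' t') l h : r = r' -> t = t' ->
  khom Y Y' l h -> onto_mx l -> onto_mx h -> kiso Y Y'.
Proof.
move=> er et; case: _ / er Y' h; case: _ / et l => l Y' h H.
move=> /ontoP[l' ll] /ontoP[h' hh].
have l'l := mulmx1C ll; have h'h := mulmx1C hh.
exists l, h, l', h'; split=> // b.
by rewrite -[RHS]mulmx1 -ll !mulmxA -(mulmxA h') H !mulmxA h'h mul1mx.
Qed.

(** The defect map [(h, l) |-> (h Y b - Y' b l)_b], whose kernel is [Hom(Y, Y')]
    and whose cokernel is [Ext(Y, Y')]. *)
Section Euler.
Variables (r t : nat) (Y : pair r t) (r' t' : nat) (Y' : pair r' t').

Definition kdefect : 'M[k]_(r' * r + t' * t, r' * t + r' * t) :=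
  block_mx (lin_mx (mulmxr (Y true))) (lin_mx (mulmxr (Y false)))
           (- lin_mx (mulmx (Y' true))) (- lin_mx (mulmx (Y' false))).

Lemma kdefectE h l : row_mx (mxvec h) (mxvec l) *m kdefect =
  row_mx (mxvec (h *m Y true - Y' true *m l)) (mxvec (h *m Y false - Y' false *m l)).
Proof. by rewrite mul_row_block !mulmxN !mul_vec_lin /= -!linearB. Qed.

Lemma kdefect_eq0 h l : (row_mx (mxvec h) (mxvec l) *m kdefect == 0) <-> khom Y Y' l h.
Proof.
rewrite kdefectE row_mx_eq0 !mxvec_eq0 !subr_eq0; split=> [/andP[/eqP e1 /eqP e0] []//|H].
by rewrite !H !eqxx.
Qed.

Lemma kdefect_full : kext0 Y Y' <-> row_full kdefect.
Proof.
rewrite -sub1mx; split=> [ext|/submxP[D DK] G].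
  apply/row_subP => i; set w := row i _.
  have [h [l hl]] := ext (fun b => vec_mx (if b then lsubmx w else rsubmx w)).
  apply/submxP; exists (row_mx (mxvec h) (mxvec l)).
  by rewrite kdefectE -!hl !vec_mxK hsubmxK.
pose w := row_mx (mxvec (G true)) (mxvec (G false)) *m D.
exists (vec_mx (lsubmx w)), (vec_mx (rsubmx w)).
have : w *m kdefect = row_mx (mxvec (G true)) (mxvec (G false)).
  by rewrite -mulmxA -DK mulmx1.
rewrite -[w in w *m _]hsubmxK -[lsubmx w in LHS]vec_mxK -[rsubmx w in LHS]vec_mxK.
rewrite kdefectE => /eq_row_mx[e1 e0] b.
by apply: (can_inj mxvecK); case: b; rewrite ?e1 ?e0.
Qed.

Lemma kext0_euler : kext0 Y Y' -> (r' * t + r' * t <= r' * r + t' * t)%N.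
Proof. by move=> /kdefect_full/eqP <-; exact: rank_leq_row. Qed.

(** A nonzero homomorphism makes the Euler form strictly positive when extensions
    vanish. *)
Lemma kext0_euler_lt l h : kext0 Y Y' -> khom Y Y' l h -> (l != 0) || (h != 0) ->
  (r' * t + r' * t < r' * r + t' * t)%N.
Proof.
move=> ext /kdefect_eq0 K nz; rewrite ltn_neqAle kext0_euler // andbT.
apply/negP => e; have /row_freeP[D KD] : row_free kdefect.
  by rewrite /row_free (eqP (kdefect_full.1 ext)).
move: nz; rewrite -(mxvec_eq0 h) -(mxvec_eq0 l) orbC -negb_and -row_mx_eq0.
by rewrite -[row_mx _ _]mulmx1 -KD mulmxA (eqP K) mul0mx eqxx.
Qed.

Lemma kext0_hom0 : (r' * t + r' * t = r' * r + t' * t)%N ->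
  (forall l h, khom Y Y' l h -> l = 0 /\ h = 0) -> kext0 Y Y'.
Proof.
move=> e H; apply/kdefect_full; rewrite /row_full [X in _ == X]e.
rewrite -/(row_free _) -kermx_eq0; apply/eqP/row_matrixP => i; rewrite row0.
set w := row i _; have : w *m kdefect = 0 by rewrite -row_mul mulmx_ker row0.
rewrite -[w]hsubmxK -[lsubmx w]vec_mxK -[rsubmx w]vec_mxK => /eqP/kdefect_eq0/H[-> ->].
by rewrite !linear0 row_mx0.
Qed.
End Euler.

(** When the Euler form of [Y] with itself is one and extensions vanish, the
    endomorphisms form a line, spanned by the identity. *)
Lemma kext0_scalar r t (Y : pair r t) l h : kext0 Y Y ->
  (r * r + t * t = (r * t + r * t).+1)%N -> khom Y Y l h -> exists c, l = c%:M /\ h = c%:M.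
Proof.
move=> ext e H; set K := kdefect Y Y.
pose one : 'rV_(_ + _) := row_mx (mxvec (1%:M : 'M[k]_r)) (mxvec (1%:M : 'M[k]_t)).
have one0 : one != 0.
  rewrite row_mx_eq0 !mxvec_eq0 -!mxrank_eq0 !mxrank1; apply/negP => /andP[/eqP r0 /eqP t0].
  by move: e; rewrite r0 t0.
have oneK : (one <= kermx K)%MS.
  by apply/sub_kermxP/eqP/kdefect_eq0 => b; rewrite mulmx1 mul1mx.
have rK : \rank (kermx K) = 1%N.
  by rewrite mxrank_ker (eqP ((kdefect_full Y Y).1 ext)) e subSn // subnn.
have Kone : (kermx K <= one)%MS.
  by rewrite -(mxrank_leqif_sup oneK).2 rK rank_rV one0.
have : (row_mx (mxvec h) (mxvec l) <= one)%MS.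
  by apply: submx_trans Kone; apply/sub_kermxP/eqP/kdefect_eq0.
move=> /sub_rVP[c]; rewrite scale_row_mx => /eq_row_mx[hc lc]; exists c.
split; apply: (can_inj mxvecK); rewrite ?lc ?hc -linearZ /= scale_scalar_mx mulr1 //.
Qed.

(** The pairs of inclusions of polynomials of degree less than [n] into those of
    degree at most [n], as multiplications by the two variables. *)
Definition Qk n : pair n.+1 n :=
  fun b => \matrix_(i, j) (if b then i == j :> nat else i == j.+1 :> nat)%:R.

(** Entries with natural indices, zero outside of the matrix, so that shifts of
    rows and columns need no bounds in the types. *)
Definition mget m n (M : 'M[k]_(m, n)) (a b : nat) : k :=
  match insub a, insub b with Some i, Some j => M i j | _, _ => 0 end.

Lemma mgetE m n (M : 'M[k]_(m, n)) (i : 'I_m) (j : 'I_n) : mget M i j = M i j.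
Proof. by rewrite /mget !valK. Qed.
Lemma mget_row m n (M : 'M[k]_(m, n)) a b : (m <= a)%N -> mget M a b = 0.
Proof. by move=> ma; rewrite /mget insubF // ltnNge ma. Qed.
Lemma mget_mx m n (M : 'M[k]_(m, n)) a b (am : (a < m)%N) (bn : (b < n)%N) :
  mget M a b = M (Ordinal am) (Ordinal bn).
Proof. by rewrite -mgetE. Qed.

Lemma mget_Qk_mull n p b (M : 'M[k]_(n, p)) a j : (a <= n)%N -> (j < p)%N ->
  mget (Qk n b *m M) a j = if b then mget M a j else if a is a'.+1 then mget M a' j else 0.
Proof.
move=> an jp; have an' : (a < n.+1)%N by [].
rewrite (mget_mx _ an' jp) !mxE; case: b.
  have [lt|ge] := ltnP a n.
    rewrite (mget_mx _ lt jp) (bigD1 (Ordinal lt)) //= !mxE eqxx mul1r big1 ?addr0 // => c ca.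
    by rewrite mxE -[a == c :> nat]/(a == val c) eq_sym -[a]/(val (Ordinal lt)) (inj_eq val_inj) (negbTE ca) mul0r.
  rewrite mget_row // big1 // => c _; rewrite mxE /= [a == c :> nat]gtn_eqF ?mul0r //.
  exact: leq_trans (ltn_ord c) ge.
case: a an an' => [|a] an an'; first by rewrite big1 // => c _; rewrite mxE mul0r.
rewrite (mget_mx _ an jp) (bigD1 (Ordinal an)) //= !mxE /= eqxx mul1r big1 ?addr0 // => c ca.
by rewrite mxE /= eqSS eq_sym -[a]/(val (Ordinal an)) (inj_eq val_inj) (negbTE ca) mul0r.
Qed.

Lemma mget_Qk_mulr n p b (M : 'M[k]_(p, n.+1)) a j : (a < p)%N -> (j < n)%N ->
  mget (M *m Qk n b) a j = if b then mget M a j else mget M a j.+1.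
Proof.
move=> ap jn; rewrite (mget_mx _ ap jn) !mxE.
have j1 : ((if b then j else j.+1) < n.+1)%N by case: b => //; exact: ltnW.
rewrite (bigD1 (Ordinal j1)) //= !mxE big1 ?addr0 => [|c cj]; last first.
  rewrite mxE; case: b j1 cj => j1 cj; by rewrite -[X in nat_of_bool (_ == X)]/(val (Ordinal j1)) (inj_eq val_inj) (negbTE cj) mulr0.
by case: b j1 => j1 /=; rewrite eqxx mulr1 -mget_mx.
Qed.

Lemma mget_inj m n (M N : 'M[k]_(m, n)) :
  (forall a b, (a < m)%N -> (b < n)%N -> mget M a b = mget N a b) -> M = N.
Proof. by move=> MN; apply/matrixP => i j; rewrite -!mgetE MN. Qed.

(** The two variables commute. *)
Lemma Qk_comm n b c : Qk n.+1 b *m Qk n c = Qk n.+1 c *m Qk n b.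
Proof.
apply: mget_inj => a j an jn; rewrite !mget_Qk_mull //.
have E x y b' : (x < n.+1)%N -> (y < n)%N ->
    mget (Qk n b') x y = (if b' then x == y else x == y.+1)%:R.
  by move=> xn yn; rewrite (@mget_mx _ _ _ x y xn yn) mxE.
have E1 y b' : mget (Qk n b') n.+1 y = 0 by exact: mget_row.
have shift x : (x < n.+1)%N -> mget (Qk n false) x.+1 j = mget (Qk n true) x j.
  rewrite ltnS leq_eqVlt => /predU1P[->|xn]; first by rewrite E1 E // gtn_eqF.
  by rewrite !E // ltnW.
have shift0 : mget (Qk n false) 0 j = 0 by rewrite E.
by case: b; case: c => //; case: a an => [|a] an; rewrite ?shift0 ?shift.
Qed.
End KroneckerPairs.

(** * Classification of the rigid indecomposable pairs *)

Section KroneckerClassification.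
Variable k : fieldType.
Implicit Types (t r n m : nat).
Local Notation pair r t := (bool -> 'M[k]_(r, t)).
Local Notation Qk := (@Qk k).

(** A homomorphism that lowers the degree vanishes: the two commutation rules
    make the matrix constant along diagonals and send every diagonal out of
    range. *)
Lemma khom_Qk_down m n l h : (n < m)%N -> khom (Qk m) (Qk n) l h -> l = 0 /\ h = 0.
Proof.
move=> nm H.
pose L := mget l; pose P := mget h.
have HT a j : (a <= n)%N -> (j < m)%N -> P a j = L a j.
  move=> an jm; have := congr1 (fun M => mget M a j) (H true).
  by rewrite /= mget_Qk_mull // mget_Qk_mulr.
have HF a j : (a <= n)%N -> (j < m)%N -> P a j.+1 = if a is a'.+1 then L a' j else 0.
  move=> an jm; have := congr1 (fun M => mget M a j) (H false).
  by rewrite /= mget_Qk_mull // mget_Qk_mulr.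
have step a j : (a <= n)%N -> (j.+1 < m)%N -> L a j.+1 = if a is a'.+1 then L a' j else 0.
  by move=> an jm; rewrite -HT // HF // ltnW.
have up a : forall j, (a <= n)%N -> (a < j < m)%N -> L a j = 0.
  elim: a => [|a IH] [|j] an // /andP[aj jm]; rewrite step //.
  by rewrite IH ?(ltnW an) // -ltnS aj ltnW.
have down d : forall a j, (a + d = n)%N -> (j <= a)%N -> L a j = 0.
  elim: d => [|d IH] a j; first by rewrite addn0 => -> _; exact: mget_row.
  rewrite addnS -addSn => an ja; have an' : (a.+1 <= n)%N by rewrite -an leq_addr.
  have jm : (j.+1 < m)%N by lia.
  by have <- := @step a.+1 j an' jm; apply: IH.
have L0 a j : (a <= n)%N -> (j < m)%N -> L a j = 0.
  move=> an jm; have [ja|aj] := leqP j a; first by apply: (down (n - a)%N); rewrite ?subnKC.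
  by apply: up; rewrite ?aj.
have P0 a j : (a <= n)%N -> (j <= m)%N -> P a j = 0.
  move=> an; rewrite leq_eqVlt => /predU1P[->|jm]; last by rewrite HT // L0.
  rewrite (_ : P a m = P a m.-1.+1); last by congr P; lia.
  have m1 : (m.-1 < m)%N by lia.
  by rewrite HF //; case: a an => // a an; rewrite L0 // ltnW.
by split; apply/matrixP => i j; rewrite -mgetE mxE; [apply: L0 | apply: P0] => //;
  rewrite ?(ltnW (ltn_ord i)) // -ltnS.
Qed.

(** The section sends all monomials but the last through the first variable. *)
Lemma Qk_onto n : onto_mx (phi (Qk n.+1)).
Proof.
apply/ontoP.
pose q1 : 'M[k]_(n.+1, n.+2) := \matrix_(i, j) (i == j :> nat)%:R.
pose q0 : 'M[k]_(n.+1, n.+2) := \matrix_(i, j) ((i == n :> nat) && (j == n.+1 :> nat))%:R.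
exists (col_mx q1 q0); rewrite mul_row_col; apply: mget_inj => a j an jn.
rewrite (mget_mx _ an jn) mxE -!mgetE /= !mget_Qk_mull // (mget_mx 1%:M an jn) mxE -val_eqE /=.
have q1E x : (x < n.+1)%N -> mget q1 x j = (x == j)%:R.
  by move=> xn; rewrite (mget_mx q1 xn jn) mxE.
have q0E x : (x < n.+1)%N -> mget q0 x j = ((x == n) && (j == n.+1))%:R.
  by move=> xn; rewrite (mget_mx q0 xn jn) mxE.
move: an; rewrite ltnS leq_eqVlt => /predU1P[->|an].
  by rewrite mget_row // add0r q0E // eqxx eq_sym.
rewrite q1E //; case: a an => [|a] an; first by rewrite addr0.
by rewrite q0E 1?ltnW // (_ : (a == n) = false) ?addr0 //; lia.
Qed.

(** For [n = m + 1] the Euler form is zero and there are no homomorphisms.  From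
    there on [m] grows, because [Qk_comm] makes two copies of [Qk m] cover
    [Qk m.+1], and vanishing of extensions passes to quotients. *)
Lemma kext0_Qk n m : (n <= m.+1)%N -> kext0 (Qk n) (Qk m).
Proof.
case: n => [_ G|n]; first by exists 0, 0 => b; rewrite [G b]thinmx0 [RHS]thinmx0.
rewrite ltnS => /subnK <-; elim: (m - n)%N => [|d IH].
  apply: kext0_hom0 => [|l h /khom_Qk_down]; last exact.
  by rewrite add0n; lia.
rewrite addSn => G; move: (d + n)%N IH G => {d}p IH G.
have /ontoP[q pq] := @Qk_onto p.
have [h1 [l1 H1]] := IH (fun b => usubmx (q *m G b)).
have [h0 [l0 H0]] := IH (fun b => dsubmx (q *m G b)).
exists (Qk p.+1 true *m h1 + Qk p.+1 false *m h0), (Qk p true *m l1 + Qk p false *m l0) => b.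
rewrite -[G b]mul1mx -pq -mulmxA -[q *m G b]vsubmxK mul_row_col H1 H0 !mulmxBr.
rewrite mulmxDl mulmxDr !mulmxA !(Qk_comm _ _ b) opprD.
by rewrite addrACA.
Qed.

Lemma kext0_QkF n m : (m.+1 < n)%N -> ~ kext0 (Qk n) (Qk m).
Proof. by move=> mn /kext0_euler; nia. Qed.

Lemma kext0_cross n m : ~ kext0 (ktr (Qk n)) (Qk m).
Proof. by move=> /kext0_euler; nia. Qed.

Lemma kext0_Qk0 r t (Y : pair r t) : kext0 Y (Qk 0) -> (t + t <= r)%N.
Proof. by move=> /kext0_euler; lia. Qed.

Lemma kindec_scalar r t (Y : pair r t) :
  (forall l h, khom Y Y l h -> exists c, l = c%:M /\ h = c%:M) -> kindec Y.
Proof.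
move=> sc l h /sc[c [-> ->]]; rewrite -!scalar_mxM => lc hc.
have [->|c0] := eqVneq c 0; first by left; rewrite !raddf0.
right; have e n : c%:M = (c * c)%:M :> 'M[k]_n -> c%:M = 1%:M :> 'M[k]_n.
  case: n => [|n]; first by move=> _; rewrite [LHS]thinmx0 [RHS]thinmx0.
  move/matrixP/(_ 0 0); rewrite !mxE eqxx !mulr1n => /eqP.
  rewrite -{1}[c]mulr1 (inj_eq (mulfI c0)) => /eqP <-.
  by [].
by split; apply: e.
Qed.

Lemma kindec_Qk n : kindec (Qk n).
Proof.
apply: kindec_scalar => l h; apply: kext0_scalar; first exact: kext0_Qk.
by lia.
Qed.

Lemma mx_kernel m n (f : 'M[k]_(m, n)) : exists r (g : 'M_(n, r)) q,
  [/\ f *m g = 0, q *m g = 1%:M, (r = n - \rank f)%N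
    & forall p (v : 'M_(n, p)), f *m v = 0 -> exists u, v = g *m u].
Proof.
pose K := row_base (kermx f^T).
have /row_freeP[q Kq] : row_free K by exact: row_base_free.
exists (\rank (kermx f^T)), K^T, q^T; split.
- apply: trmx_inj; rewrite trmx_mul trmxK trmx0; apply/sub_kermxP.
  by rewrite eq_row_base.
- by rewrite -trmx_mul Kq trmx1.
- by rewrite mxrank_ker mxrank_tr.
- move=> p v fv; have : (v^T <= K)%MS.
    by rewrite eq_row_base; apply/sub_kermxP; rewrite -trmx_mul fv trmx0.
  by case/submxP => u uE; exists u^T; rewrite -trmx_mul -uE trmxK.
Qed.

Definition dbl m n (h : 'M[k]_(m, n)) := block_mx h 0 0 h.

Lemma phi_dbl r t (Y : pair r t) t' (l : 'M_(t, t')) :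
  phi Y *m dbl l = row_mx (Y true *m l) (Y false *m l).
Proof. by rewrite mul_row_block !mulmx0 addr0 add0r. Qed.

Lemma dblM m n p (g : 'M[k]_(m, n)) (h : 'M_(n, p)) : dbl (g *m h) = dbl g *m dbl h.
Proof. by rewrite mulmx_block !mulmx0 !mul0mx !addr0 add0r. Qed.

Lemma khom_phi r t (Y : pair r t) r' t' (Y' : pair r' t') l h :
  khom Y Y' l h <-> phi Y' *m dbl l = h *m phi Y.
Proof.
rewrite phi_dbl mul_mx_row; split=> [H|/eq_row_mx[e1 e0] []//].
by rewrite !H.
Qed.

Section Reflection.
Variables (r t : nat) (Y : pair r t) (r' : nat).
Variables (g : 'M[k]_(t + t, r')) (q : 'M[k]_(r', t + t)) (s : 'M[k]_(t + t, r)).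
Hypotheses (Yg : phi Y *m g = 0) (qg : q *m g = 1%:M) (Ys : phi Y *m s = 1%:M).
Hypothesis g_ker : forall p (v : 'M_(t + t, p)), phi Y *m v = 0 -> exists u, v = g *m u.

(** The kernel of the structure map, as a pair again.  The exchange of the two
    components and the sign make the reflection of [Qk n.+1] equal to [Qk n]. *)
Definition reflect : pair t r' := fun b => if b then - dsubmx g else usubmx g.

Lemma reflectE : g = col_mx (reflect false) (- reflect true).
Proof. by rewrite opprK vsubmxK. Qed.

Lemma dbl_g m (h : 'M_(m, t)) : dbl h *m g = col_mx (h *m reflect false) (- (h *m reflect true)).
Proof. by rewrite reflectE mul_block_col !mul0mx addr0 add0r mulmxN. Qed.

Lemma g_mul m (l : 'M_(r', m)) : g *m l = col_mx (reflect false *m l) (- (reflect true *m l)).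
Proof. by rewrite {1}reflectE mul_col_mx mulNmx. Qed.

Lemma khom_reflectP l h : khom reflect reflect l h <-> dbl h *m g = g *m l.
Proof.
rewrite dbl_g g_mul; split=> [H|/eq_col_mx[e0 /oppr_inj e1] []//].
by rewrite !H.
Qed.

Lemma extend_reflect r1 t1 (Y1 : pair r1 t1) (h : 'M_(t1, t)) :
  phi Y1 *m (dbl h *m g) = 0 -> exists x, phi Y1 *m dbl h = x *m phi Y.
Proof.
move=> e; exists (phi Y1 *m dbl h *m s).
have [u uE] : exists u, s *m phi Y - 1%:M = g *m u.
  by apply: g_ker; rewrite mulmxBr mulmxA Ys mul1mx mulmx1 subrr.
have -> : phi Y1 *m dbl h *m s *m phi Y = phi Y1 *m dbl h *m (1%:M + g *m u).
  by rewrite -uE addrC subrK mulmxA.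
by rewrite mulmxDr mulmx1 !mulmxA -(mulmxA _ _ g) e mul0mx addr0.
Qed.

Lemma kindec_reflect : kindec Y -> kindec reflect.
Proof.
move=> Yi l h /khom_reflectP H ll hh.
have [|x xE] := @extend_reflect _ _ Y h; first by rewrite H mulmxA Yg mul0mx.
have so p (u v : 'M_(p, r)) : u *m phi Y = v *m phi Y -> u = v.
  by move=> e; rewrite -[u]mulmx1 -Ys mulmxA e -mulmxA Ys mulmx1.
have xx : x *m x = x.
  by apply: so; rewrite -mulmxA -xE mulmxA -xE -mulmxA -dblM hh.
have [|[h0 _]|[h1 _]] := Yi h x _ hh xx; first exact/khom_phi.
- left; split=> //; rewrite -[l]mul1mx -qg -mulmxA -H h0.
  by rewrite /dbl block_mx0 mul0mx mulmx0.
- right; split=> //; rewrite -[l]mul1mx -qg -mulmxA -H h1.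
  by rewrite /dbl -scalar_mx_block mul1mx qg.
Qed.

Lemma kext0_reflect : kext0 Y Y -> kext0 reflect reflect.
Proof.
move=> ext G; pose c : 'M_(t + t, r') := col_mx (G false) (- G true).
pose F := phi Y *m c *m q.
have [x [l xl]] := ext (fun b => if b then lsubmx F else rsubmx F).
have FE : F = x *m phi Y - phi Y *m dbl l.
  rewrite phi_dbl mul_mx_row opp_row_mx add_row_mx -(xl true) -(xl false).
  by rewrite hsubmxK.
have Fg : F *m g = phi Y *m c by rewrite /F -mulmxA qg mulmx1.
have [u uE] : exists u, c + dbl l *m g = g *m u.
  apply: g_ker; rewrite mulmxDr -Fg FE mulmxBl -mulmxA Yg mulmx0 sub0r mulmxA.
  by rewrite addNr.
have cE : c = dbl (- l) *m g - g *m (- u).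
  rewrite mulmxN opprK -uE [RHS]addrC.
  have -> : dbl (- l) = - dbl l by rewrite /dbl opp_block_mx !oppr0.
  by rewrite mulNmx addrK.
exists (- l), (- u) => b; move: cE.
rewrite dbl_g g_mul opp_col_mx add_col_mx => /eq_col_mx[e0 e1].
by case: b => //; apply: oppr_inj; rewrite e1 -opprD.
Qed.
End Reflection.

Lemma khom0_idem r t (Y : pair r t) (e : 'M_r) : kindec Y -> e *m phi Y = 0 -> e *m e = e ->
  e != 0 -> e = 1%:M /\ t = 0%N.
Proof.
move=> Yi eY ee e0; have [||[_ e0']|[l1 e1]] := Yi 0 e _ _ ee.
- by apply/khom_phi; rewrite eY phi_dbl !mulmx0 row_mx0.
- by rewrite mulmx0.
- by rewrite e0' eqxx in e0.
- split=> //; have := congr1 (@mxrank _ _ _) l1.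
  by rewrite mxrank0 mxrank1.
Qed.

(** Reflect until the structure map is no longer onto, which for an indecomposable
    pair happens only when the source is zero.  The dimensions strictly decrease,
    and the isomorphism found for the reflected pair extends to [Y]. *)
Lemma krigid_Qk t r (Y : pair r t) : (t < r)%N -> kext0 Y Y -> kindec Y -> kiso Y (Qk t) /\ r = t.+1.
Proof.
have [N] := ubnP t; elim: N t r Y => // N IH t r Y; rewrite ltnS => tN tr ext Yi.
pose e := 1%:M - phi Y *m pinvmx (phi Y).
have eY : e *m phi Y = 0 by rewrite mulmxBl mul1mx mulmxKpV // subrr.
have ee : e *m e = e by rewrite {2}/e mulmxBr mulmx1 mulmxA eY mul0mx subr0.
have [e0|e0] := eqVneq e 0; last first.
  have [e1 t0] := khom0_idem Yi eY ee e0; subst t.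
  pose d : 'M[k]_r := delta_mx (Ordinal tr) (Ordinal tr).
  have [|||d1 _] := @khom0_idem _ _ Y d Yi.
  - by rewrite [phi Y]thinmx0 mulmx0.
  - by rewrite mul_delta_mx.
  - by rewrite -mxrank_eq0 mxrank_delta.
  have r1 : r = 1%N by rewrite -(mxrank1 k r) -d1 mxrank_delta.
  subst r; split=> //; exists 1%:M, 1%:M, 1%:M, 1%:M.
  by split; rewrite ?mulmx1 // => b; rewrite [Y b]thinmx0 [Qk 0 b]thinmx0 mul0mx mulmx0.
have {e0 e eY ee} Ys : phi Y *m pinvmx (phi Y) = 1%:M.
  by apply/eqP; rewrite eq_sym -subr_eq0 -/e e0.
have [w [g [q [Yg qg wE g_ker]]]] := mx_kernel (phi Y).
have rk : \rank (phi Y) = r.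
  by apply/eqP/(introT row_freeP); exists (pinvmx (phi Y)).
rewrite rk in wE; have r2t := mulmx1_min Ys.
have [||||[l [h [l' [h' [H _ [ll _] [hh _]]]]]] tw] := IH w t (reflect g).
- by lia.
- by lia.
- exact: kext0_reflect qg g_ker ext.
- exact: kindec_reflect Yg qg Ys g_ker Yi.
have [|x xE] := @extend_reflect _ _ Y _ g _ Ys g_ker _ _ (Qk w.+1) h.
  rewrite dbl_g mul_row_col mulmxN -!H !mulmxA (@Qk_comm k w true false).
  by rewrite subrr.
subst t; split; last by lia.
apply: (@kiso_onto _ _ _ Y _ _ (Qk w.+1) h x); rewrite //.
- by lia.
- exact/khom_phi.
- by apply/ontoP; exists h'.
- have /ontoP[s sE] := @Qk_onto w.
  apply/ontoP; exists (phi Y *m dbl h' *m s).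
  by rewrite !mulmxA -xE -(mulmxA _ _ (dbl h')) -dblM hh /dbl -scalar_mx_block mulmx1.
Qed.

Lemma krigid_classification t r (Y : pair r t) : (0 < t)%N -> kext0 Y Y -> kindec Y ->
  (exists n, kiso Y (Qk n.+1)) \/ exists n, kiso Y (ktr (Qk n)).
Proof.
move=> t0 ext Yi; case: (ltngtP t r) => [tr|rt|e].
- left; have [Y_iso _] := krigid_Qk tr ext Yi.
  by exists t.-1; rewrite prednK.
- right; exists r; have [] := krigid_Qk rt (kext0_tr ext) (kindec_tr Yi).
  move=> /kiso_tr h _; rewrite (_ : Y = ktr (ktr Y)) //.
  by apply/funext => b; rewrite /ktr trmxK.
(* in equal dimensions the Euler form vanishes, although the identity is nonzero *)
- subst r; suff : (t * t + t * t < t * t + t * t)%N by rewrite ltnn.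
  apply: (@kext0_euler_lt _ _ _ Y _ _ Y 1%:M 1%:M ext) => [b|].
    by rewrite mulmx1 mul1mx.
  by rewrite -mxrank_eq0 mxrank1 -lt0n t0.
Qed.
End KroneckerClassification.

(** * From pairs of matrices back to modules *)

Section KroneckerBridge.
Variable k : fieldType.
Local Notation A := (rsz_alg k Q4).
Local Notation Qk := (@Qk k).
Implicit Types (M N X P : lmodule A) (i j : 'I_4) (r t : nat).
Local Notation pair r t := (bool -> 'M[k]_(r, t)).

Lemma kron_iso i r t (Y : pair r t) r' t' (Y' : pair r' t') : kiso Y Y' -> iso (kron i Y) (kron i Y').
Proof.
by move=> [l [h [l' [h' [H H' [ll l'l] [hh h'h]]]]]]; exact: kron_retract_iso H H' ll l'l hh h'h.
Qed.

Lemma block_diag_mul m n p m' n' p' (a : 'M[k]_(m, n)) (b : 'M_(m', n')) (c : 'M_(n, p)) (d : 'M_(n', p')) :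
  block_mx a 0 0 b *m block_mx c 0 0 d = block_mx (a *m c) 0 0 (b *m d).
Proof. by rewrite mulmx_block !mulmx0 !mul0mx !addr0 add0r. Qed.

Lemma kron_iso_dim i r t (Y : pair r t) r' t' (Y' : pair r' t') :
  iso (kron i Y) (kron i Y') -> r = r' /\ t = t'.
Proof.
move=> [_ [_ [/hom_kron_kron[l [h [-> _]]] /hom_kron_kron[l' [h' [-> _]]] fg gf]]].
move: fg gf; rewrite [LHS]block_diag_mul [RHS]scalar_mx_block => /eq_block_mx[ll _ _ hh].
rewrite [LHS]block_diag_mul [RHS]scalar_mx_block => /eq_block_mx[l'l _ _ h'h].
by split; apply/eqP; rewrite eqn_leq ?(mulmx1_min hh) ?(mulmx1_min h'h) ?(mulmx1_min ll) ?(mulmx1_min l'l).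
Qed.

Lemma kron_indecomposable i r t (Y : pair r t) : (0 < t)%N -> kindec Y -> indecomposable (kron i Y).
Proof.
move=> t0 Yi; apply: idem_indec => [|e]; first by rewrite /= ltn_addr.
move=> /hom_kron_kron[l [h [-> H]]]; rewrite [LHS]block_diag_mul => /eq_block_mx[ll _ _ hh].
have [[-> ->]|[-> ->]] := Yi _ _ H ll hh; first by left; rewrite block_mx0.
by right; rewrite -scalar_mx_block.
Qed.

Lemma indecomposable_kindec i r t (Y : pair r t) : indecomposable (kron i Y) -> kindec Y.
Proof.
move=> Xi l h H ll hh; pose e : 'M[k]_(mdim (kron i Y)) := block_mx l 0 0 h.
have [||e0|e1] := @indec_idem _ _ _ e Xi.
- by apply/hom_kron_kron; exists l, h.
- by rewrite [LHS]block_diag_mul ll hh.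
- by left; move/eqP: e0; rewrite block_mx_eq0 => /and4P[/eqP -> _ _ /eqP ->].
- by right; move: e1; rewrite [RHS]scalar_mx_block => /eq_block_mx[-> _ _ ->].
Qed.

(** A cocycle [G] is the corner of a block triangular pair; a splitting of the
    corresponding extension of modules, read off in blocks, writes it as a
    coboundary. *)
Lemma kext0_of_splits i r t (Y : pair r t) r' t' (Y' : pair r' t') :
  (forall E u e, @extension _ _ (kron i Y') E (kron i Y) u e -> splits e) -> kext0 Y Y'.
Proof.
move=> sp G; pose Z b : 'M[k]_(r' + r, t' + t) := block_mx (Y' b) (G b) 0 (Y b).
pose u : 'M[k]_(mdim (kron i Z), mdim (kron i Y')) := block_mx (col_mx 1%:M 0) 0 0 (col_mx 1%:M 0).
pose e : 'M[k]_(mdim (kron i Y), mdim (kron i Z)) := block_mx (row_mx 0 1%:M) 0 0 (row_mx 0 1%:M).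
have [|s] := sp (kron i Z) u e.
  split.
  - split; apply/hom_kron_kron; eexists; eexists; split; try reflexivity.
      by move=> b; rewrite [LHS]mul_block_col mul_col_mx !mulmx1 !mulmx0 !addr0 mul1mx mul0mx.
    by move=> b; rewrite mul_mx_row [RHS]mul_row_block !mulmx0 !mul0mx mulmx1 mul1mx !add0r.
  - exists (block_mx (row_mx 1%:M 0) 0 0 (row_mx 1%:M 0)).
    by rewrite [LHS]block_diag_mul !mul_row_col !mulmx1 !mulmx0 !addr0 -scalar_mx_block.
  - apply/ontoP; exists (block_mx (col_mx 0 1%:M) 0 0 (col_mx 0 1%:M)).
    by rewrite [LHS]block_diag_mul !mul_row_col !mulmx1 !mulmx0 !add0r -scalar_mx_block.
  - rewrite [LHS]block_diag_mul !mul_row_col !mulmx1 !mulmx0 !addr0.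
    by rewrite block_mx0.
  - rewrite /= => v; rewrite -[v]vsubmxK -[usubmx v]vsubmxK -[dsubmx v]vsubmxK.
    rewrite mul_block_col !mul_row_col !mul0mx !mul1mx !add0r !addr0.
    move=> /eqP; rewrite col_mx_eq0 => /andP[/eqP -> /eqP ->].
    exists (col_mx (usubmx (usubmx v)) (usubmx (dsubmx v))).
    by rewrite mul_block_col !mul_col_mx !mul1mx !mul0mx !addr0 add0r.
move=> /hom_kron_kron[l [h [-> H]]]; rewrite [LHS]block_diag_mul [RHS]scalar_mx_block.
move=> /eq_block_mx[l2 _ _ h2].
rewrite -[l]vsubmxK mul_row_col mul0mx add0r mul1mx in l2.
rewrite -[h]vsubmxK mul_row_col mul0mx add0r mul1mx in h2.
exists (usubmx h), (usubmx l) => b; have := H b.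
rewrite -{1}[l]vsubmxK -{1}[h]vsubmxK l2 h2 mul_block_col mul_col_mx mulmx1.
by move=> /eq_col_mx[<- _]; rewrite addrC addKr.
Qed.

Lemma projective_splits P Y E u e : projective P -> @extension _ _ Y E P u e -> splits e.
Proof.
by move=> PP [[_ He] _ eo _ _]; have [s Hs] := PP _ _ _ _ He (@hom1 _ _ P) eo; exists s.
Qed.

Lemma tau_rigid_kext0 M i r t (Y : pair r t) r' t' (Y' : pair r' t') : tau_rigid M ->
  retract (kron i Y) M -> retract (kron i Y') M -> kext0 Y Y'.
Proof.
move=> Mt YM [j [p [_ Hp pj]]]; apply: (@kext0_of_splits i) => E u e ext.
by apply: (tau_rigid_retract_splits Mt YM ext Hp); apply/ontoP; exists j.
Qed.

(** The simple module at [swap i] is a quotient of every module with top at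
    [swap i], and is [kron i (Qk 0)]. *)
Lemma tau_rigid_swap M i r t (Y : pair r t) r' t' (Y' : pair r' t') : tau_rigid M ->
  (0 < t')%N -> retract (kron i Y) M -> retract (kron (swap i) Y') M -> (t + t <= r)%N.
Proof.
case: t' Y' => // t' Y' Mt _ YM [j [p [_ Hp pj]]]; apply: kext0_Qk0.
apply: (@kext0_of_splits i) => E u e ext.
pose g : 'M[k]_(1, t'.+1 + r') := row_mx (delta_mx 0 0) 0.
have Hf : mhom (kron (swap i) Y') (kron i (Qk 0)) (col_mx (0 : 'M_(0, _)) g).
  apply: hom_kron_to => x; first by rewrite mul0mx scaler0.
  rewrite big1 => [|b _]; last by rewrite mulmx0 scaler0.
  by rewrite addr0 [LHS]mul_row_block !mul0mx mulmx0 addr0 mul_mx_scalar scale_row_mx scaler0 addr0.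
apply: (tau_rigid_retract_splits Mt YM ext (homM Hp Hf)); apply/ontoP.
exists (j *m col_mx (delta_mx 0 0) 0); rewrite -mulmxA (mulmxA p) pj mul1mx mul_col_mx mul_row_col.
rewrite mul_delta_mx mulmx0 addr0 mul0mx.
apply/matrixP => x y; case: (splitP x) => [[]//|z xz]; case: (splitP y) => [[]//|z' yz].
have -> : x = rshift 0 z by apply: val_inj.
have -> : y = rshift 0 z' by apply: val_inj.
by rewrite col_mxEd !ord1 !mxE !eqxx.
Qed.

Lemma kron_in_rad i r t (Y : pair r t) : onto_mx (phi Y) -> forall y : 'cV_r,
  in_rad (@rsz_rad k Q4) (P := kron i Y) (col_mx 0 y).
Proof.
move=> /ontoP[s sE] y; pose z b := (if b then usubmx else dsubmx) (s *m y).
exists bool, (fun b => ar k i b), (fun b => col_mx (z b) 0); split=> [b v|].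
  by rewrite /ar cf_arr.
rewrite -[y in LHS]mul1mx -sE -mulmxA -[s *m y]vsubmxK mul_row_col.
rewrite big_bool !kron_ar eqxx ![in RHS]mul_block_col.
by rewrite !mul0mx !addr0 [RHS](@add_col_mx _ t r 1) addr0.
Qed.

(** A map out of [kron i Y] is determined by the images of the top; when the
    structure map is bijective these can be chosen freely, so [kron i Y] is
    projective. *)
Lemma kron_extend i r t (Y : pair r t) s N f : s *m phi Y = 1%:M ->
  mact N (ev k i) *m f = f -> exists f', mhom (kron i Y) N (row_mx f f').
Proof.
move=> sY Ef.
exists (row_mx (mact N (ar k i true) *m f) (mact N (ar k i false) *m f) *m s).
set f' := _ *m s; apply/hom_kron_from; split=> // [|b|b].
- by rewrite /f' mulmxA mul_mx_row !mulmxA -!mactM !vert_arr /= !eqxx.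
- have : f' *m phi Y = row_mx (mact N (ar k i true) *m f) (mact N (ar k i false) *m f).
    by rewrite -mulmxA sY mulmx1.
  by rewrite mul_mx_row => /eq_row_mx[e1 e0]; case: b.
- by rewrite /f' mulmxA mul_mx_row !mulmxA -!mactM !arr_arr raddf0 !mul0mx row_mx0 mul0mx.
Qed.

Lemma kron_hom_eq i r t (Y : pair r t) N (f g : 'M_(mdim N, mdim (kron i Y))) :
  onto_mx (phi Y) -> mhom (kron i Y) N f -> mhom (kron i Y) N g ->
  @lsubmx _ _ t r f = @lsubmx _ _ t r g -> f = g.
Proof.
move=> /ontoP[s Ys]; rewrite -[f](@hsubmxK _ _ t r) -[g](@hsubmxK _ _ t r).
move=> /hom_kron_from[_ _ fY _] /hom_kron_from[_ _ gY _]; rewrite !row_mxKl => fg.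
rewrite fg; congr row_mx; rewrite -[LHS]mulmx1 -[RHS]mulmx1 -Ys !mulmxA !mul_mx_row.
by rewrite -!fY -!gY fg.
Qed.

Lemma projective_kron i r t (Y : pair r t) s : phi Y *m s = 1%:M -> s *m phi Y = 1%:M ->
  projective (kron i Y).
Proof.
move=> Ys sY M N g h Hg Hh go; have /ontoP[g' gg'] := go.
have fi : mact N (ev k i) *m lsubmx h = lsubmx h.
  have := Hh; rewrite -[h in mhom _ _ h](@hsubmxK _ _ t r).
  by case/hom_kron_from.
pose f := mact M (ev k i) *m (g' *m lsubmx h).
have Ef : mact M (ev k i) *m f = f by rewrite mulmxA -mactM vert_vert eqxx.
have gf : g *m f = lsubmx h by rewrite mulmxA Hg -mulmxA (mulmxA g) gg' mul1mx.
have [f' Hf] := kron_extend sY Ef.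
exists (row_mx f f') => //; apply: (kron_hom_eq _ Hh (homM Hf Hg)).
  by apply/ontoP; exists s.
by rewrite mul_mx_row row_mxKl gf.
Qed.

Definition Pk i := kron i (Qk 1).

Lemma Pk_bij : exists s, phi (Qk 1) *m s = 1%:M /\ s *m phi (Qk 1) = 1%:M.
Proof. by have /ontoP[s sE] := @Qk_onto k 0; exists s; split; rewrite ?(mulmx1C sE). Qed.

Lemma projective_Pk i : projective (Pk i).
Proof. by have [s [Ys sY]] := Pk_bij; exact: projective_kron Ys sY. Qed.

Lemma Pk_indec i : indecomposable (Pk i).
Proof. by apply: kron_indecomposable => //; exact: kindec_Qk. Qed.

(** No extensions by the simple at [swap i] forces [t + t <= r], which leaves only
    [Qk 1] in the classification. *)
Lemma projective_indec X : projective X -> indecomposable X -> exists i, iso X (Pk i).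
Proof.
move=> PX Xi; have [i [t [r [Y [t0 Yo XY]]]]] := indecomposable_kron Xi.
have PY : projective (kron i Y) by apply: projective_retract PX; exact/iso_retract/iso_sym.
have Yi := indecomposable_kindec (indec_iso XY Xi).
have ext r' t' (Y' : pair r' t') : kext0 Y Y'.
  by apply: (@kext0_of_splits i) => E u e; exact: projective_splits.
have rt := kext0_Qk0 (ext _ _ (Qk 0)).
have [[n Yn]|[n Yn]] := krigid_classification t0 (ext _ _ Y) Yi; have [er et] := kiso_dim Yn.
  have n0 : n = 0%N by lia.
  by exists i; apply: iso_trans XY _; move: Yn; rewrite n0; exact: kron_iso.
by lia.
Qed.

(** [Pk i] is generated by one element, so the regular module maps onto it. *)
Lemma Pk_regular i : retract (Pk i) (regular_module A).
Proof.
have [g Hg gE] := @regular_map _ _ (Pk i) (col_mx 1%:M 0).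
have go : onto_mx g.
  have act a : exists u, mact (Pk i) a *m (col_mx 1%:M 0 : 'cV_(1 + 2)) = g *m u.
    by exists (mact (regular_module A) a *m reg_coord 1); rewrite mulmxA Hg -mulmxA gE.
  have /ontoP[s sE] := @Qk_onto k 0.
  move=> v; pose z := s *m dsubmx (v : 'cV_(1 + 2)).
  have [u uE] := act 1; have [u1 u1E] := act (ar k i true); have [u0 u0E] := act (ar k i false).
  exists (usubmx (v : 'cV_(1 + 2)) 0 0 *: u + usubmx z 0 0 *: u1 + dsubmx z 0 0 *: u0).
  rewrite !mulmxDr -!scalemxAr -uE -u1E -u0E mact1 mul1mx !kron_ar !mul_block_col eqxx.
  rewrite !mul0mx !mulmx1 !addr0 !scale_col_mx !scaler0 !add_col_mx !addr0 add0r.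
  rewrite -[LHS](@vsubmxK _ 1 2); congr col_mx.
    by apply/matrixP => a b; rewrite !ord1 !mxE eqxx mulr1.
  rewrite -[LHS]mul1mx -sE -mulmxA -/z -[z in LHS]vsubmxK mul_row_col.
  by congr (_ + _); rewrite {1}[X in _ *m X]mx11_scalar mul_mx_scalar.
have [s Hs gs] := projective_Pk Hg (@hom1 _ _ (Pk i)) go.
by exists s, g.
Qed.

Lemma Pk_inj i j : iso (Pk i) (Pk j) -> i = j.
Proof.
move=> [f [g [Hf _ fg _]]]; apply/eqP; apply: contraT => ij.
have := hom_kron_no_top ij (@Qk_onto k 0) Hf.
have := congr1 (@usubmx _ 1 2 _) fg; rewrite -mul_usub_mx => + f0; rewrite f0 mul0mx.
rewrite [X in usubmx X](@scalar_mx_block _ 1 2) block_mxEv col_mxKu.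
by move=> /matrixP/(_ 0 0)/eqP; rewrite !mxE; case: splitP => // z _; rewrite !ord1 mxE eqxx eq_sym oner_eq0.
Qed.

Lemma num_summands_regular : num_summands (regular_module A) 4.
Proof.
have := num_summands_fsum Pk_indec Pk_inj (enum_uniq 'I_4).
rewrite size_enum_ord /num_summands; congr (_ @` _ #= _).
apply/seteqP; split=> X [Xi].
  move=> /(summand_fsum Pk_indec)[//|i _ /iso_sym Xi'].
  by split=> //; apply/summandP; apply: retract_iso_l Xi' (Pk_regular i).
move=> /summandP XA; split=> //.
have [i XP] := projective_indec (projective_retract XA (@projective_regular _ A)) Xi.
apply/summandP; apply: retract_iso_l (iso_sym XP) _; apply/summandP.
by apply/(mem_summand_fsum Pk_indec Pk_inj); rewrite mem_enum.
Qed.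
End KroneckerBridge.

(** * Projective presentations *)

Section KroneckerPresentation.
Variable k : fieldType.
Local Notation A := (rsz_alg k Q4).
Local Notation Qk := (@Qk k).
Implicit Types (M N X P : lmodule A) (i j : 'I_4) (r t : nat).
Local Notation pair r t := (bool -> 'M[k]_(r, t)).

(** The sum of [t] copies of [Pk i], with a structure map equal to the identity. *)
Definition PPk t : pair (t + t) t := fun b => if b then col_mx 1%:M 0 else col_mx 0 1%:M.

Lemma phi_PPk t : phi (PPk t) = 1%:M.
Proof. by rewrite /phi -block_mxEh -scalar_mx_block. Qed.

Lemma mul_PPk m t (f : 'M[k]_(m, t + t)) b :
  f *m PPk t b = if b then lsubmx f else rsubmx f.
Proof.
rewrite -{1}[f]hsubmxK; case: b; rewrite mul_row_col mulmx1 mulmx0 ?addr0 //.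
by rewrite add0r.
Qed.

Lemma projective_PPk i t : projective (kron i (PPk t)).
Proof. by apply: (@projective_kron _ _ _ _ _ 1%:M); rewrite phi_PPk mulmx1. Qed.

(** The kernel of the cover of [kron i Y] by [kron i (PPk t)] is the kernel of
    [phi Y], a sum of copies of the simple at [swap i]; hence the first term.  A map
    from the first term to [kron i Y'] is a cocycle read through [q], and factors
    when it is a coboundary. *)
Lemma kron_presentation i r t (Y : pair r t) : onto_mx (phi Y) ->
  exists P1 P0 f p, @nice_presentation _ _ (@rsz_rad k Q4) (kron i Y) P1 P0 f p /\
  forall j r' t' (Y' : pair r' t'), (j = i -> kext0 Y Y') -> (j = swap i -> r = (t + t)%N) ->
    factors f (kron j Y').
Proof.
move=> Yo; have /ontoP[s Ys] := Yo.
have [w [g [q [Yg qg wE g_ker]]]] := mx_kernel (phi Y).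
have wr : w = (t + t - r)%N.
  by rewrite wE; congr (_ - _)%N; apply/eqP/(introT row_freeP); exists s.
have PPo m : onto_mx (phi (PPk m)) by apply/ontoP; exists 1%:M; rewrite phi_PPk mulmx1.
pose P1 := kron (swap i) (PPk w); pose P0 := kron i (PPk t).
pose f : 'M[k]_(mdim P0, mdim P1) := block_mx 0 0 g 0.
pose p : 'M[k]_(mdim (kron i Y), mdim P0) := block_mx 1%:M 0 0 (phi Y).
have si := negbTE (swap_neq i); have si' : (i == swap i) = false by rewrite eq_sym.
have p_ker (v : 'cV_(t + (t + t))) : p *m v = 0 -> usubmx v = 0 /\ phi Y *m dsubmx v = 0.
  rewrite -{1}[v]vsubmxK [p *m _]mul_block_col !mul0mx mul1mx addr0 add0r.
  by move=> /eqP; rewrite col_mx_eq0 => /andP[/eqP -> /eqP ->].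
exists P1, P0, f, p; split.
  split; try exact: projective_PPk.
  - rewrite /f block_mxEh; apply/hom_kron_from; rewrite swapK kron_ev si' eqxx.
    split=> [||b|b]; rewrite ?col_mx0 ?mulmx0 ?mul0mx //.
      by rewrite mul_block_col !mul0mx mul1mx addr0 add0r.
    by rewrite kron_ar si' mul_block_col !mul0mx !addr0 col_mx0.
  - apply/hom_kron_kron; exists 1%:M, (phi Y); split=> // b.
    by rewrite mulmx1 mul_PPk; case: b; rewrite ?row_mxKl ?row_mxKr.
  - apply/ontoP; exists (block_mx 1%:M 0 0 s).
    by rewrite [LHS]block_diag_mul mulmx1 Ys -scalar_mx_block.
  - rewrite [LHS]mulmx_block !mulmx0 !mul0mx !addr0 add0r Yg.
    by rewrite block_mx0.
  - move=> v /p_ker[v0 /g_ker[u uE]]; exists (col_mx u 0).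
    by rewrite [RHS]mul_block_col !mul0mx !addr0 -uE -v0 vsubmxK.
  - rewrite /= => v; rewrite -[v]vsubmxK [f *m _]mul_block_col !mul0mx !addr0.
    move=> /eqP; rewrite col_mx_eq0 => /andP[_ /eqP gv].
    have -> : usubmx v = 0 by rewrite -[LHS]mul1mx -qg -mulmxA gv mulmx0.
    exact: kron_in_rad.
  - by move=> v /p_ker[v0 _]; rewrite -[v]vsubmxK v0; exact: kron_in_rad.
move=> j r' t' Y' ext proj u; rewrite -[u in mhom _ _ u](@hsubmxK _ (t' + r') w (w + w)) => Hu.
have [Eu _ uY0 _] := (hom_kron_from _ _ _ _).1 Hu.
have zero : lsubmx u = 0 -> u = 0.
  move=> u0; rewrite -[u](@hsubmxK _ (t' + r') w (w + w)) u0.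
  suff -> : rsubmx u = 0 by rewrite row_mx0.
  rewrite -[LHS]mulmx1 -(phi_PPk w) mul_mx_row -!uY0 u0 !mulmx0 row_mx0 //.
have trivial : u = 0 -> exists2 v, mhom P0 (kron j Y') v & u = v *m f.
  by move=> u0; exists 0; [exact: hom0 | rewrite mul0mx].
have [ji|ji] := eqVneq j i; last first.
  apply/trivial/zero; have [jsi|jsi] := eqVneq j (swap i); last first.
    rewrite -Eu kron_ev (negbTE jsi) (inj_eq (inv_inj swapK)) (negbTE ji).
    by rewrite block_mx0 mul0mx.
  by apply/matrixP => a b; have := ltn_ord b; rewrite {2}wr proj // subnn.
subst j; move: Eu; rewrite kron_ev si' eqxx -[lsubmx u](@vsubmxK _ t' r').
rewrite mul_block_col !mul0mx !addr0 mul1mx add0r => /eq_col_mx[u0 _].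
set a := dsubmx (lsubmx u) in u0 *.
have [h [l hl]] := ext erefl (fun b => if b then lsubmx (a *m q) else rsubmx (a *m q)).
have aqE : a *m q = h *m phi Y - phi Y' *m dbl l.
  by rewrite phi_dbl mul_mx_row opp_row_mx add_row_mx -(hl true) -(hl false) hsubmxK.
have aE : a = - (phi Y' *m dbl l *m g).
  have := congr1 (fun x => x *m g) aqE; rewrite -mulmxA qg mulmx1 => ->.
  by rewrite [LHS]mulmxBl -[h *m _ *m g]mulmxA Yg mulmx0 sub0r.
exists (block_mx (- l) 0 0 (- (phi Y' *m dbl l))).
  apply/hom_kron_kron; exists (- l), (- (phi Y' *m dbl l)); split=> // b.
  rewrite mulmxN mulNmx phi_dbl mul_PPk; congr (- _).
  by case: b; rewrite ?row_mxKl ?row_mxKr.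
rewrite [RHS]mulmx_block !mulmx0 !mul0mx !addr0 add0r mulNmx -aE u0.
rewrite -[LHS](@hsubmxK _ (t' + r') w (w + w)) -[lsubmx u in LHS](@vsubmxK _ t' r') -/a -u0.
rewrite block_mxEh; congr row_mx.
rewrite -[LHS]mulmx1 -(phi_PPk w) mul_mx_row -!uY0 !kron_ar si'.
by rewrite !block_mx0 !mul0mx row_mx0 col_mx0.
Qed.
End KroneckerPresentation.

(** * Modules generated by a module *)

Section Fac.
Variables (k : fieldType) (A : falgType k).
Implicit Types (M N X Y : lmodule A) (s t : seq (lmodule A)).

Lemma hom_dsums_zero s t :
  (forall X Y, X \in s -> Y \in t -> forall f, mhom X Y f -> f = 0) ->
  forall f, mhom (dsums s) (dsums t) f -> f = 0.
Proof.
move=> st; have to X : X \in s -> forall f, mhom X (dsums t) f -> f = 0.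
  move=> sX; have {}st Y f := st X Y sX ^~ f.
  elim: t st => [|Y t IH] st f Hf; first by rewrite [f]flatmx0 [RHS]flatmx0.
  rewrite -[f](@vsubmxK _ (mdim Y) (mdim (dsums t))).
  have -> : usubmx f = 0.
    apply: (st Y); first by rewrite inE eqxx.
    have := homM Hf (@prl_hom _ _ Y (dsums t)).
    by rewrite -{1}[f](@vsubmxK _ (mdim Y)) mul_row_col mul1mx mul0mx addr0.
  have -> : dsubmx f = 0.
    apply: IH => [Z g tZ|]; first by apply: st; rewrite inE tZ orbT.
    have := homM Hf (@prr_hom _ _ Y (dsums t)).
    by rewrite -{1}[f](@vsubmxK _ (mdim Y)) mul_row_col mul1mx mul0mx add0r.
  by rewrite col_mx0.
elim: s to {st} => [|X s IH] to f Hf; first by rewrite [f]thinmx0 [RHS]thinmx0.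
rewrite -[f](@hsubmxK _ _ (mdim X) (mdim (dsums s))).
have -> : lsubmx f = 0.
  apply: (to X); first by rewrite inE eqxx.
  have := homM (@inl_hom _ _ X (dsums s)) Hf.
  by rewrite -{1}[f](@hsubmxK _ _ (mdim X)) mul_row_col mulmx1 mulmx0 addr0.
have -> : rsubmx f = 0.
  apply: IH => [Z sZ g|]; first by apply: to; rewrite inE sZ orbT.
  have := homM (@inr_hom _ _ X (dsums s)) Hf.
  by rewrite -{1}[f](@hsubmxK _ _ (mdim X)) mul_row_col mulmx1 mulmx0 add0r.
by rewrite row_mx0.
Qed.

Lemma Fac_quotient M X Y g : Fac M X -> mhom X Y g -> onto_mx g -> Fac M Y.
Proof.
move=> [N NM [f Hf fo]] Hg go; exists N => //; exists (g *m f); first exact: homM.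
move: fo go => /ontoP[f' ff'] /ontoP[g' gg']; apply/ontoP; exists (f' *m g').
by rewrite mulmxA -(mulmxA g) ff' mulmx1.
Qed.

Lemma Fac_summand M X : indecomposable X -> summand X M -> Fac M X.
Proof.
move=> Xi XM; exists X => [Y Yi /summandP YX|].
  by apply/summandP/(retract_trans YX)/summandP.
exists 1%:M; first exact: hom1.
by apply/ontoP; exists 1%:M; rewrite mulmx1.
Qed.

Lemma Fac_dsum M X Y : Fac M X -> Fac M Y -> Fac M (dsum X Y).
Proof.
move=> [N NM [f Hf /ontoP[f' ff']]] [N' NM' [g Hg /ontoP[g' gg']]].
exists (dsum N N') => [Z Zi /summandP/(retract_dsum Zi)[]/summandP|].
- exact: NM.
- exact: NM'.
exists (block_mx f 0 0 g).
  by apply: hom_col; apply: hom_row => //; exact: hom0.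
apply/ontoP; exists (block_mx f' 0 0 g').
by rewrite mulmx_block !mulmx0 !mul0mx !addr0 !add0r ff' gg' -scalar_mx_block.
Qed.

Lemma Fac_dsums M s : (forall X, X \in s -> Fac M X) -> Fac M (dsums s).
Proof.
elim: s => [|X s IH] sM /=.
  exists (zero_module A) => [Y [Y0 _] /summandP/(retract0 Y0) //|].
  exists 1%:M; first exact: hom1.
  by apply/ontoP; exists 1%:M; rewrite mulmx1.
apply: Fac_dsum; first by apply: sM; rewrite inE eqxx.
by apply: IH => Y sY; apply: sM; rewrite inE sY orbT.
Qed.

(** A module in [Fac M'] is a quotient of a sum of indecomposable summands of [M'],
    by the decomposition theorem. *)
Lemma Fac_sub M M' : (forall X, indecomposable X -> summand X M' -> Fac M X) ->
  Fac M' `<=` Fac M.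
Proof.
move=> sub Y [N NM [g Hg go]].
have [s si Ns] := decomposition N.
have FN : Fac M (dsums s).
  apply: Fac_dsums => X sX; apply: sub; first exact: si.
  apply: NM; first exact: si.
  by apply/summandP/(retract_iso_r (iso_sym Ns))/retract_dsums.
have [f [f' [Hf Hf' ff' f'f]]] := Ns.
apply: Fac_quotient FN (homM Hf' Hg) _.
have /ontoP[g' gg'] := go; apply/ontoP; exists (f *m g').
by rewrite mulmxA -(mulmxA g) f'f mulmx1.
Qed.

(** Shows that [Fac] strictly decreases: [Y] is the module that is removed, and
    [c] the projection onto its top. *)
Lemma not_Fac M Y n (c : 'M[k]_(n, mdim Y)) : c != 0 ->
  (forall X, indecomposable X -> summand X M -> forall f, mhom X Y f -> c *m f = 0) ->
  ~ Fac M Y.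
Proof.
move=> c0 kill [N NM [g Hg go]].
have [s si Ns] := decomposition N.
have [f [f' [Hf Hf' ff' f'f]]] := Ns.
have {}NM X : X \in s -> summand X M.
  move=> sX; apply: NM; first exact: si.
  by apply/summandP/(retract_iso_r (iso_sym Ns))/retract_dsums.
have zero : c *m (g *m f') = 0.
  have := homM Hf' Hg; move: (g *m f') => {f f' Hf Hf' ff' f'f Ns g Hg go} h.
  elim: s si NM h => [|X s IH] si NM h Hh; first by rewrite [h]thinmx0 mulmx0.
  rewrite -[h](@hsubmxK _ _ (mdim X) (mdim (dsums s))) mul_mx_row.
  have -> : c *m lsubmx h = 0.
    apply: (kill X); [by apply: si; rewrite inE eqxx | by apply: NM; rewrite inE eqxx |].
    have := homM (@inl_hom _ _ X (dsums s)) Hh.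
    by rewrite -{1}[h](@hsubmxK _ _ (mdim X)) mul_row_col mulmx1 mulmx0 addr0.
  have -> : c *m rsubmx h = 0.
    apply: IH => [Z sZ|Z sZ|]; [by apply: si; rewrite inE sZ orbT | by apply: NM; rewrite inE sZ orbT |].
    have := homM (@inr_hom _ _ X (dsums s)) Hh.
    by rewrite -{1}[h](@hsubmxK _ _ (mdim X)) mul_row_col mulmx1 mulmx0 add0r.
  by rewrite row_mx0.
have /ontoP[g' gg'] := go; case/eqP: c0.
rewrite -[c]mulmx1 -gg' !mulmxA; have -> : c *m g = c *m (g *m f') *m f.
  by rewrite !mulmxA -(mulmxA _ f') f'f mulmx1.
by rewrite zero !mul0mx.
Qed.
End Fac.

(** * The indecomposable tau-rigid modules *)
Section RigidModules.
Variable k : fieldType.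
Local Notation A := (rsz_alg k Q4).
Local Notation Qk := (@Qk k).
Implicit Types (M N X P : lmodule A) (i j : 'I_4) (n : nat) (s : bool).
Local Notation pair r t := (bool -> 'M[k]_(r, t)).

Lemma ktrK r t (Y : pair r t) : ktr (ktr Y) = Y.
Proof. by apply/funext => b; rewrite /ktr trmxK. Qed.

(** The structure maps of the indecomposable tau-rigid modules: preprojective
    for [s = true], preinjective for [s = false]. *)
Definition mY s n : pair (if s then n.+2 else n) n.+1 :=
  if s return pair (if s then n.+2 else n) n.+1 then Qk n.+1 else ktr (Qk n).

Lemma mY_onto s n : onto_mx (phi (mY s n)).
Proof.
case: s; first exact: Qk_onto.
apply/ontoP; exists (col_mx (Qk n true) 0); rewrite mul_row_col mulmx0 addr0.
apply: mget_inj => a j an jn; rewrite mget_Qk_mulr // (mget_mx _ an (ltnW jn : j < n.+1)%N) (mget_mx _ an jn).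
by rewrite !mxE eq_sym -val_eqE.
Qed.

Lemma mY_kindec s n : kindec (mY s n).
Proof. by case: s; [exact: kindec_Qk | exact/kindec_tr/kindec_Qk]. Qed.

Lemma mY_kext0 s n m : ((if s then n else m) <= (if s then m else n).+1)%N ->
  kext0 (mY s n) (mY s m).
Proof. by case: s => h; [apply: kext0_Qk | apply/kext0_tr/kext0_Qk]. Qed.

Lemma mY_kext0P s n m : kext0 (mY s n) (mY s m) ->
  ((if s then n else m) <= (if s then m else n).+1)%N.
Proof.
case: s => /= h; rewrite leqNgt; apply/negP => lt.
  by apply: kext0_QkF h.
by have := kext0_tr h; rewrite !ktrK; exact: kext0_QkF.
Qed.

Lemma mY_cross n m : ~ kext0 (mY false n) (mY true m).
Proof. exact: kext0_cross. Qed.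

Definition mmod (m : 'I_4 * bool * nat) : lmodule A := kron m.1.1 (mY m.1.2 m.2).

Lemma mmod_indec m : indecomposable (mmod m).
Proof. by apply: kron_indecomposable => //; exact: mY_kindec. Qed.

Lemma mmod_no_top m m' f : m.1.1 != m'.1.1 -> mhom (mmod m) (mmod m') f ->
  @usubmx _ m'.2.+1 _ _ f = 0.
Proof.
case: m m' f => [[i s] n] [[j s'] n'] f /= ij Hf.
exact (hom_kron_no_top ij (@mY_onto _ _) Hf).
Qed.

Lemma mmod_no_top_degree i s n n' f : (if s then n' < n else n < n')%N ->
  mhom (mmod (i, s, n)) (mmod (i, s, n')) f -> @usubmx _ n'.+1 _ _ f = 0.
Proof.
case: s f => f /= lt /hom_kron_kron[l [h [-> H]]]; rewrite block_mxEv col_mxKu.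
  by have [-> _] := @khom_Qk_down _ n.+1 n'.+1 _ _ lt H; rewrite row_mx0.
have := khom_tr H; rewrite !ktrK => H'; have [_ /(congr1 trmx)] := khom_Qk_down lt H'.
by rewrite trmxK trmx0 => ->; rewrite row_mx0.
Qed.

(** The multiplications by the two variables together map two copies of one
    module onto the next. *)
Lemma mmod_gen_true M i n : Fac M (mmod (i, true, n)) -> Fac M (mmod (i, true, n.+1)).
Proof.
move=> Fn; have F2 : Fac M (dsum (mmod (i, true, n)) (mmod (i, true, n))) by exact: Fac_dsum.
pose q b : 'M[k]_(mdim (mmod (i, true, n.+1)), mdim (mmod (i, true, n))) :=
  block_mx (Qk n.+1 b) 0 0 (Qk n.+2 b).
have Hq b : mhom (mmod (i, true, n)) (mmod (i, true, n.+1)) (q b).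
  by apply/hom_kron_kron; exists (Qk n.+1 b), (Qk n.+2 b); split=> // c; rewrite /= Qk_comm.
apply: (Fac_quotient F2 (hom_row (Hq true) (Hq false))).
have /ontoP[u uE] := @Qk_onto k n; have /ontoP[v vE] := @Qk_onto k n.+1.
apply/ontoP; exists (col_mx (block_mx (usubmx u) 0 0 (usubmx v)) (block_mx (dsubmx u) 0 0 (dsubmx v))).
rewrite mul_row_col ![block_mx _ _ _ _ *m _]block_diag_mul add_block_mx !addr0 -!mul_row_col !vsubmxK.
by rewrite [phi _ *m _]uE [phi _ *m _]vE -scalar_mx_block.
Qed.

(** The transpose of the multiplication by a variable is onto. *)
Lemma mmod_gen_false M i n : Fac M (mmod (i, false, n.+1)) -> Fac M (mmod (i, false, n)).
Proof.
move=> Fn.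
pose q : 'M[k]_(mdim (mmod (i, false, n)), mdim (mmod (i, false, n.+1))) :=
  block_mx (Qk n.+1 true)^T 0 0 (Qk n true)^T.
have Hq : mhom (mmod (i, false, n.+1)) (mmod (i, false, n)) q.
  apply/hom_kron_kron; exists (Qk n.+1 true)^T, (Qk n true)^T; split=> // b.
  by rewrite /= /ktr -!trmx_mul Qk_comm.
apply: (Fac_quotient Fn Hq).
have Q1 p : (Qk p true)^T *m Qk p true = 1%:M.
  apply: mget_inj => a j ap jp; rewrite mget_Qk_mulr // (mget_mx _ ap (ltnW jp : j < p.+1)%N) (mget_mx _ ap jp).
  by rewrite !mxE eq_sym -val_eqE.
apply/ontoP; exists (block_mx (Qk n.+1 true) 0 0 (Qk n true)).
by rewrite [LHS]block_diag_mul !Q1 -scalar_mx_block.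
Qed.

(** An isomorphism reaches the top, so the vertices agree, and then the dimensions
    tell the families and the indices apart. *)
Lemma mmod_inj m m' : iso (mmod m) (mmod m') -> m = m'.
Proof.
case: m m' => [[i s] n] [[j s'] n'] ii.
have ij : i = j.
  apply/eqP; apply: contraT => ij; have [f [g [Hf _ fg _]]] := ii.
  have f0 := @mmod_no_top (i, s, n) (j, s', n') f ij Hf.
  have := congr1 (@usubmx _ n'.+1 _ _) fg; rewrite -mul_usub_mx f0 mul0mx.
  rewrite [X in usubmx X](@scalar_mx_block _ n'.+1) block_mxEv col_mxKu.
  move=> /matrixP/(_ 0 (lshift _ 0))/eqP; rewrite row_mxEl !mxE eqxx eq_sym.
  by rewrite oner_eq0.
subst j; have [] := kron_iso_dim ii.
by case: s {ii}; case: s' => /= e1 [e2]; congr (_, _, _) => //; lia.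
Qed.

Lemma tau_rigid_indecomposable M X : tau_rigid M -> indecomposable X -> summand X M ->
  exists m, iso X (mmod m).
Proof.
move=> Mt Xi /summandP XM.
have [i [t [r [Y [t0 Yo XY]]]]] := indecomposable_kron Xi.
have YM := retract_iso_l XY XM.
have Yi := indecomposable_kindec (indec_iso XY Xi).
have [[n Yn]|[n Yn]] := krigid_classification t0 (tau_rigid_kext0 Mt YM YM) Yi.
  by exists (i, true, n); apply: iso_trans XY (kron_iso i Yn).
by exists (i, false, n); apply: iso_trans XY (kron_iso i Yn).
Qed.

(** [Pk j] detects whether the vertex [j] lies in the support; among the modules
    [mmod] only the simples [(i, false, 0)] have a single vertex as support. *)
Lemma Pk_hom_zero j i s n : (j != i) -> (j = swap i -> (s = false) /\ n = 0%N) ->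
  forall f, mhom (Pk k j) (mmod (i, s, n)) f -> f = 0.
Proof.
move=> ji sj f Hf; apply: (kron_hom_eq (@Qk_onto k 0) Hf (@hom0 _ _ _ _)).
have := Hf; rewrite -{1}[f](@hsubmxK _ _ 1 2) => /hom_kron_from[Ef _ _ _].
rewrite [RHS]linear0 -Ef kron_ev eq_sym (negbTE ji).
have [/eqP|] := boolP (swap i == j); last by rewrite block_mx0 mul0mx.
move=> e; have [s0 n0] := sj (esym e); subst s n.
rewrite -[lsubmx f](@vsubmxK _ 1 0) mul_block_col !mul0mx !add0r.
by rewrite [X in col_mx _ X]flatmx0 -[RHS](@vsubmxK _ 1 0) linear0 [dsubmx _]flatmx0.
Qed.

Lemma Pk_hom_zeroP j i s n : (forall f, mhom (Pk k j) (mmod (i, s, n)) f -> f = 0) ->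
  j != i /\ (j = swap i -> s = false /\ n = 0%N).
Proof.
move=> zero; have [u [_ uE]] := @Pk_bij k.
have si := negbTE (swap_neq i).
have kill (v : 'cV_(n.+1 + (if s then n.+2 else n))) :
    mact (mmod (i, s, n)) (ev k j) *m v = v -> v = 0.
  move=> Ev; have [f' /zero f0] := @kron_extend _ _ _ _ _ _ (mmod (i, s, n)) v uE Ev.
  by rewrite -[v](row_mxKl _ f') f0 linear0.
split.
  apply/negP => /eqP ji; subst j; have := kill (col_mx (const_mx 1) 0).
  rewrite kron_ev /= eqxx si mul_block_col !mul0mx mul1mx !addr0 => /(_ erefl).
  move=> /eqP; rewrite col_mx_eq0 => /andP[/eqP/matrixP/(_ 0 0)/eqP].
  by rewrite !mxE oner_eq0.
move=> ji; subst j; apply: contrapT => sn.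
have r0 : (0 < if s then n.+2 else n)%N by case: s n sn {kill zero} => // -[] // [].
have := kill (col_mx 0 (const_mx 1)).
rewrite kron_ev /= eqxx [i == _]eq_sym si mul_block_col !mul0mx mul1mx !add0r => /(_ erefl).
move=> /eqP; rewrite col_mx_eq0 => /andP[_ /eqP/matrixP/(_ (Ordinal r0) 0)/eqP].
by rewrite !mxE oner_eq0.
Qed.
End RigidModules.

(** * Rays and their compatibility *)

Section Rays.

Definition vtx (b c : bool) : 'I_4 := inord (b.*2 + c).
Definition block (i : 'I_4) : bool := (1 < i)%N.
Definition side (i : 'I_4) : bool := odd i.

Lemma val_vtx b c : vtx b c = b.*2 + c :> nat.
Proof. by rewrite inordK //; case: b; case: c. Qed.
Lemma block_vtx b c : block (vtx b c) = b.
Proof. by rewrite /block val_vtx; case: b; case: c. Qed.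
Lemma side_vtx b c : side (vtx b c) = c.
Proof. by rewrite /side val_vtx; case: b; case: c. Qed.
Lemma vtxE i : vtx (block i) (side i) = i.
Proof. by apply: val_inj; rewrite /= val_vtx /block /side; case: i => [[|[|[|[|//]]]] ?]. Qed.
Lemma swap_vtx b c : swap (vtx b c) = vtx b (~~ c).
Proof.
have e : val (vtx b c) = (b.*2 + c)%N := val_vtx b c.
by apply: val_inj; rewrite /swap e; case: b {e}; case: c; rewrite [RHS]val_vtx /= inordK.
Qed.
(** A block, a sign and a position.  In the coordinates of its block, the ray
    stands for the g-vector [(z + 1, - z)] for the positive sign and
    [(z, - z - 1)] for the negative one. *)
Definition ray : Type := (bool * bool * int)%type.

Definition zpos (c : bool) (n : nat) : int := if c then Negz n else Posz n.
Definition zside (z : int) : bool := if z is Negz _ then true else false.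
Definition zabs (z : int) : nat := match z with Posz n => n | Negz n => n end.

Definition near (z z' : int) : bool := (z <= z' + 1) && (z' <= z + 1).

(** Compatible rays of one block span a cone of the g-vector fan. *)
Definition compat (r r' : ray) : bool :=
  (r.1.1 != r'.1.1) || ((r.1.2 == r'.1.2) && near r.2 r'.2).

Lemma near_zpos c c' n n' : near (zpos c n) (zpos c' n') =
  if c == c' then (n <= n'.+1)%N && (n' <= n.+1)%N else (n == 0%N) && (n' == 0%N).
Proof. by rewrite /near /zpos; case: c; case: c'; rewrite ?NegzE /=; lia. Qed.

Notation summand_index := ('I_4 * bool * nat + 'I_4)%type.

Definition decode (r : ray) : summand_index :=
  let i := vtx r.1.1 (zside r.2) in
  if r.1.2 then inl (i, true, zabs r.2)
  else if zabs r.2 is n.+1 then inl (i, false, n) else inr (swap i).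

(** The left summand is the module [mmod], the right one the shifted projective
    [Pk j], which lies at the end of the negative half-line of the vertex
    [swap j].  The second vertex of a block covers the negative positions. *)
Definition encode (o : summand_index) : ray :=
  match o with
  | inl (i, s, n) => (block i, s, zpos (side i) (if s then n else n.+1))
  | inr j => (block j, false, zpos (~~ side j) 0)
  end.

Lemma decodeK : cancel decode encode.
Proof.
case=> [[b s] z]; rewrite /decode /=; case: s; first by rewrite /= block_vtx side_vtx; case: z.
case e: (zabs z) => [|n] /=; rewrite ?swap_vtx block_vtx side_vtx ?negbK.
  by case: z e => m /= ->.
by case: z e => m /= ->.
Qed.

Lemma encodeK : cancel encode decode.
Proof.
case=> [[[i s] n]|j]; rewrite /decode /=.
  have e m : zside (zpos (side i) m) = side i by case: side.
  have e' m : zabs (zpos (side i) m) = m by case: side.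
  by case: s; rewrite e e' vtxE.
have -> : zside (zpos (~~ side j) 0) = ~~ side j by case: side.
have -> : zabs (zpos (~~ side j) 0) = 0%N by case: side.
by rewrite swap_vtx negbK vtxE.
Qed.

Lemma compatC r r' : compat r r' = compat r' r.
Proof. by rewrite /compat /near eq_sym [r.1.2 == _]eq_sym [X in _ || (_ && X)]andbC. Qed.

Lemma same_block i j : block i = block j -> j = i \/ j = swap i.
Proof.
move=> ij; have := vtxE j; have := vtxE i; rewrite -ij.
case: (side i) => ei; case: (side j) => ej; try by left; apply: etrans (esym ej) ei.
  by right; apply: etrans (esym ej) _; rewrite -[in RHS]ei swap_vtx.
by right; apply: etrans (esym ej) _; rewrite -[in RHS]ei swap_vtx.
Qed.

Lemma block_swap i : block (swap i) = block i.
Proof. by rewrite -{1}(vtxE i) swap_vtx block_vtx. Qed.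
Lemma side_swap i : side (swap i) = ~~ side i.
Proof. by rewrite -{1}(vtxE i) swap_vtx side_vtx. Qed.

Lemma compat_modules i s n i' s' n' :
  compat (encode (inl (i, s, n))) (encode (inl (i', s', n'))) <->
  (i' = i -> [/\ s = s', (n <= n'.+1)%N & (n' <= n.+1)%N]) /\
  (i' = swap i -> [/\ s, s', n = 0%N & n' = 0%N]).
Proof.
rewrite /compat /= near_zpos; split=> [|[same opp]].
  move=> h; split=> e; subst i'; move: h; rewrite ?block_swap ?side_swap eqxx /=.
    by rewrite eqxx; case/andP => /eqP <-; case: s => /= /andP[].
  by case: (side i) => /=; case: s; case: s' => //= /andP[/eqP -> /eqP ->].
have [/same_block[e|e]|//] := eqVneq (block i) (block i').
  have [<- h h'] := same e; rewrite e !eqxx /=; case: (s); by rewrite ?ltnS h h'.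
have [-> -> -> ->] := opp e; rewrite e side_swap.
by case: (side i).
Qed.

Lemma compat_shifted i s n j : compat (encode (inl (i, s, n))) (encode (inr j)) <->
  j != i /\ (j = swap i -> s = false /\ n = 0%N).
Proof.
rewrite /compat /= near_zpos; split=> [h|[ji opp]].
  split=> [|e]; last first.
    subst j; move: h; rewrite block_swap side_swap negbK !eqxx /=.
    by case: s => //= /andP[h _]; split=> //; lia.
  apply/eqP => e; subst j; move: h; rewrite eqxx /=.
  by case: (side i); case: s.
have [/same_block[e|e]|//] := eqVneq (block i) (block j); first by rewrite e eqxx in ji.
by have [-> ->] := opp e; rewrite e side_swap negbK !eqxx.
Qed.

Lemma compat_shifted2 j j' : compat (encode (inr j)) (encode (inr j')).
Proof. by rewrite /compat /= near_zpos /=; case: ifP; rewrite orbT. Qed.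

Arguments encode : simpl never.
Arguments decode : simpl never.

Definition clique (S : seq ray) := {in S &, forall r r', compat r r'}.

Definition ray_modules (S : seq ray) :=
  pmap (fun r => if decode r is inl m then Some m else None) S.
Definition ray_projectives (S : seq ray) :=
  pmap (fun r => if decode r is inr j then Some j else None) S.

Lemma mem_ray_modules S m : (m \in ray_modules S) = (encode (inl m) \in S).
Proof.
rewrite mem_pmap; apply/mapP/idP => [[r Sr]|Sm]; last by exists (encode (inl m)); rewrite ?encodeK.
by case e: (decode r) => [m'|//] [->]; rewrite -e decodeK.
Qed.
Lemma mem_ray_projectives S j : (j \in ray_projectives S) = (encode (inr j) \in S).
Proof.
rewrite mem_pmap; apply/mapP/idP => [[r Sr]|Sm]; last by exists (encode (inr j)); rewrite ?encodeK.
by case e: (decode r) => [//|m'] [->]; rewrite -e decodeK.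
Qed.

Lemma uniq_ray_modules S : uniq S -> uniq (ray_modules S).
Proof.
apply: (@pmap_uniq _ _ _ (fun m => encode (inl m))) => r.
by have := decodeK r; case: (decode r).
Qed.
Lemma uniq_ray_projectives S : uniq S -> uniq (ray_projectives S).
Proof.
apply: (@pmap_uniq _ _ _ (fun j => encode (inr j))) => r.
by have := decodeK r; case: (decode r).
Qed.
Lemma size_rays_split S : (size (ray_modules S) + size (ray_projectives S))%N = size S.
Proof. by elim: S => //= r S <-; case: (decode r) => /= _; rewrite ?addSn ?addnS. Qed.

Lemma sub_rays S T : {subset ray_modules S <= ray_modules T} -> {subset ray_projectives S <= ray_projectives T} -> {subset S <= T}.
Proof.
move=> mST qST r; rewrite -[r]decodeK; case: (decode r) => [m|j].
  by rewrite -!mem_ray_modules; exact: mST.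
by rewrite -!mem_ray_projectives; exact: qST.
Qed.

Lemma rays_exist s q : uniq s -> uniq q -> exists S, [/\ uniq S, ray_modules S = s & ray_projectives S = q].
Proof.
move=> us uq; exists ([seq encode (inl m) | m <- s] ++ [seq encode (inr j) | j <- q]).
have enc_inj := can_inj encodeK.
have i1 : injective (fun m => encode (inl m)) by move=> x y /enc_inj[].
have i2 : injective (fun j => encode (inr j)) by move=> x y /enc_inj[].
split.
- rewrite cat_uniq (map_inj_uniq i1) (map_inj_uniq i2) us uq; apply/and3P; split=> //.
  by apply/hasPn => _ /mapP[j _ ->]; apply/mapP => -[m _ /enc_inj].
- rewrite /ray_modules pmap_cat -[RHS]cats0; congr (_ ++ _).
    by elim: s {us i1} => // m s IH; rewrite map_cons [LHS]/= encodeK /= IH.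
  by elim: q {uq} => // j q IH; rewrite map_cons [LHS]/= encodeK.
- rewrite /ray_projectives pmap_cat -[RHS]cat0s; congr (_ ++ _).
    by elim: s {us} => // m s IH; rewrite map_cons [LHS]/= encodeK.
  by elim: q {uq} => // j q IH; rewrite map_cons [LHS]/= encodeK /= IH.
Qed.
End Rays.

(** * Tau-rigid pairs as sets of rays *)
Section RigidPairs.
Variable k : fieldType.
Local Notation A := (rsz_alg k Q4).
Implicit Types (M N X P : lmodule A) (S T : seq ray) (U V : mpair A).

Definition msum S := fsum (@mmod k) (ray_modules S).
Definition psum S := fsum (@Pk k) (ray_projectives S).
Definition pair_of S : mpair A := (msum S, psum S).

Lemma pair_iso_refl U : pair_iso U U.
Proof. by split; exact: iso_refl. Qed.
Lemma pair_iso_sym U V : pair_iso U V -> pair_iso V U.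
Proof. by move=> [? ?]; split; exact: iso_sym. Qed.
Lemma pair_iso_trans U V (W : mpair A) : pair_iso U V -> pair_iso V W -> pair_iso U W.
Proof. by move=> [a b] [c d]; split; [exact: iso_trans a c | exact: iso_trans b d]. Qed.
Lemma pair_class_eq U V : pair_iso U V -> pair_class U = pair_class V.
Proof.
move=> UV; apply/seteqP; split=> W; first exact/pair_iso_trans/pair_iso_sym.
exact: pair_iso_trans.
Qed.

Lemma msum_summand S m : summand (mmod k m) (msum S) <-> m \in ray_modules S.
Proof. exact: iff_sym (mem_summand_fsum (@mmod_indec k) (@mmod_inj k) _ _). Qed.
Lemma psum_summand S j : summand (Pk k j) (psum S) <-> j \in ray_projectives S.
Proof. exact: iff_sym (mem_summand_fsum (@Pk_indec k) (@Pk_inj k) _ _). Qed.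

(** Self-extensions and extensions between summands force the compatibility
    conditions; the two families in one vertex are separated by [mY_cross]. *)
Lemma tau_rigid_pair_rays U : tau_rigid_pair U ->
  exists S, [/\ uniq S, clique S & pair_iso U (pair_of S)].
Proof.
move=> [[bM bP] Mt PP zero].
have [s us Ms] := basic_iso_fsum bM (fun X Xi => tau_rigid_indecomposable Mt Xi).
have [|q uq Pq] := @basic_iso_fsum _ _ _ (@Pk k) _ bP.
  by move=> X Xi /summandP XP; apply: projective_indec => //; exact: projective_retract PP.
have [S [uS msS qsS]] := rays_exist us uq.
have sM m : m \in s -> retract (mmod k m) U.1.
  by move=> sm; apply: (retract_iso_r (iso_sym Ms)); apply: retract_dsums; exact: map_f.
have qP j : j \in q -> retract (Pk k j) U.2.
  by move=> qj; apply: (retract_iso_r (iso_sym Pq)); apply: retract_dsums; exact: map_f.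
exists S; split=> //.
- have mm i s1 n i' s1' n' : (i, s1, n) \in s -> (i', s1', n') \in s ->
      compat (encode (inl (i, s1, n))) (encode (inl (i', s1', n'))).
    move=> /sM m1 /sM m2; apply/compat_modules; split=> e; subst i'.
      have h1 := tau_rigid_kext0 Mt m1 m2; have h2 := tau_rigid_kext0 Mt m2 m1.
      have ss : s1 = s1'.
        by case: s1 s1' h1 h2 {m1 m2} => -[] // h1 h2; [case: (mY_cross h2) | case: (mY_cross h1)].
      subst s1'; have := mY_kext0P h1; have := mY_kext0P h2.
      by case: s1 {h1 h2 m1 m2}.
    have h1 := tau_rigid_swap Mt (ltn0Sn _) m1 m2.
    have m1' : retract (kron (swap (swap i)) (mY k s1 n)) U.1 by rewrite swapK.
    have h2 := tau_rigid_swap Mt (ltn0Sn _) m2 m1'.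
    move: h1 h2 => /=; case: s1 {m1 m1' m2}; case: s1' => /=; split=> //; lia.
  have mj i s1 n j : (i, s1, n) \in s -> j \in q ->
      compat (encode (inl (i, s1, n))) (encode (inr j)).
    move=> /sM[u [v [Hu _ vu]]] /qP[w [p [_ Hp pw]]].
    apply/compat_shifted/(@Pk_hom_zeroP k) => f Hf.
    have := zero _ (homM (homM Hp Hf) Hu) => e.
    have <- : v *m (u *m (f *m p)) *m w = f by rewrite !mulmxA vu mul1mx -mulmxA pw mulmx1.
    by rewrite e mulmx0 mul0mx.
  move=> r r'; rewrite -[r]decodeK -[r']decodeK.
  case: (decode r) => [[[i s1] n]|j]; case: (decode r') => [[[i' s1'] n']|j'].
  + by rewrite -!mem_ray_modules msS; exact: mm.
  + by rewrite -mem_ray_modules -mem_ray_projectives msS qsS; exact: mj.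
  + by rewrite -mem_ray_modules -mem_ray_projectives msS qsS compatC => qj sm; exact: mj.
  + by move=> _ _; exact: compat_shifted2.
- by split; rewrite /= /msum /psum ?msS ?qsS.
Qed.

(** The presentations of [kron_presentation] reduce the converse to the vanishing of
    extensions between compatible modules. *)
Lemma clique_tau_rigid_pair S : uniq S -> clique S -> tau_rigid_pair (pair_of S).
Proof.
move=> uS cS; split.
- split; [apply: (basic_fsum (@mmod_indec k) (@mmod_inj k)); exact: uniq_ray_modules
         | apply: (basic_fsum (@Pk_indec k) (@Pk_inj k)); exact: uniq_ray_projectives].
- apply: (tau_rigid_dsums (@rsz_rad_sq k Q4)) => _ /mapP[[[i s] n] mS ->].
  have [P1 [P0 [f [p [pres fact]]]]] := kron_presentation i (@mY_onto k s n).
  exists P1, P0, f, p; split=> // _ /mapP[[[i' s'] n'] m'S ->].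
  rewrite !mem_ray_modules in mS m'S; have /compat_modules[same opp] := cS _ _ mS m'S.
  apply: fact => /= e.
    by have [<- h h'] := same e; apply: mY_kext0; case: (s).
  by have [-> _ -> _] := opp e.
- rewrite /= /psum /fsum; elim: (ray_projectives S) => [|j q IH] /=; first exact: projective0.
  by apply: projective_dsum IH; exact: projective_Pk.
- apply: hom_dsums_zero => _ _ /mapP[j jS ->] /mapP[[[i s] n] mS ->] f.
  rewrite mem_ray_projectives in jS; rewrite mem_ray_modules in mS.
  by have /compat_shifted[ji sj] := cS _ _ mS jS; exact: Pk_hom_zero.
Qed.

Lemma num_summands_msum S : uniq S -> num_summands (msum S) (size (ray_modules S)).
Proof. by move=> uS; apply: (num_summands_fsum (@mmod_indec k) (@mmod_inj k)); exact: uniq_ray_modules. Qed.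
Lemma num_summands_psum S : uniq S -> num_summands (psum S) (size (ray_projectives S)).
Proof. by move=> uS; apply: (num_summands_fsum (@Pk_indec k) (@Pk_inj k)); exact: uniq_ray_projectives. Qed.

Lemma clique_support S : uniq S -> clique S -> size S = 4 -> support_tau_tilting (pair_of S).
Proof.
move=> uS cS S4; split; first exact: clique_tau_rigid_pair.
exists (size (ray_modules S)), (size (ray_projectives S)); rewrite size_rays_split S4; split.
- exact: num_summands_msum.
- exact: num_summands_psum.
- exact: num_summands_regular.
Qed.

Lemma clique_almost_complete S : uniq S -> clique S -> size S = 3 -> almost_complete (pair_of S).
Proof.
move=> uS cS S3; split; first exact: clique_tau_rigid_pair.
exists (size (ray_modules S)), (size (ray_projectives S)); rewrite size_rays_split S3; split.
- exact: num_summands_msum.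
- exact: num_summands_psum.
- exact: num_summands_regular.
Qed.

Lemma size_rays U S m p : uniq S -> pair_iso U (pair_of S) -> num_summands U.1 m ->
  num_summands U.2 p -> (m + p)%N = size S.
Proof.
move=> uS [US1 US2] /(num_summands_iso US1) Um /(num_summands_iso US2) Up.
rewrite (num_summands_unique Um (num_summands_msum uS)).
by rewrite (num_summands_unique Up (num_summands_psum uS)) size_rays_split.
Qed.

Lemma support_rays U : support_tau_tilting U ->
  exists S, [/\ uniq S, clique S, size S = 4 & pair_iso U (pair_of S)].
Proof.
move=> [/tau_rigid_pair_rays[S [uS cS US]] [m [p [Um Up Ar]]]]; exists S; split=> //.
by rewrite -(size_rays uS US Um Up); exact: num_summands_unique Ar (num_summands_regular k).
Qed.

Lemma almost_complete_rays U : almost_complete U ->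
  exists S, [/\ uniq S, clique S, size S = 3 & pair_iso U (pair_of S)].
Proof.
move=> [/tau_rigid_pair_rays[S [uS cS US]] [m [p [Um Up Ar]]]]; exists S; split=> //.
apply: succn_inj; rewrite -(size_rays uS US Um Up).
exact: num_summands_unique Ar (num_summands_regular k).
Qed.

Lemma pair_summand_rays U V S T : pair_iso U (pair_of S) -> pair_iso V (pair_of T) ->
  pair_summand U V -> {subset S <= T}.
Proof.
move=> [US1 US2] [VT1 VT2] [/summandP UV1 /summandP UV2]; apply: sub_rays => [m mS|j jS].
  apply/msum_summand/summandP; apply: (retract_iso_r VT1); apply: retract_trans UV1.
  by apply: (retract_iso_r (iso_sym US1)); apply/summandP/msum_summand.
apply/psum_summand/summandP; apply: (retract_iso_r VT2); apply: retract_trans UV2.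
by apply: (retract_iso_r (iso_sym US2)); apply/summandP/psum_summand.
Qed.

Lemma pair_iso_rays S T : pair_iso (pair_of S) (pair_of T) -> {subset S <= T}.
Proof.
move=> ST; apply: (pair_summand_rays (pair_iso_refl (pair_of S)) ST).
by split; apply/summandP/retract_refl.
Qed.

Lemma pair_of_perm S T : perm_eq S T -> pair_iso (pair_of S) (pair_of T).
Proof. by move=> ST; split; apply: fsum_perm; apply: perm_pmap. Qed.

Lemma pair_summand_cons x S : pair_summand (pair_of S) (pair_of (x :: S)).
Proof.
split; apply/summandP; rewrite /= /msum /psum /fsum /ray_modules /ray_projectives /=; case: (decode x) => o /=;
  by [exact: retract_refl | exact: retract_inr].
Qed.
End RigidPairs.

(** * Left mutations *)

Section Mutations.
Variable k : fieldType.
Local Notation A := (rsz_alg k Q4).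
Implicit Types (M N X P : lmodule A) (S T W : seq ray) (U V : mpair A).

Definition cls S : set (mpair A) := pair_class (pair_of k S).

Lemma cls_perm S T : perm_eq S T -> cls S = cls T.
Proof. by move=> ST; apply: pair_class_eq; exact: pair_of_perm. Qed.

Lemma Fac_ray S m : encode (inl m) \in S -> Fac (msum k S) (mmod k m).
Proof. by rewrite -mem_ray_modules => mS; apply: Fac_summand; [exact: mmod_indec | exact/msum_summand]. Qed.

Lemma msum_indec S X : indecomposable X -> summand X (msum k S) ->
  exists2 m, encode (inl m) \in S & iso X (mmod k m).
Proof.
move=> Xi /(summand_fsum (@mmod_indec k) Xi)[m mS Xm].
by exists m; rewrite -?mem_ray_modules.
Qed.

(** The hypothesis on [x'] bounds the new [Fac] by the old one.  The hypothesis on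
    tops takes [mmod k m0] out of the new one: a module generated by others has its
    top covered by their images. *)
Lemma exchange_arrow m0 x' W : let x := encode (inl m0) in
  uniq (x :: W) -> uniq (x' :: W) -> x != x' -> size W = 3 ->
  clique (x :: W) -> clique (x' :: W) ->
  (forall m, x' = encode (inl m) -> Fac (msum k (x :: W)) (mmod k m)) ->
  (forall m f, encode (inl m) \in x' :: W -> mhom (mmod k m) (mmod k m0) f ->
    @usubmx _ m0.2.+1 _ _ f = 0) ->
  mut_arrow (cls (x :: W)) (cls (x' :: W)).
Proof.
move=> x ux ux' xx' W3 cx cx' gen top.
have clW : clique W by move=> r r' rW r'W; apply: cx; rewrite inE ?rW ?r'W orbT.
have uW : uniq W by case/andP: ux.
exists (pair_of k (x :: W)), (pair_of k (x' :: W)); split=> //.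
have sub : Fac (msum k (x' :: W)) `<=` Fac (msum k (x :: W)).
  apply: Fac_sub => X Xi /(msum_indec Xi)[m mS [f [g [Hf Hg fg gf]]]].
  suff Fm : Fac (msum k (x :: W)) (mmod k m).
    by apply: Fac_quotient Fm Hg _; apply/ontoP; exists f.
  move: mS; rewrite inE => /orP[/eqP/esym/gen //|mW].
  by apply: Fac_ray; rewrite inE mW orbT.
split; last first.
  split=> // back; apply: (_ : ~ Fac (msum k (x' :: W)) (mmod k m0)) (back _ (Fac_ray (mem_head x W))).
  pose c : 'M[k]_(m0.2.+1, mdim (mmod k m0)) := row_mx 1%:M 0.
  apply: (@not_Fac _ _ _ _ _ c).
    apply/eqP => /matrixP/(_ 0 (lshift _ 0))/eqP; rewrite row_mxEl !mxE eqxx.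
    by rewrite oner_eq0.
  move=> X Xi /(msum_indec Xi)[m mS [h [g [Hh Hg hg gh]]]] f Hf.
  have Hfg := homM Hg Hf.
  have t0 := top _ _ mS Hfg.
  have -> : f = f *m g *m h by rewrite -mulmxA gh mulmx1.
  rewrite mulmxA; rewrite -[f *m g](@vsubmxK _ m0.2.+1) mul_row_col mul1mx mul0mx addr0.
  by rewrite [usubmx _]t0 mul0mx.
split.
- by apply: clique_support => //=; rewrite W3.
- by apply: clique_support => //=; rewrite W3.
- move=> /pair_iso_rays/(_ x (mem_head x W)); rewrite inE (negbTE xx') /= => xW.
  by case/andP: ux => /negP.
exists (pair_of k W); split; [exact: clique_almost_complete | exact: pair_summand_cons..].
Qed.

(** The case of an exchange inside one block, with the conditions on maps and tops
    expressed by positions.  The neighbour [w] of the removed ray generates the new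
    module, unless the new ray is a shifted projective. *)
Lemma exchange_ray b s c n z' w t a : let z := zpos c (if s then n else n.+1) in
  near z w -> near z' w -> z != w -> z' != w -> z != z' ->
  (forall c' n', z' = zpos c' (if s then n' else n'.+1) ->
    if s then (0 < n')%N && (w == zpos c' n'.-1) else w == zpos c' n'.+2) ->
  (forall n', zpos c (if s then n' else n'.+1) \in [:: z'; w] ->
    if s then (n < n')%N else (n' < n)%N) ->
  let W := [:: (b, s, w); (~~ b, t, a); (~~ b, t, a + 1)] in
  mut_arrow (cls ((b, s, z) :: W)) (cls ((b, s, z') :: W)).
Proof.
move=> z zw z'w z_w z'_w zz' gen top W.
have bb : (b == ~~ b) = false by case: (b).
have zE : (b, s, z) = encode (inl (vtx b c, s, n)).
  by rewrite /encode /= block_vtx side_vtx.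
have uW y : y != w -> uniq ((b, s, y) :: W).
  move=> yw; rewrite /W /= !inE !xpair_eqE !eqxx bb /= (negbTE yw) /= andbT.
  by lia.
have cW y : near y w -> clique ((b, s, y) :: W).
  move=> yw r r'; rewrite !inE => /or4P[]/eqP-> /or4P[]/eqP->;
  rewrite /compat /= ?eqxx ?bb ?[~~ b == b]eq_sym ?bb //= /near; move: yw; rewrite /near; lia.
rewrite zE; apply: exchange_arrow; rewrite -?zE //.
- exact: uW.
- exact: uW.
- by rewrite !xpair_eqE !eqxx.
- exact: cW.
- exact: cW.
- move=> [[j s'] n'] /= [bj ss' e]; subst s'.
  have := gen _ _ e; have := vtxE j; rewrite -bj => <-; rewrite side_vtx.
  have wW v : (b, s, w) = v -> v \in (b, s, z) :: W by move<-; rewrite !inE eqxx orbT.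
  case: (s) in gen e wW *.
    case: n' {e} => // n' /= /eqP e; apply: mmod_gen_true; apply: Fac_ray; apply: wW.
    by rewrite /encode block_vtx side_vtx -e.
  move=> /eqP ew; apply: mmod_gen_false; apply: Fac_ray; apply: wW.
  by rewrite /encode block_vtx side_vtx -ew.
- move=> [[j s'] n'] f jS Hf.
  have [e|ji] := eqVneq j (vtx b c); last exact: (mmod_no_top _ Hf).
  subst j; move: jS; rewrite /encode block_vtx side_vtx => jS.
  have ss' : s' = s.
    move: jS; rewrite !inE !xpair_eqE eqxx bb /= !orbF.
    by case/orP => /andP[/eqP].
  subst s'; apply: mmod_no_top_degree Hf; rewrite /=; apply: top.
  by move: jS; rewrite !inE !xpair_eqE !eqxx bb /= !orbF.
Qed.

Definition quad b s z t a : seq ray :=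
  [:: (b, s, z); (b, s, z + 1); (~~ b, t, a); (~~ b, t, a + 1)].

Definition linked C D := clos_refl_sym_trans _ (@mut_arrow k A) C D.

(** The arrows point away from the middle of the positive line, where the module is
    projective, and towards the middle of the negative line, where the two rays are
    shifted projectives. *)
Lemma quad_step b s z t a : linked (cls (quad b s z t a)) (cls (quad b s (z + 1) t a)).
Proof.
rewrite /quad; set W := [:: (b, s, z + 1); _; _].
have -> : cls [:: (b, s, z + 1), (b, s, z + 1 + 1) & behead W] = cls ((b, s, z + 1 + 1) :: W).
  by apply: cls_perm; rewrite (perm_catCA [:: _] [:: _]).
have to c n : z = zpos c (if s then n else n.+1) ->
    (forall c' n', z + 1 + 1 = zpos c' (if s then n' else n'.+1) ->
    if s then (0 < n')%N && (z + 1 == zpos c' n'.-1) else z + 1 == zpos c' n'.+2) ->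
    (forall n', zpos c (if s then n' else n'.+1) \in [:: z + 1 + 1; z + 1] ->
    if s then (n < n')%N else (n' < n)%N) ->
    linked (cls ((b, s, z) :: W)) (cls ((b, s, z + 1 + 1) :: W)).
  move=> zE gen top; apply: rst_step.
  have := @exchange_ray b s c n (z + 1 + 1) (z + 1) t a; rewrite /= -zE; apply=> //; rewrite /near; lia.
have from c n : z + 1 + 1 = zpos c (if s then n else n.+1) ->
    (forall c' n', z = zpos c' (if s then n' else n'.+1) ->
    if s then (0 < n')%N && (z + 1 == zpos c' n'.-1) else z + 1 == zpos c' n'.+2) ->
    (forall n', zpos c (if s then n' else n'.+1) \in [:: z; z + 1] ->
    if s then (n < n')%N else (n' < n)%N) ->
    linked (cls ((b, s, z) :: W)) (cls ((b, s, z + 1 + 1) :: W)).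
  move=> zE gen top; apply: rst_sym; apply: rst_step.
  have := @exchange_ray b s c n z (z + 1) t a; rewrite /= -zE; apply=> //; rewrite /near; lia.
case: s @W to from => W to from.
  case: z @W to from => [n|[|[|n]]] W to from.
  - by apply: (to false n) => [|[] m|m]; rewrite ?inE /zpos ?NegzE; lia.
  - by apply: (to true 0%N) => [|[] m|m]; rewrite ?inE /zpos ?NegzE; lia.
  - by apply: (from false 0%N) => [|[] m|m]; rewrite ?inE /zpos ?NegzE; lia.
  - by apply: (from true n) => [|[] m|m]; rewrite ?inE /zpos ?NegzE; lia.
case: z @W to from => [n|[|[|n]]] W to from.
- by apply: (from false n.+1) => [|[] m|m]; rewrite ?inE /zpos ?NegzE; lia.
- by apply: (from false 0%N) => [|[] m|m]; rewrite ?inE /zpos ?NegzE; lia.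
- by apply: (to true 0%N) => [|[] m|m]; rewrite ?inE /zpos ?NegzE; lia.
- by apply: (to true n.+1) => [|[] m|m]; rewrite ?inE /zpos ?NegzE; lia.
Qed.

Lemma quad_linked b s z t a : linked (cls (quad b s 0 t a)) (cls (quad b s z t a)).
Proof.
elim/int_ind: z => [|n IH|n IH]; first exact: rst_refl.
  by apply: rst_trans IH _; have := quad_step b s n%:Z t a; rewrite -addn1 PoszD.
apply: rst_trans IH (rst_sym _ _ _ _ _).
by have := quad_step b s (- n.+1%:Z) t a; rewrite -{2}addn1 PoszD opprD addrK.
Qed.

Lemma quad_swap b s z t a : perm_eq (quad b s z t a) (quad (~~ b) t a s z).
Proof. by rewrite /quad negbK (perm_catC [:: _; _] [:: _; _]). Qed.

Lemma quad_origin b s z t a : linked (cls (quad b s 0 t 0)) (cls (quad b s z t a)).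
Proof.
apply: (rst_trans _ _ _ (cls (quad b s 0 t a))); last exact: quad_linked.
by rewrite !(cls_perm (quad_swap b s 0 t _)); exact: quad_linked.
Qed.

Lemma uniq_quad b s z t a : uniq (quad b s z t a).
Proof. by rewrite /quad /= !inE !xpair_eqE !eqxx /=; case: b => /=; lia. Qed.

Lemma clique_quad b s z t a : clique (quad b s z t a).
Proof.
have bb : (b == ~~ b) = false by case: b.
move=> r r'; rewrite !inE => /or4P[]/eqP-> /or4P[]/eqP->;
by rewrite /compat /= ?eqxx ?bb ?[~~ b == b]eq_sym ?bb //= /near; lia.
Qed.

(** Three distinct integers cannot be pairwise at distance one. *)
Lemma clique_block S b : uniq S -> clique S ->
  let T := [seq r <- S | r.1.1 == b] in (size T <= 2)%N /\
  (size T = 2 -> exists s z, perm_eq T [:: (b, s, z); (b, s, z + 1)]).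
Proof.
move=> uS cS T.
have uT : uniq T by exact: filter_uniq.
have cT r r' : r \in T -> r' \in T -> [/\ r.1.1 = b, r'.1.1 = b, r.1.2 = r'.1.2 & near r.2 r'.2].
  rewrite !mem_filter => /andP[/eqP rb rS] /andP[/eqP r'b r'S].
  by have := cS _ _ rS r'S; rewrite /compat rb r'b eqxx => /andP[/eqP].
have neq r r' : r \in T -> r' \in T -> r != r' -> r.2 != r'.2.
  move=> rT r'T; apply: contraNneq => e; have [rb r'b rs _] := cT _ _ rT r'T.
  by case: r r' {rT r'T} rb r'b rs e => [[? ?] ?] [[? ?] ?] /= -> -> -> ->.
case: T uT cT neq => [|r1 [|r2 [|r3 T]]] //= uT cT neq.
  split=> // _; have i1 : r1 \in [:: r1; r2] by rewrite inE eqxx.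
  have i2 : r2 \in [:: r1; r2] by rewrite !inE eqxx orbT.
  have [b1 b2 s12 n12] := cT _ _ i1 i2.
  have r12 : r1 != r2 by move: uT; rewrite inE andbT.
  have z12 := neq _ _ i1 i2 r12.
  case: r1 r2 {i1 i2 cT uT neq r12} b1 b2 s12 n12 z12 => [[b1 s1] z1] [[b2 s2] z2] /= -> -> <-.
  rewrite /near => n12 z12; have [->|->] : z2 = z1 + 1 \/ z1 = z2 + 1 by lia.
    by exists s1, z1.
  exists s1, z2.
  by rewrite (perm_catC [:: _] [:: _]).
have i1 : r1 \in [:: r1, r2, r3 & T] by rewrite inE eqxx.
have i2 : r2 \in [:: r1, r2, r3 & T] by rewrite !inE eqxx orbT.
have i3 : r3 \in [:: r1, r2, r3 & T] by rewrite !inE eqxx !orbT.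
have [_ _ _ n12] := cT _ _ i1 i2; have [_ _ _ n13] := cT _ _ i1 i3; have [_ _ _ n23] := cT _ _ i2 i3.
have [r12 r13 r23] : [/\ r1 != r2, r1 != r3 & r2 != r3].
  by move: uT; rewrite !inE !negb_or => /and4P[/and3P[-> -> _] /andP[-> _] _ _].
have := neq _ _ i1 i2 r12; have := neq _ _ i1 i3 r13; have := neq _ _ i2 i3 r23.
by move: n12 n13 n23; rewrite /near; lia.
Qed.

Lemma clique_quadP S : uniq S -> clique S -> size S = 4 ->
  exists s z t a, perm_eq S (quad false s z t a).
Proof.
move=> uS cS S4.
have SE : perm_eq ([seq r <- S | r.1.1 == false] ++ [seq r <- S | r.1.1 == true]) S.
  rewrite (@eq_filter _ (fun r => r.1.1 == true) (predC (fun r => r.1.1 == false))).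
    by rewrite perm_filterC.
  by move=> r /=; case: (r.1.1).
have := perm_size SE; rewrite size_cat S4.
have [+ +] := clique_block false uS cS; have [+ +] := clique_block true uS cS.
move: SE; set F := [seq r <- S | _ == false]; set T := [seq r <- S | _ == true] => SE T2 TE F2 FE e.
have [sF sT] : size F = 2 /\ size T = 2.
  by move: (size F) (size T) F2 T2 e => x y; lia.
have [s [z {}FE]] := FE sF; have [t [a {}TE]] := TE sT.
exists s, z, t, a; rewrite perm_sym; apply: perm_trans SE.
by rewrite perm_sym (perm_cat FE TE).
Qed.

(** [l] gives the line that is used in each block. *)
Definition labelled (l : bool -> bool) C := exists S,
  [/\ uniq S, clique S, size S = 4, C = cls S & forall r, r \in S -> r.1.2 = l r.1.1].

(** By [clique_block] the three rays common to both pairs cannot lie in one block, and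
    in each block a common ray fixes the sign. *)
Lemma labelled_mutation l U V : mutation U V ->
  labelled l (pair_class U) -> labelled l (pair_class V).
Proof.
move=> [_ /support_rays[T [uT cT T4 VT]] _ [W [/almost_complete_rays[R [uR cR R3 WR]] WU WV]]].
move=> [S [uS cS S4 US lS]]; exists T; split=> //; first exact: pair_class_eq.
have {}US : pair_iso U (pair_of k S).
  by apply: pair_iso_sym; rewrite -[pair_iso _ _]/(cls S U) -US; exact: pair_iso_refl.
have RS := pair_summand_rays WR US WU; have RT := pair_summand_rays WR VT WV.
have hb b : exists2 r, r \in R & r.1.1 = b.
  have [Rb _] := clique_block (~~ b) uR cR.
  suff /hasP[r rR /eqP rb] : has (fun r : ray => r.1.1 == b) R by exists r.
  apply: contraLR Rb => /hasPn h; rewrite (@eq_in_filter _ _ predT).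
    by rewrite filter_predT R3.
  by move=> r /h /=; case: (b); case: (r.1.1).
move=> r rT; have [r' r'R r'b] := hb r.1.1.
have := cT _ _ rT (RT _ r'R); rewrite /compat r'b eqxx => /andP[/eqP -> _].
by rewrite -r'b; apply/lS/RS.
Qed.

Lemma labelled_linked l C D : linked C D -> labelled l C <-> labelled l D.
Proof.
elim=> {C D} [C D [U [V [-> -> [m _]]]]|//|C D _ IH|C D E _ IH1 _ IH2].
- split; apply: labelled_mutation => //.
  have [sU sV UV [W [aW WU WV]]] := m; split=> //; last by exists W.
  by move=> /pair_iso_sym.
- exact: iff_sym.
- exact: iff_trans IH1 IH2.
Qed.

Lemma labelled_quad l s z t a : labelled l (cls (quad false s z t a)) -> s = l false /\ t = l true.
Proof.
move=> [S [_ _ _ e lS]].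
have SE : pair_iso (pair_of k S) (pair_of k (quad false s z t a)).
  by rewrite -[pair_iso _ _]/(cls S _) -e; exact: pair_iso_refl.
have lq r : r \in quad false s z t a -> r.1.2 = l r.1.1.
  by move=> /(pair_iso_rays (pair_iso_sym SE))/lS.
by split; [apply: (lq (false, s, z)) | apply: (lq (true, t, a))]; rewrite !inE eqxx ?orbT.
Qed.

(** One base point for each choice of lines. *)
Definition component (st : bool * bool) := mut_component (cls (quad false st.1 0 st.2 0)).

Lemma vertex_quad s z t a : mut_vertices (cls (quad false s z t a)).
Proof.
exists (pair_of k (quad false s z t a)) => //.
by apply: clique_support => //; [exact: uniq_quad | exact: clique_quad].
Qed.

Lemma component_inj : injective component.
Proof.
move=> [s t] [s' t'] e.
have : component (s, t) (cls (quad false s 0 t 0)) by split; [exact: vertex_quad | exact: rst_refl].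
rewrite e => -[_ /(labelled_linked (fun b => if b then t else s))] [_ lab].
have [|-> -> //] := @labelled_quad (fun b => if b then t else s) s' 0 t' 0.
apply: lab; exists (quad false s 0 t 0).
split=> //; [exact: uniq_quad | exact: clique_quad |].
by move=> r; rewrite !inE => /or4P[]/eqP->.
Qed.

Lemma components_quad : mut_components A = component @` setT.
Proof.
apply/seteqP; split=> [_ [_ [U sU <-] <-]|_ [[s t] _ <-]]; last first.
  by exists (cls (quad false s 0 t 0)) => //; exact: vertex_quad.
have [S [uS cS S4 US]] := support_rays sU.
have [s [z [t [a ST]]]] := clique_quadP uS cS S4.
have UE : pair_class U = cls (quad false s z t a) by rewrite (pair_class_eq US) -(cls_perm ST).
exists (s, t) => //; rewrite UE /component /=.
have q0 := quad_origin false s z t a.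
by apply/seteqP; split=> D [vD CD]; split=> //;
  [exact: rst_trans (rst_sym _ _ _ _ q0) CD | exact: rst_trans q0 CD].
Qed.
End Mutations.

Theorem lemma3p9 (k : fieldType) : mut_components (rsz_alg k Q4) #= `I_4.
Proof.
rewrite components_quad.
apply: card_eq_trans (inj_card_eq _) _; first by move=> x y _ _; exact: component_inj.
have <- : (fun st : bool * bool => (st.1.*2 + st.2)%N) @` setT = `I_4.
  apply/seteqP; split=> [_ [[[] []] _ <-] //|n /=].
  by case: n => [|[|[|[|//]]]] _; [exists (false, false)|exists (false, true)|exists (true, false)|exists (true, true)].
rewrite card_eq_sym; apply: inj_card_eq.
by move=> [[] []] [[] []] _ _.
Qed.
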